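(* (1) Let $\mathfrak{n}$ be a filiform Lie algebra of the class $A_2$ of dimension $n\ge 8$. Then $\mathfrak{n}$ is an Einstein nilradical if and only if it is isomorphic either to $\mathcal{V}(n)$ or to one of the following algebras: $\mathfrak{g}_\alpha(8)$ with $\alpha\neq-2$; $\mathfrak{g}_\alpha(9)$ with $\alpha\ne-2$; $\mathfrak{g}_\alpha(10)$ with $\alpha\neq-2,-1,\frac12$; $\mathfrak{g}_\alpha(11)$. (Here $\alpha\in\mathbb{R}$ ranges over the values for which the respective algebra is defined.) (2) The class $B_2$ consists, up to isomorphism, of the six algebras $\mathfrak{b}(6)$, $\mathfrak{b}(8)$, $\mathfrak{b}_1(10)$, $\mathfrak{b}_2(10)$, $\mathfrak{b}_{+}(12)$, $\mathfrak{b}_{-}(12)$. All of them are Einstein nilradicals.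
   Context: All Lie algebras are real and finite-dimensional. In the lists of relations below, all brackets of basis vectors $e_i,e_j$ not determined by the listed ones and skew-symmetry are zero. **Einstein nilradical.** For a nilpotent Lie algebra $\mathfrak{n}$ with an inner product $\langle\cdot,\cdot\rangle$, the Ricci operator $\mathrm{ric}_{\mathfrak{n}}$ is the symmetric operator determined by $\operatorname{Tr}(\mathrm{ric}_{\mathfrak{n}}\circ A)=\frac14\sum_{i,j}\langle A[E_i,E_j]-[AE_i,E_j]-[E_i,AE_j],[E_i,E_j]\rangle$ for all $A\in\operatorname{End}(\mathfrak{n})$, where $\{E_i\}$ is an orthonormal basis. $\mathfrak{n}$ is an Einstein nilradical if it admits an inner product, a constant $c<0$ and a derivation $D\in\operatorname{Der}(\mathfrak{n})$ such that $\mathrm{ric}_{\mathfrak{n}}=c\,\mathrm{id}_{\mathfrak{n}}+D$. (Equivalently, $\mathfrak{n}$ is the nilradical of a solvable Lie algebra with an Einstein inner product of negative scalar curvature.) **Filiform.** A nilpotent Lie algebra of dimension $n$ is filiform if its descending central series has the maximal possible length $n-1$. **Class $A_2$.** An $n$-dimensional Lie algebra ($n\ge5$) is of class $A_2$ if it has a basis $e_1,\dots,e_n$ with $[e_1,e_i]=e_{i+1}$ for $i=2,\dots,n-1$, and $[e_i,e_j]=c_{ij}e_{i+j}$ for $i,j\ge2$, $i+j\le n$, where not all the $c_{ij}$ are zero. **Class $B_2$.** An $n$-dimensional Lie algebra ($n\ge 6$ even) is of class $B_2$ if it has a basis $e_1,\dots,e_n$ with $[e_1,e_i]=e_{i+1}$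 for $i=2,\dots,n-2$; $[e_i,e_j]=c_{ij}e_{i+j}$ for $i,j\ge2$, $i+j\le n-1$, where not all the $c_{ij}$ are zero; and $[e_i,e_{n+1-i}]=(-1)^ie_n$ for $i=2,\dots,n-1$. (Equivalently, it is filiform of rank one, i.e. with maximal torus of derivations of dimension one, and admits a derivation with eigenvalues $1,2,\dots,n-1,n+1$.) **The algebras $\mathcal{V}(n)$, $\mathfrak{m}_2(5)$.** $\mathcal{V}(n)$, $n\ge4$: $[e_i,e_j]=(j-i)e_{i+j}$, $i+j\le n$. $\mathfrak{m}_2(5)$: $[e_1,e_i]=e_{i+1}$, $i=2,3,4$; $[e_2,e_3]=e_5$. **The algebras $\mathfrak{g}_\alpha(n)$, $\alpha\in\mathbb{R}$** (basis $e_1,\dots,e_n$): - $\mathfrak{g}_\alpha(7)$: $[e_1,e_i]=e_{i+1}$, $i=2,\dots,6$; $[e_2,e_3]=(2+\alpha)e_5$, $[e_2,e_4]=(2+\alpha)e_6$, $[e_2,e_5]=(1+\alpha)e_7$, $[e_3,e_4]=e_7$. - $\mathfrak{g}_\alpha(8)$: relations of $\mathfrak{g}_\alpha(7)$ and $[e_1,e_7]=e_8$, $[e_2,e_6]=\alpha e_8$, $[e_3,e_5]=e_8$. - $\mathfrak{g}_\alpha(9)$, $\alpha\neq-\frac52$: relations of $\mathfrak{g}_\alpha(8)$ and $[e_1,e_8]=e_9$, $[e_2,e_7]=\frac{2\alpha^2+3\alpha-2}{2\alpha+5}e_9$, $[e_3,e_6]=\frac{2\alpha+2}{2\alpha+5}e_9$,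 $[e_4,e_5]=\frac{3}{2\alpha+5}e_9$. - $\mathfrak{g}_\alpha(10)$, $\alpha\neq-\frac52$: relations of $\mathfrak{g}_\alpha(9)$ and $[e_1,e_9]=e_{10}$, $[e_2,e_8]=\frac{2\alpha^2+\alpha-1}{2\alpha+5}e_{10}$, $[e_3,e_7]=\frac{2\alpha-1}{2\alpha+5}e_{10}$, $[e_4,e_6]=\frac{3}{2\alpha+5}e_{10}$. - $\mathfrak{g}_\alpha(11)$, $\alpha\neq-3,-\frac52,-1$: relations of $\mathfrak{g}_\alpha(10)$ and $[e_1,e_{10}]=e_{11}$, $[e_2,e_9]=\frac{2\alpha^3+2\alpha^2+3}{2(\alpha^2+4\alpha+3)}e_{11}$, $[e_3,e_8]=\frac{4\alpha^3+8\alpha^2-8\alpha-21}{2(\alpha^2+4\alpha+3)(2\alpha+5)}e_{11}$, $[e_4,e_7]=\frac{3(2\alpha^2+4\alpha+5)}{2(\alpha^2+4\alpha+3)(2\alpha+5)}e_{11}$, $[e_5,e_6]=\frac{3(4\alpha+1)}{2(\alpha^2+4\alpha+3)(2\alpha+5)}e_{11}$. **The algebras $\mathfrak{b}$.** Each is obtained from an algebra $\mathfrak{n}'$ of odd dimension $n-1$ with basis $e_1,\dots,e_{n-1}$ by adding a central basis vector $e_n$, keeping the relations of $\mathfrak{n}'$, and adding the relations $[e_i,e_{n+1-i}]=(-1)^ie_n$ for $i=2,\dots,n/2$: - $\mathfrak{b}(6)$: $\mathfrak{n}'=\mathfrak{m}_2(5)$; - $\mathfrak{b}(8)$: $\mathfrak{n}'=\mathfrak{g}_{-5/2}(7)$;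 - $\mathfrak{b}_1(10)$: $\mathfrak{n}'=\mathfrak{g}_{-1}(9)$; - $\mathfrak{b}_2(10)$: $\mathfrak{n}'=\mathfrak{g}_{-3}(9)$; - $\mathfrak{b}_{\pm}(12)$: $\mathfrak{n}'=\mathfrak{g}_{\alpha}(11)$ with $\alpha=\frac{-4\pm\sqrt{10}}{2}$. *)

(* Defs.v *)
From HB Require Import structures.
From mathcomp Require Import all_boot all_order all_algebra.
From mathcomp Require Import sesquilinear reals.

Set Implicit Arguments.
Unset Strict Implicit.
Unset Printing Implicit Defensive.

Import Order.TTheory GRing.Theory Num.Theory.

Local Open Scope ring_scope.

(* A Lie algebra is a finite-dimensional real vector space V with a bracket
   br : V -> V -> V satisfying is_lie. *)
Record is_lie (R : realType) (V : vectType R) (br : V -> V -> V) : Prop :=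
  IsLie {
    lie_linearl : forall y, linear (br^~ y);
    lie_linearr : forall x, linear (br x);
    lie_alt : forall x, br x x = 0;
    lie_jacobi : forall x y z,
      br x (br y z) + br y (br z x) + br z (br x y) = 0
  }.

Definition lie_isom (R : realType) (V W : vectType R)
    (brV : V -> V -> V) (brW : W -> W -> W) : Prop :=
  exists f : 'Hom(V, W),
    bijective f /\ forall x y, f (brV x y) = brW (f x) (f y).

Definition derivation (R : realType) (V : vectType R) (br : V -> V -> V)
    (D : 'End(V)) : Prop :=
  forall x y, D (br x y) = br (D x) y + br x (D y).

(* Descending central series, starting at the whole algebra for k = 0; as br is
   bilinear, brackets of basis vectors span [V, U]. *)
Definition lcs (R : realType) (V : vectType R) (br : V -> V -> V) (k : nat)
    : {vspace V} :=
  iter k (fun U : {vspace V} =>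
            <<[seq br x y | x <- vbasis {:V}, y <- vbasis U]>>%VS) {:V}%VS.

Definition nilpotent_lie (R : realType) (V : vectType R)
    (br : V -> V -> V) : Prop :=
  is_lie br /\ exists k, lcs br k = 0%VS.

Definition filiform (R : realType) (V : vectType R)
    (br : V -> V -> V) : Prop :=
  nilpotent_lie br /\
  let m := (\dim {:V}).-1 in
  lcs br m = 0%VS /\ forall k, (k < m)%N -> lcs br k <> 0%VS.

Definition lftrace (R : realType) (V : vectType R) (f : 'End(V)) : R :=
  \tr (passmx.mxof (vbasis {:V}) (vbasis {:V}) f).

Definition is_ricci (R : realType) (V : vectType R) (br : V -> V -> V)
    (ip : {dot V for idfun}) (ric : 'End(V)) : Prop :=
  (forall x y, ip (ric x) y = ip x (ric y)) /\
  exists E : seq V,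
    [/\ basis_of {:V} E, orthonormal ip E &
        forall A : 'End(V),
          lftrace (ric \o A)%VF =
          4%:R^-1 * \sum_(x <- E) \sum_(y <- E)
            ip (A (br x y) - br (A x) y - br x (A y)) (br x y)].

Definition einstein_nilradical (R : realType) (V : vectType R)
    (br : V -> V -> V) : Prop :=
  nilpotent_lie br /\
  exists (ip : {dot V for idfun}) (c : R) (D ric : 'End(V)),
    [/\ is_ricci br ip ric, c < 0, derivation br D &
        ric = c *: \1%VF + D].

(* In both classes the basis is e 1, ..., e n, and the values of e and c outside
   the stated ranges of indices are irrelevant; that n is the dimension follows
   from basis_of. The brackets br (e i) (e 1) are given by skew-symmetry. *)
Definition classA2 (R : realType) (V : vectType R) (br : V -> V -> V)
    (n : nat) : Prop :=
  is_lie br /\ (5 <= n)%N /\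
  exists (e : nat -> V) (c : nat -> nat -> R),
    basis_of {:V} [seq e i | i <- iota 1 n] /\
    [/\ forall i, (2 <= i)%N -> (i <= n.-1)%N -> br (e 1%N) (e i) = e i.+1,
        br (e 1%N) (e n) = 0,
        forall i j, (2 <= i)%N -> (2 <= j)%N -> (i + j <= n)%N ->
          br (e i) (e j) = c i j *: e (i + j)%N,
        forall i j, (2 <= i <= n)%N -> (2 <= j <= n)%N -> (n < i + j)%N ->
          br (e i) (e j) = 0 &
        exists i j, [/\ (2 <= i)%N, (2 <= j)%N, (i + j <= n)%N & c i j <> 0]].

Definition classB2 (R : realType) (V : vectType R) (br : V -> V -> V)
    (n : nat) : Prop :=
  is_lie br /\ (6 <= n)%N /\ ~~ odd n /\
  exists (e : nat -> V) (c : nat -> nat -> R),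
    basis_of {:V} [seq e i | i <- iota 1 n] /\
    [/\ forall i, (2 <= i)%N -> (i <= n.-2)%N -> br (e 1%N) (e i) = e i.+1,
        forall i, (n.-1 <= i <= n)%N -> br (e 1%N) (e i) = 0,
        forall i j, (2 <= i)%N -> (2 <= j)%N -> (i + j <= n.-1)%N ->
          br (e i) (e j) = c i j *: e (i + j)%N,
        forall i, (2 <= i)%N -> (i <= n.-1)%N ->
          br (e i) (e (n.+1 - i)%N) = (-1) ^+ i *: e n &
        forall i j, (2 <= i <= n)%N -> (2 <= j <= n)%N -> (n <= i + j)%N ->
          (i + j)%N <> n.+1 -> br (e i) (e j) = 0] /\
    exists i j, [/\ (2 <= i)%N, (2 <= j)%N, (i + j <= n.-1)%N & c i j <> 0].

(* The skew-symmetric bracket on R^n with [e_i, e_j] = \sum_k s i j k e_k for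
   1 <= i < j <= n, where e_1, ..., e_n is the standard basis: the relations are
   indexed from 1, the coordinates from 0. *)
Definition sc_bracket (R : realType) (n : nat) (s : nat -> nat -> nat -> R)
    (x y : 'rV[R]_n) : 'rV[R]_n :=
  \row_k \sum_(i < n) \sum_(j < n | (i < j)%N)
    (x 0 i * y 0 j - x 0 j * y 0 i) * s i.+1 j.+1 k.+1.

(* [e_i, e_j] = c i j e_(i+j); there is no such e_(i+j) in R^n for i + j > n. *)
Definition graded_sc (R : realType) (c : nat -> nat -> R) (i j k : nat) : R :=
  if k == (i + j)%N then c i j else 0.

Definition V_bracket (R : realType) (n : nat)
    : 'rV[R]_n -> 'rV[R]_n -> 'rV[R]_n :=
  sc_bracket (graded_sc (fun i j => j%:R - i%:R)).

Definition m2_coef (R : realType) (i j : nat) : R :=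
  match i, j with
  | 1%N, _ => 1
  | 2%N, 3%N => 1
  | _, _ => 0
  end.

(* The relations of g_alpha(n) are those of g_alpha(11) with i + j <= n, so one
   table serves all n. The denominators vanish only at values of alpha for which
   the algebras involving them are not defined. *)
Definition g_coef (R : realType) (a : R) (i j : nat) : R :=
  let d := 2 * a + 5 in
  let q := 2 * (a ^+ 2 + 4 * a + 3) in
  match i, j with
  | 1%N, _ => 1
  | 2%N, 3%N => 2 + a
  | 2%N, 4%N => 2 + a
  | 2%N, 5%N => 1 + a
  | 3%N, 4%N => 1
  | 2%N, 6%N => a
  | 3%N, 5%N => 1
  | 2%N, 7%N => (2 * a ^+ 2 + 3 * a - 2) / d
  | 3%N, 6%N => (2 * a + 2) / d
  | 4%N, 5%N => 3 / d
  | 2%N, 8%N => (2 * a ^+ 2 + a - 1) / d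
  | 3%N, 7%N => (2 * a - 1) / d
  | 4%N, 6%N => 3 / d
  | 2%N, 9%N => (2 * a ^+ 3 + 2 * a ^+ 2 + 3) / q
  | 3%N, 8%N => (4 * a ^+ 3 + 8 * a ^+ 2 - 8 * a - 21) / (q * d)
  | 4%N, 7%N => 3 * (2 * a ^+ 2 + 4 * a + 5) / (q * d)
  | 5%N, 6%N => 3 * (4 * a + 1) / (q * d)
  | _, _ => 0
  end.

Definition g_bracket (R : realType) (a : R) (n : nat)
    : 'rV[R]_n -> 'rV[R]_n -> 'rV[R]_n :=
  sc_bracket (graded_sc (g_coef a)).

(* The algebra with relations c on e_1, ..., e_(n-1), extended by a central e_n
   and [e_i, e_(n+1-i)] = (-1)^i e_n for i >= 2; i < j restricts i to i <= n/2. *)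
Definition central_sc (R : realType) (n : nat) (c : nat -> nat -> R)
    (i j k : nat) : R :=
  if k == n then (if (2 <= i)%N && (i + j == n.+1)%N then (-1) ^+ i else 0)
  else graded_sc c i j k.

Inductive b_algebra : Set :=
  B6 | B8 | B10_1 | B10_2 | B12_plus | B12_minus.

Definition b_dim (b : b_algebra) : nat :=
  match b with
  | B6 => 6
  | B8 => 8
  | B10_1 | B10_2 => 10
  | B12_plus | B12_minus => 12
  end.

Definition b_coef (R : realType) (b : b_algebra) : nat -> nat -> R :=
  match b with
  | B6 => @m2_coef R
  | B8 => g_coef (- (5 / 2))
  | B10_1 => g_coef (-1)
  | B10_2 => g_coef (-3)
  | B12_plus => g_coef ((-4 + Num.sqrt 10) / 2)
  | B12_minus => g_coef ((-4 - Num.sqrt 10) / 2)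
  end.

Definition b_bracket (R : realType) (b : b_algebra)
    : 'rV[R]_(b_dim b) -> 'rV[R]_(b_dim b) -> 'rV[R]_(b_dim b) :=
  sc_bracket (central_sc (b_dim b) (b_coef R b)).

(* Main.v *)
(* In a basis (e_a) indexed by degrees a with [e_a, e_b] = C_ab e_(a+b), take a
   diagonal inner product with squared lengths g_a and put
   x_ab = C_ab^2 g_(a+b) / (g_a g_b).  Pairing the Ricci operator with a diagonal
   operator T gives, up to a factor, the sum of x_ab (T_a + T_b - T_(a+b)), so that
   ric = c id + l N, N being the degree derivation, becomes a linear condition on x.
   Conversely each solution x which is positive exactly where C is nonzero comes from
   some g: minimise a convex function (Birch's theorem).  If [e_1, e_i] = e_(i+1)
   and some other bracket is nonzero, every derivation is triangular with diagonal
   proportional to the degree, so the derivation of an Einstein metric has a graded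
   eigenbasis with the same constants C, orthogonal because ric is symmetric.  Being
   an Einstein nilradical is thus a linear programming question on the set of
   nonzero C_ab: tables settle feasibility, single test vectors T infeasibility.
   The Jacobi identity leaves c_23, c_34, c_45, c_56 as the only parameters of the
   class A_2 as long as c_34 is nonzero, and these reduce to alpha = c_23 / c_34 - 2
   for n <= 11 and leave only V(n) for n >= 12; all algebras with c_34 = 0 are
   infeasible.  In the class B_2, the Jacobi identity of e_2, e_3, e_(n-4) excludes
   c_34 = 0 and n >= 14, and it is an equation for alpha for n = 8, 10, 12. *)
Require Import Defs.
From HB Require Import structures.
From mathcomp Require Import all_boot all_order all_algebra.
From mathcomp Require Import sesquilinear reals.
From mathcomp Require Import boolp.
From mathcomp Require classical_sets topology normedtype derive realfun exp sequences.
From mathcomp Require Import ring lra zify.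

Set Implicit Arguments.
Unset Strict Implicit.
Unset Printing Implicit Defensive.

Import Order.TTheory GRing.Theory Num.Theory.

Local Open Scope ring_scope.

(** Feasibility sees only which constants vanish, so scaling e_2, ..., e_n by a common factor, which
    multiplies all c_ij by it, is harmless and c_34 can be normalised to 1; the dimensions 8 to 11
    then split into finitely many vanishing patterns. Pairing with T_k = k kills every bracket term,
    so the ratio of [s] to [mu] is forced; on the degrees 1, ..., n it is (2n + 1) : 3, whence the
    weights 2n + 1 - 3k of all test vectors. Uniqueness of structure constants is an induction on
    the weight i + j: once lower weights are known, the Jacobi identity with e_1 leaves one
    alternating unknown per weight, killed by skew-symmetry in even weight and, from weight 9 on, by
    e_2, e_3 and a third vector in odd weight unless a certain sum vanishes. In class B_2 exactly
    this sum has to vanish. Giving e_n the degree n + 1 makes that class graded as well. Its members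
    of equal dimension are told apart by c_23 / c_34, an invariant because [e_2, e_(n-1)] is nonzero
    and prevents e_2 from acquiring an e_1-component. *)

(** * Birch's theorem: balancing a metric by a convex minimum *)

Module Balance.
Import classical_sets topology normedtype derive realfun exp sequences.
Import numFieldNormedType.Exports.

Lemma continuous_sum (R : realType) (T : topologicalType) m (F : 'I_m -> T -> R) :
  (forall k, continuous (F k)) -> continuous (fun x => \sum_k F k x).
Proof.
move=> Fc; apply: (@continuous_big _ _ _ _ xpredT) => // -[y z].
exact: add_continuous.
Qed.

(** For s >= 0 the exponential dominates s^2 / 2, and what remains is the square (C / 2) (s - 2 x /
    C)^2; completing it costs 2 x^2 / C. For s < 0 the term - x s already equals x |s|. *)
Lemma term_coercive (R : realType) (C x s : R) : 0 < C -> 0 < x ->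
  x * `|s| - 2 * x ^+ 2 / C <= C * expR s - x * s.
Proof.
move=> C0 x0; have q0 : 0 <= 2 * x ^+ 2 / C.
  by rewrite mulr_ge0 ?mulr_ge0 ?sqr_ge0 ?invr_ge0 ?ltW.
case: (lerP 0 s) => s0; last first.
  by rewrite ltr0_norm//; have := mulr_gt0 C0 (expR_gt0 s); lra.
rewrite ger0_norm//.
have := expR_ge1Dxn 1 s0; rewrite (_ : 2`!%:R = 2 :> R)// => e2.
have : C * (s ^+ 2 / 2) <= C * expR s by rewrite ler_pM2l//; lra.
suff : 0 <= C * (s ^+ 2 / 2) - x * s - (x * s - 2 * x ^+ 2 / C) by lra.
have -> : C * (s ^+ 2 / 2) - x * s - (x * s - 2 * x ^+ 2 / C)
   = C / 2 * (s - 2 * x / C) ^+ 2 by field; rewrite gt_eqF.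
by rewrite mulr_ge0 ?sqr_ge0 ?divr_ge0 ?ltW.
Qed.

(** Inverting exp (- u) >= 1 - u bounds exp u by 1 / (1 - u), and (1 - u) (1 + u + 2 u^2) = 1 + u^2
    (1 - 2 u) >= 1. *)
Lemma expR_le_quadratic (R : realType) (u : R) :
  `|u| <= 2^-1 -> expR u <= 1 + u + 2 * u ^+ 2.
Proof.
rewrite ler_norml => /andP[u1 u2].
have u3 : 0 < 1 - u by lra.
have := expR_ge1Dx (- u); rewrite expRN -{1}[1 - u]invrK lef_pV2 ?posrE ?invr_gt0 ?expR_gt0//.
move=> /le_trans; apply.
by rewrite -div1r ler_pdivrMr//; nra.
Qed.

(** The first-order condition at a minimum, with a quadratic remainder in place of a derivative. *)
Lemma linear_term_eq0 (R : realFieldType) (d G K : R) : 0 < d -> 0 <= K ->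
  (forall e, `|e| <= d -> 0 <= e * G + e ^+ 2 * K) -> G = 0.
Proof.
move=> d0 K0 H; apply/eqP; rewrite -[_ == _]negbK; apply/negP => G0.
(* The summand |G| / d keeps the step - G / z within [- d, d]; the summand K + 1 makes z exceed K,
   so that the value (G / z)^2 (K - z) is negative. *)
pose z := K + 1 + `|G| / d.
have z0 : 0 < z by rewrite ltr_wpDr ?divr_ge0// ?ltW// ltr_wpDl.
have := H (- (G / z)).
rewrite normrN normrM [`|z^-1|]gtr0_norm ?invr_gt0// ler_pdivrMr//.
have -> : `|G| <= d * z.
  rewrite /z mulrDr mulrCA divff ?gt_eqF// mulr1 lerDr.
  by rewrite mulr_ge0 ?addr_ge0// ltW.
move=> /(_ isT); apply/negP; rewrite -ltNge.
have -> : - (G / z) * G + (- (G / z)) ^+ 2 * K = (G / z) ^+ 2 * (K - z).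
  by field; rewrite gt_eqF.
rewrite pmulr_rlt0 ?exprn_even_gt0//= ?mulf_neq0 ?invr_neq0// ?gt_eqF//.
by rewrite /z -addrA opprD addrA subrr add0r oppr_lt0 ltr_pwDl// divr_ge0// ltW.
Qed.

(* The gradient of \sum_k (C_k exp s_k - x_k s_k) at its minimum over the row space of
   A, which is attained since every summand is coercive. *)
Lemma birch_balance (R : realType) (n m : nat) (A : 'M[R]_(n, m)) (C x : 'I_m -> R) :
  (forall k, 0 < C k) -> (forall k, 0 < x k) ->
  exists t : 'rV[R]_n, forall i,
    \sum_k (C k * expR ((t *m A) 0 k) - x k) * A i k = 0.
Proof.
move=> C0 x0.
pose h (s : 'rV[R]_m) := \sum_k (C k * expR (s 0 k) - x k * s 0 k).
(* A continuous function vanishing exactly on the row space of [A], so that [K] is closed. *)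
pose g (s : 'rV[R]_m) := \sum_k `|\sum_l s 0 l * cokermx A l k|.
pose K := [set s : 'rV[R]_m | g s <= 0 /\ h s <= h 0]%classic.
have hc : continuous h.
  have cs (k : 'I_m) : continuous (fun s : 'rV[R]_m => s 0 k).
    by move=> s; exact: coord_continuous.
  apply: continuous_sum => k s.
  apply: (@continuousB _ _ _ (fun s : 'rV[R]_m => C k * expR (s 0 k))
           (fun s => x k * s 0 k)).
    apply: (@continuousM _ _ (fun=> C k) (fun s : 'rV[R]_m => expR (s 0 k))).
      exact: cst_continuous.
    apply: (continuous_comp (f := fun s : 'rV[R]_m => s 0 k)); first exact: cs.
    exact: continuous_expR.
  by apply: (@continuousM _ _ (fun=> x k)); [exact: cst_continuous|exact: cs].
have gc : continuous g.
  apply: continuous_sum => k s.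
  apply: (continuous_comp (f := fun s : 'rV[R]_m => \sum_l s 0 l * cokermx A l k));
    last exact: norm_continuous.
  move: s; apply: continuous_sum => l s.
  apply: (@continuousM _ _ (fun s : 'rV[R]_m => s 0 l) (fun=> cokermx A l k)).
    exact: coord_continuous.
  exact: cst_continuous.
have Kc : compact K.
  apply: bounded_closed_compact.
    pose M := h 0 + \sum_k 2 * x k ^+ 2 / C k.
    have hM s : h s <= h 0 -> forall k, `|s 0 k| <= M / x k.
      move=> hs k; rewrite ler_pdivlMr// mulrC.
      have : \sum_k (x k * `|s 0 k| - 2 * x k ^+ 2 / C k) <= h s.
        by apply: ler_sum => l _; exact: term_coercive.
      rewrite sumrB => h1.
      have : x k * `|s 0 k| <= \sum_k x k * `|s 0 k|.
        rewrite (bigD1 k)//= lerDl sumr_ge0// => l _.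
        by rewrite mulr_ge0// ltW.
      by move: hs h1; rewrite /M; lra.
    have M0 k : 0 <= M / x k by apply: le_trans (hM 0 _ k).
    exists (\sum_k M / x k); split; first exact: num_real.
    move=> B MB s /= [_ hs]; rewrite /Num.norm/= mx_normrE.
    have MB' : \sum_k M / x k <= B by exact: ltW.
    apply: bigmax_le => [|[i j] _ /=]; first by apply: le_trans MB'; apply: sumr_ge0.
    apply: le_trans MB'; rewrite (ord1 i) (bigD1 j)//=.
    by apply: le_trans (hM s hs j) _; rewrite lerDl sumr_ge0.
  apply: closedI.
    apply: (@preimage_closed _ _ g [set y | y <= 0]%classic); last exact: closed_le.
    by move=> y _; exact: gc.
  apply: (@preimage_closed _ _ h [set y | y <= h 0]%classic); last exact: closed_le.
  by move=> y _; exact: hc.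
have gP s : (g s <= 0) = (s <= A)%MS.
  have -> : g s = \sum_k `|(s *m cokermx A) 0 k| by apply: eq_bigr => k _; rewrite mxE.
  rewrite submxE; apply/idP/eqP => [gs|s0]; last first.
    by rewrite s0 big1// => k _; rewrite mxE normr0.
  apply/rowP => k; rewrite [RHS]mxE; apply/eqP; rewrite -normr_le0.
  by apply: le_trans gs; rewrite (bigD1 k)//= lerDl sumr_ge0.
have K0 : K 0 by split; rewrite //= gP sub0mx.
have [s] := EVT_min_rV (ex_intro _ _ K0) Kc (continuous_subspaceT hc).
rewrite inE => -[/= +] hs0 smin; rewrite gP => sA.
have [t st] : exists t, s = t *m A.
  exact/submxP.
exists t => i; rewrite -st.
pose a k := A i k.
pose f (e : R) := \sum_k (C k * expR (s 0 k + e * a k) - x k * (s 0 k + e * a k)).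
have fE e : f e = h (s + e *: row i A).
  by apply: eq_bigr => k _; rewrite !mxE.
(* Minimality on [K] extends to the whole line: where [h] exceeds [h 0], it exceeds the value at [s]
   too. *)
have fmin e : f 0 <= f e.
  rewrite !fE scale0r addr0.
  have [hle|/ltW hle] := leP (h (s + e *: row i A)) (h 0); last exact: le_trans hle.
  apply: smin; rewrite inE; split=> //.
  rewrite /= gP; apply: addmx_sub => //.
  by apply: scalemx_sub; exact: row_sub.
(* For |e| <= 1 / (2 W) all exponents e a_k stay in [- 1/2, 1/2], where the quadratic bound on the
   exponential holds. *)
pose W := 1 + \sum_k `|a k|.
have W1 : 0 < W by rewrite ltr_wpDr// sumr_ge0.
apply: (@linear_term_eq0 _ (2 * W)^-1 _ (\sum_k 2 * (C k * expR (s 0 k)) * a k ^+ 2)).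
- by rewrite invr_gt0 mulr_gt0.
- by apply: sumr_ge0 => k _; rewrite mulr_ge0 ?sqr_ge0// !mulr_ge0 ?expR_ge0// ltW.
move=> e he; have := fmin e; rewrite -subr_ge0 => /le_trans; apply.
rewrite /f -sumrB !mulr_sumr -big_split /=; apply: ler_sum => k _.
rewrite mul0r addr0 expRD.
have hu : `|e * a k| <= 2^-1.
  have ak : `|a k| <= W.
    rewrite /W (bigD1 k)//= addrCA lerDl addr_ge0// sumr_ge0//.
  rewrite normrM; apply: le_trans (ler_pM _ _ he ak) _ => //.
  by rewrite invfM mulfVK// gt_eqF.
have := ler_wpM2l (ltW (mulr_gt0 (C0 k) (expR_gt0 (s 0 k)))) (expR_le_quadratic hu).
rewrite -/(a k); lra.
Qed.

(** With g = exp t the quotient g (w) / (g (u) g (v)) is the exponential of a linear form in t,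
    whose coefficients are a column of [A]; the balance equations, weighted by - T_i, sum up to the
    claim. Indices outside [P] have a zero column, which makes the value 1 given to them by [pos]
    harmless. *)
Lemma weighted_scaling (R : realType) (n : nat) (I : finType) (P : pred I)
    (u v w : I -> 'I_n) (C x : I -> R) :
  (forall k, P k -> 0 < C k) -> (forall k, P k -> 0 < x k) ->
  exists g : 'I_n -> R, (forall i, 0 < g i) /\
    forall T : 'I_n -> R,
      \sum_(k | P k) C k * (g (w k) / (g (u k) * g (v k))) *
               (T (u k) + T (v k) - T (w k)) =
      \sum_(k | P k) x k * (T (u k) + T (v k) - T (w k)).
Proof.
move=> C0 x0.
pose del (i j : 'I_n) : R := (i == j)%:R.
pose A := \matrix_(i < n, k < #|I|)
  if P (enum_val k) then
    del i (w (enum_val k)) - del i (u (enum_val k)) - del i (v (enum_val k))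
  else 0.
pose pos (y : I -> R) (k : 'I_#|I|) := if P (enum_val k) then y (enum_val k) else 1.
have posP (y : I -> R) : (forall k, P k -> 0 < y k) -> forall k : 'I_#|I|, 0 < pos y k.
  by move=> y0 k; rewrite /pos; case: ifP => // /y0.
have [t tP] := birch_balance A (posP _ C0) (posP _ x0).
exists (fun i => expR (t 0 i)); split=> [i|T]; first exact: expR_gt0.
have delE (F : 'I_n -> R) j : \sum_i F i * del i j = F j.
  rewrite (bigD1 j)//= /del eqxx mulr1 big1 ?addr0// => i /negPf ->.
  by rewrite mulr0.
apply/eqP; rewrite -subr_eq0 -sumrB big_mkcond.
rewrite (reindex (@enum_val I predT)) /=; last exact/onW_bij/enum_val_bij.
have : \sum_i - T i * \sum_k (pos C k * expR ((t *m A) 0 k) - pos x k) * A i k = 0.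
  by apply: big1 => i _; rewrite tP mulr0.
under [X in X = 0 -> _]eq_bigr => i _ do rewrite mulr_sumr.
rewrite exchange_big /= => /eqP; congr (_ == _); apply: eq_bigr => k _.
rewrite /pos; case: ifPn => Pk; last first.
  by apply: big1 => i _; rewrite [A i k]mxE (negPf Pk) !mulr0.
set c := C _; set y := x _.
have -> : (t *m A) 0 k = t 0 (w (enum_val k)) - t 0 (u (enum_val k)) - t 0 (v (enum_val k)).
  rewrite mxE; under eq_bigr => i _ do rewrite mxE Pk !mulrBr.
  by rewrite !sumrB !delE.
rewrite !expRD !expRN -mulrA -invfM mulrA.
under eq_bigr => i _ do rewrite mulrCA mxE Pk !mulrBr.
rewrite !sumrB -!mulr_sumr !delE; ring.
Qed.

Lemma graded_scaling (R : realType) (D : seq nat) (P : rel nat)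
    (C x : nat -> nat -> R) :
  (forall a b, P a b -> 0 < C a b) -> (forall a b, P a b -> 0 < x a b) ->
  exists g : nat -> R, (forall a, 0 < g a) /\
    forall T : nat -> R,
      \sum_(a <- D) \sum_(b <- D | P a b)
         C a b * (g (a + b)%N / (g a * g b)) * (T a + T b - T (a + b)%N) =
      \sum_(a <- D) \sum_(b <- D | P a b) x a b * (T a + T b - T (a + b)%N).
Proof.
move=> C0 x0; pose N := (sumn D + sumn D)%N.
pose deg (i : 'I_(size D)) := nth 0%N D i.
have degN i : (deg i <= sumn D)%N.
  rewrite /deg; have := mem_nth 0%N (ltn_ord i); move: (nth _ _ _) => a.
  elim: D {i deg N} => //= d D IH; rewrite inE => /orP[/eqP->|/IH]; first exact: leq_addr.
  by move=> /leq_trans; apply; exact: leq_addl.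
pose I := ('I_(size D) * 'I_(size D))%type.
have [g [g0 gP]] := @weighted_scaling R N.+1 I (fun p => P (deg p.1) (deg p.2))
  (fun p => inord (deg p.1)) (fun p => inord (deg p.2))
  (fun p => inord (deg p.1 + deg p.2)) (fun p => C (deg p.1) (deg p.2))
  (fun p => x (deg p.1) (deg p.2)) (fun p => C0 _ _) (fun p => x0 _ _).
exists (fun a => g (inord a)); split=> [a|T]; first exact: g0.
have sumE (F : nat -> nat -> R) : \sum_(a <- D) \sum_(b <- D | P a b) F a b =
    \sum_(p : I | P (deg p.1) (deg p.2)) F (deg p.1) (deg p.2).
  rewrite [RHS]big_mkcond.
  rewrite -(pair_bigA _ (fun i j => if P (deg i) (deg j) then F (deg i) (deg j) else 0)) /=.
  rewrite (big_nth 0%N) big_mkord; apply: eq_bigr => i _.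
  by rewrite (big_nth 0%N) big_mkord big_mkcond.
have := gP (fun i => T i); rewrite !sumE => h.
have inE1 i : (inord (deg i) : 'I_N.+1) = deg i :> nat.
  by rewrite inordK// ltnS (leq_trans (degN i))// leq_addr.
have inE2 i j : (inord (deg i + deg j) : 'I_N.+1) = (deg i + deg j)%N :> nat.
  by rewrite inordK// ltnS leq_add.
by move: h; under eq_bigr do rewrite !inE1 !inE2; move=> ->; apply: eq_bigr => p _; rewrite !inE1 !inE2.
Qed.
End Balance.

(** * Coordinates in a basis indexed by degrees *)

Lemma lftrace_basis (R : realType) (V : vectType R) n (X : n.-tuple V) (f : 'End(V)) :
  basis_of {:V} X -> lftrace f = \sum_i coord X i (f X`_i).
Proof.
move=> Xb; have vb := vbasisP {:V}.
transitivity (\sum_i coord (vbasis {:V}) i (f (vbasis {:V})`_i)).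
  by rewrite /lftrace /mxtrace; apply: eq_bigr => i _; rewrite !mxE /= passmx.vecof_delta -/(passmx.rVof _ _) ?mxE.
under eq_bigr => i _ do
  rewrite [f _](coord_basis Xb (memvf _)) linear_sum /=.
rewrite exchange_big; apply: eq_bigr => j _.
rewrite [X in _ = _ (f X)](coord_basis vb (memvf _)) !linear_sum /=.
by apply: eq_bigr => i _; rewrite !linearZ /= mulrC.
Qed.

Section Coordinates.
Variables (R : realType) (V : vectType R) (D : seq nat) (e : nat -> V).
Hypothesis (Du : uniq D) (eb : basis_of {:V} [seq e a | a <- D]).

Let X := [tuple of map e (in_tuple D)].

(** Coordinates are indexed by the degree itself and are the zero form for degrees outside [D],
    hence linear for every index. *)
Definition gcoord (a : nat) (v : V) : R :=
  if insub (index a D) is Some i then coord X i v else 0.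

Lemma gcoord_is_linear a : scalar (gcoord a).
Proof.
rewrite /gcoord => k u v; case: insubP => [i _ _|_]; first by rewrite linearP.
by rewrite mulr0 addr0.
Qed.
HB.instance Definition _ a :=
  GRing.isLinear.Build R V R _ (gcoord a) (gcoord_is_linear a).

Lemma gcoord_sum v : v = \sum_(a <- D) gcoord a v *: e a.
Proof.
rewrite [LHS](coord_basis (X := X) eb (memvf v)) (big_nth 0%N) big_mkord.
apply: eq_bigr => i _; rewrite /gcoord index_uniq//.
rewrite insubT//= => ilt; congr (coord _ _ v *: _); first exact: val_inj.
by rewrite /= (nth_map 0%N).
Qed.

Lemma gcoord_e a b : a \in D -> b \in D -> gcoord a (e b) = (a == b)%:R.
Proof.
move=> aD bD; rewrite /gcoord insubT ?index_mem// => ia.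
have -> : e b = X`_(Sub (index b D) (etrans (index_mem b D) bD) : 'I_(size D)).
  by rewrite /= (nth_map 0%N) ?nth_index ?index_mem.
rewrite coord_free ?(basis_free eb)//; congr (_%:R).
rewrite -val_eqE /= [_ == index a D]eq_sym.
by rewrite -(nth_uniq 0%N ia _ Du) ?index_mem// !nth_index.
Qed.

Lemma gcoord_inj u v : (forall a, a \in D -> gcoord a u = gcoord a v) -> u = v.
Proof.
move=> h; rewrite [u]gcoord_sum [v]gcoord_sum; apply: eq_big_seq => a aD; by rewrite h.
Qed.

Lemma lftrace_gcoord (f : 'End(V)) : lftrace f = \sum_(a <- D) gcoord a (f (e a)).
Proof.
rewrite (lftrace_basis f (X := X) eb) [RHS](big_nth 0%N) big_mkord.
apply: eq_bigr => i _; rewrite /gcoord index_uniq// insubT//= => ilt.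
by rewrite (nth_map 0%N)//; congr (coord _ _ _); apply: val_inj.
Qed.
End Coordinates.

(** * Inner products that are diagonal in a given basis *)

Section DiagonalInnerProduct.
Variables (R : realType) (V : vectType R) (D : seq nat) (e : nat -> V).
Hypothesis (Du : uniq D) (eb : basis_of {:V} [seq e a | a <- D]).
Variable g : nat -> R.
Hypothesis g0 : forall a, 0 < g a.

Local Notation co := (gcoord D e).

Definition diag_form (x y : V) : R := \sum_(a <- D) g a * co a x * co a y.

Lemma diag_form_bilinear :
  bilinear_for *%R (idfun \; *%R) diag_form.
Proof.
split=> u k x y /=; rewrite /diag_form mulr_sumr -big_split /=;
  by apply: eq_bigr => a _; rewrite linearP /=; ring.
Qed.

HB.instance Definition _ := @bilinear_isBilinear.Build R V V R
  *%R (idfun \; *%R) diag_form diag_form_bilinear.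

Lemma diag_form_sym x y : diag_form x y = (-1) ^+ false * idfun (diag_form y x).
Proof.
by rewrite expr0 mul1r /diag_form; apply: eq_bigr => a _; rewrite mulrAC.
Qed.

HB.instance Definition _ :=
  isHermitianSesquilinear.Build R V false idfun diag_form diag_form_sym.

Lemma diag_form_gt0 u : u != 0 -> 0 < diag_form u u.
Proof.
move=> u0; rewrite lt_def; apply/andP; split; last first.
  by apply: sumr_ge0 => a _; rewrite -mulrA mulr_ge0 ?sqr_ge0// ltW.
apply: contraNneq u0 => /eqP; rewrite /diag_form psumr_eq0 => [/allP h|a _]; last first.
  by rewrite -mulrA mulr_ge0 ?sqr_ge0// ltW.
rewrite (gcoord_sum Du eb u); apply/eqP; apply: big1_seq => a /= aD.
have := h a aD; rewrite -mulrA mulf_eq0 gt_eqF//= mulf_eq0 orbb => /eqP->.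
by rewrite scale0r.
Qed.

HB.instance Definition _ :=
  isDotProduct.Build R V diag_form diag_form_gt0.

Lemma diag_dot : exists ip : {dot V for idfun},
  forall x y, ip x y = \sum_(a <- D) g a * co a x * co a y.
Proof. by exists diag_form. Qed.
End DiagonalInnerProduct.

Lemma linear_fun0 (R : realType) (V W : lmodType R) (f : V -> W) : linear f -> f 0 = 0.
Proof.
move=> fl; have := fl 1 0 0; rewrite !scale1r addr0 => /eqP.
by rewrite -subr_eq subrr eq_sym => /eqP.
Qed.

Lemma linear_funZ (R : realType) (V W : lmodType R) (f : V -> W) k x :
  linear f -> f (k *: x) = k *: f x.
Proof. by move=> fl; rewrite -[k *: x]addr0 fl (linear_fun0 fl) addr0. Qed.

Lemma linear_funD (R : realType) (V W : lmodType R) (f : V -> W) x y :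
  linear f -> f (x + y) = f x + f y.
Proof. by move=> fl; rewrite -[x]scale1r fl !scale1r. Qed.

Lemma linear_fun_sum (R : realType) (V W : lmodType R) (f : V -> W) (I : Type)
  (r : seq I) (P : pred I) F :
  linear f -> f (\sum_(i <- r | P i) F i) = \sum_(i <- r | P i) f (F i).
Proof.
move=> fl; apply: (big_morph f) => [x y|]; first exact: linear_funD.
exact: linear_fun0.
Qed.

Section Basis.
Variables (R : realType) (V : vectType R) (D : seq nat) (e : nat -> V).
Hypothesis (Du : uniq D) (eb : basis_of {:V} [seq e a | a <- D]).
Local Notation co := (gcoord D e).

Lemma linear_gcoord (W : lmodType R) (f : V -> W) v : linear f ->
  f v = \sum_(a <- D) co a v *: f (e a).
Proof.
move=> fl; rewrite [in LHS](gcoord_sum Du eb v) linear_fun_sum//.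
by apply: eq_bigr => a _; rewrite linear_funZ.
Qed.

Lemma bilinear_ext (W : lmodType R) (F G : V -> V -> W) :
  (forall y, linear (F^~ y)) -> (forall x, linear (F x)) ->
  (forall y, linear (G^~ y)) -> (forall x, linear (G x)) ->
  (forall a b, a \in D -> b \in D -> F (e a) (e b) = G (e a) (e b)) ->
  forall x y, F x y = G x y.
Proof.
move=> F1 F2 G1 G2 FG x y.
rewrite (linear_gcoord x (F1 y)) (linear_gcoord x (G1 y)).
apply: eq_big_seq => a aD; congr (_ *: _).
rewrite (linear_gcoord y (F2 _)) (linear_gcoord y (G2 _)).
by apply: eq_big_seq => b bD; rewrite FG.
Qed.

Lemma size_degrees : size D = \dim {:V}.
Proof. by rewrite -(size_basis (X := [tuple of map e (in_tuple D)]) eb). Qed.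

Lemma spanning_basis (f : nat -> V) :
  (forall a, a \in D -> e a \in <<[seq f b | b <- D]>>%VS) ->
  basis_of {:V} [seq f a | a <- D].
Proof.
move=> ef; rewrite basisEdim size_map size_degrees leqnn andbT.
apply/subvP => v _; rewrite (gcoord_sum Du eb v) big_seq.
by apply: rpred_sum => a aD; rewrite rpredZ// ef.
Qed.

Definition diag_fun (r : nat -> R) (v : V) : V := \sum_(a <- D) (r a * co a v) *: e a.

Lemma diag_fun_linear r : linear (diag_fun r).
Proof.
move=> k x y; rewrite /diag_fun scaler_sumr -big_split /=.
by apply: eq_bigr => a _; rewrite linearP /= mulrDr scalerDl scalerA mulrCA.
Qed.
HB.instance Definition _ r := GRing.isLinear.Build R V V _ (diag_fun r) (diag_fun_linear r).

Definition diag_op r : 'End(V) := linfun (diag_fun r).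

Lemma diag_opE r a : a \in D -> diag_op r (e a) = r a *: e a.
Proof.
move=> aD; rewrite lfunE /= /diag_fun (bigD1_seq a)//= gcoord_e// eqxx mulr1.
rewrite big_seq_cond big1 ?addr0// => b /andP[bD /negPf ba].
by rewrite gcoord_e// ba mulr0 scale0r.
Qed.

Lemma gcoord_diag_op r a v : a \in D -> co a (diag_op r v) = r a * co a v.
Proof.
move=> aD; rewrite lfunE /= /diag_fun linear_sum /= (bigD1_seq a)//= linearZ /=.
rewrite gcoord_e// eqxx mulr1 big_seq_cond big1 ?addr0// => b /andP[bD /negPf ba].
by rewrite linearZ /= gcoord_e// eq_sym ba mulr0.
Qed.
End Basis.

(** * Graded bases, the Ricci trace of a diagonal metric, and sufficiency *)

(** The set of degrees may have gaps: a bracket whose weight is not a degree is zero. The class B_2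
    needs this for the missing degree n. *)
Definition graded (R : realType) (V : vectType R) (br : V -> V -> V)
    (D : seq nat) (C : nat -> nat -> R) (e : nat -> V) : Prop :=
  basis_of {:V} [seq e a | a <- D] /\
  forall a b, a \in D -> b \in D ->
    br (e a) (e b) = if (a + b)%N \in D then C a b *: e (a + b)%N else 0.

(* Nikolayevsky's condition: ric = c id + l N paired with diag (T), for s = - 2 c and
   mu = 2 l, where x a b stands for C_ab^2 g_(a+b) / (g_a g_b). *)
Definition feasible (R : realType) (D : seq nat) (C : nat -> nat -> R) : Prop :=
  exists (x : nat -> nat -> R) (s mu : R),
    [/\ 0 < s,
        forall a b, a \in D -> b \in D -> (a < b)%N -> (a + b)%N \in D ->
          if C a b == 0 then x a b = 0 else 0 < x a b &
        forall T : nat -> R,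
          \sum_(a <- D) \sum_(b <- D | (a < b)%N && ((a + b)%N \in D))
             x a b * (T a + T b - T (a + b)%N) =
          \sum_(a <- D) (s - mu * a%:R) * T a].

Lemma sum_sym (R : realType) (D : seq nat) (F : nat -> nat -> R) :
  (forall a b, a \in D -> b \in D -> F b a = F a b) ->
  (forall a, a \in D -> F a a = 0) ->
  \sum_(a <- D) \sum_(b <- D) F a b =
  2 * \sum_(a <- D) \sum_(b <- D | (a < b)%N) F a b.
Proof.
move=> Fs F0.
have -> : \sum_(a <- D) \sum_(b <- D) F a b =
   \sum_(a <- D) (\sum_(b <- D | (a < b)%N) F a b + \sum_(b <- D | (b < a)%N) F a b).
  apply: eq_big_seq => a aD; rewrite (bigID (fun b => (a < b)%N)) /=; congr (_ + _).
  rewrite (bigID (fun b => (b < a)%N)) /= [X in _ + X]big1 ?addr0.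
    by apply: eq_bigl => b; lia.
  by move=> b /andP[h1 h2]; rewrite (_ : b = a) ?F0//; lia.
rewrite big_split /= mulr_natl mulr2n; congr (_ + _).
under eq_bigr do rewrite big_mkcond.
rewrite exchange_big /=; apply: eq_big_seq => a aD; rewrite [RHS]big_mkcond.
by apply: eq_big_seq => b bD; rewrite Fs.
Qed.

Section Graded.
Variables (R : realType) (V : vectType R) (br : V -> V -> V).
Variables (D : seq nat) (C : nat -> nat -> R) (e : nat -> V).
Hypothesis (Du : uniq D) (lie : is_lie br) (gr : graded br D C e).
Local Notation co := (gcoord D e).

Lemma lie_anti x y : br y x = - br x y.
Proof.
have := lie_alt lie (x + y).
rewrite (linear_funD _ _ (lie_linearr lie _)) !(linear_funD _ _ (lie_linearl lie _)).
by rewrite !lie_alt// add0r addr0 => /eqP; rewrite addr_eq0 => /eqP ->.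
Qed.

Lemma e_neq0 a : a \in D -> e a != 0.
Proof.
move=> aD; apply/eqP => e0; have := gcoord_e Du gr.1 aD aD.
by rewrite e0 linear0 eqxx => /eqP; rewrite eq_sym oner_eq0.
Qed.

Lemma graded_anti a b : a \in D -> b \in D -> (a + b)%N \in D -> C b a = - C a b.
Proof.
move=> aD bD abD; have := lie_anti (e a) (e b).
rewrite !gr.2// addnC abD => /eqP; rewrite -scaleNr -subr_eq0 -scalerBl scaler_eq0.
by rewrite (negPf (e_neq0 abD)) orbF subr_eq0 => /eqP.
Qed.

Lemma degree_derivation : derivation br (diag_op D e (fun a => a%:R)).
Proof.
have [br1 br2] := (lie_linearl lie, lie_linearr lie).
set N := diag_op _ _ _; move=> x y; move: x y.
apply: (bilinear_ext Du gr.1) => [y k u v|x k u v|y k u v|x k u v|a b aD bD].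
- by rewrite br1 linearP.
- by rewrite br2 linearP.
- by rewrite linearP !br1 scalerDr addrACA.
- by rewrite linearP !br2 scalerDr addrACA.
rewrite !(diag_opE Du gr.1)// (linear_funZ _ _ (br1 _)) (linear_funZ _ _ (br2 _)) -scalerDl -natrD.
rewrite gr.2//; case: ifP => abD; last by rewrite linear0 scaler0.
by rewrite linearZ /= (diag_opE Du gr.1)// scalerA scalerA mulrC.
Qed.

Lemma gcoord_brl v a b : a \in D -> b \in D -> (a + b)%N \in D ->
  co (a + b)%N (br v (e b)) = co a v * C a b.
Proof.
move=> aD bD abD; rewrite (linear_gcoord Du gr.1 v (lie_linearl lie (e b))).
rewrite linear_sum /= (bigD1_seq a)//= linearZ /= gr.2// abD linearZ /= gcoord_e// ?gr.1//.
rewrite eqxx mulr1 big_seq_cond big1 ?addr0// => d /andP[dD da].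
rewrite linearZ /= gr.2//; case: ifP => dbD; last by rewrite linear0 mulr0.
by rewrite linearZ /= (gcoord_e Du gr.1)// eqn_add2r eq_sym (negPf da) !mulr0.
Qed.

Lemma gcoord_brr v a b : a \in D -> b \in D -> (a + b)%N \in D ->
  co (a + b)%N (br (e a) v) = co b v * C a b.
Proof.
move=> aD bD abD; rewrite lie_anti linearN /= addnC gcoord_brl// ?(addnC b)//.
by rewrite graded_anti// mulrN opprK.
Qed.

(* The trace formula defining the Ricci operator, on the orthonormal basis
   e_a / sqrt (g a). *)
Lemma ricci_sum (ip : {dot V for idfun}) (g h : nat -> R) (A : 'End(V)) :
  (forall x y, ip x y = \sum_(a <- D) g a * co a x * co a y) ->
  (forall a, h a ^+ 2 = (g a)^-1) ->
  \sum_(x <- [seq h a *: e a | a <- D]) \sum_(y <- [seq h a *: e a | a <- D])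
    ip (A (br x y) - br (A x) y - br x (A y)) (br x y) =
  - 2 * \sum_(a <- D) \sum_(b <- D | (a < b)%N && ((a + b)%N \in D))
     C a b ^+ 2 * (g (a + b)%N / (g a * g b)) *
     (co a (A (e a)) + co b (A (e b)) - co (a + b)%N (A (e (a + b)%N))).
Proof.
move=> ipE hE; have [br1 br2] := (lie_linearl lie, lie_linearr lie).
pose F a b := if (a + b)%N \in D then C a b ^+ 2 * (g (a + b)%N / (g a * g b)) *
     (co (a + b)%N (A (e (a + b)%N)) - co a (A (e a)) - co b (A (e b))) else 0.
have ipe d v k : d \in D -> ip v (k *: e d) = k * g d * co d v.
  move=> dD; rewrite ipE (bigD1_seq d)//= linearZ /= gcoord_e// ?gr.1// eqxx mulr1.
  rewrite big_seq_cond big1 ?addr0; first by ring.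
  by move=> b /andP[bD /negPf bd]; rewrite linearZ /= (gcoord_e Du gr.1)// bd !mulr0.
transitivity (\sum_(a <- D) \sum_(b <- D) F a b).
  rewrite big_map; apply: eq_big_seq => a aD; rewrite big_map.
  apply: eq_big_seq => b bD.
  rewrite (linear_funZ _ _ (br1 _)) (linear_funZ _ _ (br2 _)) gr.2// /F.
  case: ifP => abD; last first.
    by rewrite !scaler0 ipE big1// => d _; rewrite [co d 0]linear0 mulr0.
  rewrite !scalerA ipe// !linearB /=.
  rewrite !(linear_funZ _ _ (br1 _)) !(linear_funZ _ _ (br2 _)) !linearZ /=.
  rewrite gcoord_brl// gcoord_brr//.
  rewrite !linearZ /= invfM -(hE a) -(hE b); ring.
rewrite sum_sym; first last.
- move=> a aD; rewrite /F; case: ifP => // aaD.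
  have /eqP := graded_anti aD aD aaD; rewrite -addr_eq0 -mulr2n mulrn_eq0 /= => /eqP->.
  by rewrite expr0n /= !mul0r.
- move=> a b aD bD; rewrite /F addnC; case: ifP => // abD.
  rewrite (graded_anti aD bD)// sqrrN [g b * _]mulrC; ring.
rewrite mulNr -mulrN -sumrN; congr (_ * _); apply: eq_bigr => a _.
rewrite -sumrN [LHS]big_mkcond [RHS]big_mkcond; apply: eq_bigr => b _.
by rewrite /F; case: ltnP => //= _; case: ifP => // _; ring.
Qed.
End Graded.

Lemma dotC (R : realType) (V : vectType R) (ip : {dot V for idfun}) x y :
  ip x y = ip y x.
Proof. by rewrite hermC expr0 mul1r. Qed.

Lemma orthonormal_nth (R : realType) (V : vectType R) (ip : {dot V for idfun})
    (E : seq V) :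
  orthonormal ip E <->
  forall i j, (i < size E)%N -> (j < size E)%N -> ip E`_i E`_j = (i == j)%:R.
Proof.
elim: E => [|v E IH]; first by split=> // _ i j; rewrite ltn0.
rewrite /orthonormal /= andbT; split.
  move=> /andP[/andP[/eqP v1 E1] /andP[/allP/= vE oE]].
  have {}IH := IH.1 (introT andP (conj E1 oE)).
  move=> [|i] [|j] //= iE jE.
  - by apply/eqP/vE/mem_nth.
  - by rewrite dotC; apply/eqP/vE/mem_nth.
  by rewrite IH.
move=> h; have /andP[E1 oE] : orthonormal ip E.
  by apply/IH => i j iE jE; have := h i.+1 j.+1 iE jE.
rewrite E1 oE !andbT; have := h 0%N 0%N isT isT => /= ->; rewrite eqxx /=.
apply/allP => u /(nthP 0)[j jE <-] /=.
by have := h 0%N j.+1 isT jE => /= ->.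
Qed.

(** Balancing gives lengths g for which C_ab^2 g_(a+b) / (g_a g_b) need not equal [x], but has the
    same pairing with every diagonal T. This is enough: by [ricci_sum] the trace formula involves
    only the diagonal entries of [A], so testing against diagonal operators decides it for all
    endomorphisms. *)
Lemma feasible_einstein (R : realType) (V : vectType R) (br : V -> V -> V)
    (D : seq nat) (C : nat -> nat -> R) (e : nat -> V) :
  uniq D -> nilpotent_lie br -> graded br D C e -> feasible D C ->
  einstein_nilradical br.
Proof.
move=> Du nil gr [x [s [mu [s0 xC xT]]]]; split=> //.
have lie := nil.1; have eb := gr.1.
pose P a b := [&& a \in D, b \in D, (a < b)%N, (a + b)%N \in D & C a b != 0].
have C0 a b : P a b -> 0 < C a b ^+ 2.
  by case/and5P => _ _ _ _ Cab; rewrite exprn_even_gt0.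
have x0 a b : P a b -> 0 < x a b.
  case/and5P => aD bD ab abD /negPf Cab.
  by have := xC a b aD bD ab abD; rewrite Cab.
have [g [g0 gT]] := Balance.graded_scaling D C0 x0.
have [ip ipE] := diag_dot Du eb g0.
(* The factor - 1/2 is the 1/4 of the trace formula times the - 2 of [ricci_sum]; hence c = - s / 2
   and the derivation is mu / 2 times the degree. *)
pose ric : 'End(V) := diag_op D e (fun a => - 2^-1 * (s - mu * a%:R)).
exists ip, (- 2^-1 * s), ((2^-1 * mu) *: diag_op D e (fun a => a%:R)), ric; split.
- split=> [y z|].
    rewrite !ipE; apply: eq_big_seq => a aD.
    by rewrite !(gcoord_diag_op Du eb)//; ring.
  pose h a := (Num.sqrt (g a))^-1.
  have h2 a : h a ^+ 2 = (g a)^-1 by rewrite exprVn sqr_sqrtr ?ltW.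
  have h0 a : h a != 0 by rewrite invr_eq0 gt_eqF// sqrtr_gt0.
  exists [seq h a *: e a | a <- D]; split.
  + apply: (spanning_basis Du eb (f := fun a => h a *: e a)) => a aD.
    rewrite -[e a](scalerK (h0 a)) rpredZ//; apply: memv_span.
    exact: (map_f (fun a => h a *: e a)).
  + apply/orthonormal_nth => i j; rewrite size_map => iD jD.
    rewrite !(nth_map 0%N)//; set a := nth _ _ i; set b := nth _ _ j.
    have aD : a \in D by exact: mem_nth.
    have bD : b \in D by exact: mem_nth.
    rewrite -(nth_uniq 0%N iD jD Du) -/a -/b ipE (bigD1_seq b)//=.
    rewrite big_seq_cond big1 ?addr0 => [|d /andP[dD /negPf db]]; last first.
      by rewrite !linearZ /= !(gcoord_e Du eb)// db !mulr0.
    rewrite !linearZ /= !(gcoord_e Du eb)// eqxx eq_sym; case: eqP => [<-|_]; last first.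
      by rewrite !(mulr0, mul0r).
    by rewrite !mulr1 -mulrA -expr2 h2 divff// gt_eqF.
  move=> A; rewrite (ricci_sum Du lie gr A ipE h2) (lftrace_gcoord Du eb).
  have -> : \sum_(a <- D) gcoord D e a ((ric \o A)%VF (e a)) =
      - 2^-1 * \sum_(a <- D) (s - mu * a%:R) * gcoord D e a (A (e a)).
    rewrite mulr_sumr; apply: eq_big_seq => a aD.
    by rewrite comp_lfunE (gcoord_diag_op Du eb)// mulrA.
  rewrite -(xT (fun a => gcoord D e a (A (e a)))).
  transitivity (- 2^-1 * \sum_(a <- D) \sum_(b <- D | P a b) x a b *
     (gcoord D e a (A (e a)) + gcoord D e b (A (e b)) - gcoord D e (a + b)%N (A (e (a + b)%N)))).
    congr (_ * _); apply: eq_big_seq => a aD.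
    rewrite [LHS]big_mkcond [RHS]big_mkcond; apply: eq_big_seq => b bD.
    rewrite /P aD bD /=; case: ifP => [/andP[ab abD]|ab]; last by rewrite andbA ab.
    rewrite ab abD /=; have := xC a b aD bD ab abD.
    by case: eqP => [_ ->|//]; rewrite mul0r.
  rewrite -(gT (fun a => gcoord D e a (A (e a)))) mulrA.
  have -> : 4^-1 * (-2) = - 2^-1 :> R by lra.
  congr (_ * _); apply: eq_big_seq => a aD.
  rewrite [LHS]big_mkcond [RHS]big_mkcond; apply: eq_big_seq => b bD.
  rewrite /P aD bD /=; case: ifP => [/and3P[-> -> _]//|]; case: ifP => // /andP[-> ->] /=.
  by move=> /negbFE/eqP ->; rewrite expr0n /= !mul0r.
- by rewrite mulNr oppr_lt0 mulr_gt0// invr_gt0.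
- have der := degree_derivation Du lie gr.
  have [br1 br2] := (lie_linearl lie, lie_linearr lie).
  move=> y z; rewrite !scale_lfunE der scalerDr.
  by rewrite (linear_funZ _ _ (br1 _)) (linear_funZ _ _ (br2 _)).
apply/lfunP => v; rewrite add_lfunE !scale_lfunE id_lfunE.
apply: (gcoord_inj Du eb) => a aD; rewrite linearD !linearZ /= !(gcoord_diag_op Du eb)//.
ring.
Qed.

(** * Independence of the trace formula from the orthonormal basis *)

Section OrthonormalBases.
Variables (R : realType) (V : vectType R) (ip : {dot V for idfun}).

Lemma orthonormal_expand (E : seq V) v :
  basis_of {:V} E -> orthonormal ip E -> v = \sum_(x <- E) ip v x *: x.
Proof.
move=> Eb /orthonormal_nth oE.
rewrite [LHS](coord_basis (X := in_tuple E) Eb (memvf v)) (big_nth 0) big_mkord.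
apply: eq_bigr => i _; congr (_ *: _).
rewrite [in RHS](coord_basis (X := in_tuple E) Eb (memvf v)).
rewrite linear_sumlz (bigD1 i)//= linearZl_LR/= oE// eqxx mulr1 big1 ?addr0// => j /negPf ji.
by rewrite linearZl_LR/= oE// val_eqE ji mulr0.
Qed.

(** Expanding both arguments in [F] and summing over [E] leaves, by Parseval, the contraction of
    [phi] with the inner product in the basis [F]. *)
Lemma sum_orthonormal (E F : seq V) (phi : V -> V -> R) :
  basis_of {:V} E -> orthonormal ip E -> basis_of {:V} F -> orthonormal ip F ->
  (forall y, linear_for *%R (phi^~ y)) -> (forall x, linear_for *%R (phi x)) ->
  \sum_(x <- E) phi x x = \sum_(y <- F) phi y y.
Proof.
move=> Eb oE Fb oF phi1 phi2.
have exp1 u v : phi u v = \sum_(y <- F) ip u y * phi y v.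
  rewrite {1}[u](orthonormal_expand u Fb oF).
  rewrite (linear_fun_sum (V := V) (W := R^o) _ _ _ (phi1 v)).
  by apply: eq_bigr => y _; rewrite (linear_funZ (V := V) (W := R^o) _ _ (phi1 v)).
have exp2 u v : phi u v = \sum_(y <- F) ip v y * phi u y.
  rewrite {1}[v](orthonormal_expand v Fb oF).
  rewrite (linear_fun_sum (V := V) (W := R^o) _ _ _ (phi2 u)).
  by apply: eq_bigr => y _; rewrite (linear_funZ (V := V) (W := R^o) _ _ (phi2 u)).
have ipx u v : ip u v = \sum_(x <- E) ip x u * ip x v.
  rewrite {1}[u](orthonormal_expand u Eb oE) linear_sumlz.
  by apply: eq_bigr => x _; rewrite linearZl_LR (dotC ip u).
transitivity (\sum_(y <- F) \sum_(z <- F) ip y z * phi y z).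
  under eq_bigr => x _ do rewrite exp1.
  rewrite exchange_big; apply: eq_bigr => y _ /=.
  under eq_bigr => x _ do rewrite exp2 mulr_sumr.
  rewrite exchange_big; apply: eq_bigr => z _ /=.
  by rewrite ipx mulr_suml; apply: eq_bigr => x _; rewrite mulrA.
by apply: eq_bigr => y _; rewrite [RHS]exp2.
Qed.
End OrthonormalBases.

(** An Einstein metric comes with an unspecified orthonormal basis, whereas the computation takes
    place in an eigenbasis. The summand is bilinear in the two occurrences of each variable, which
    allows the bases to be exchanged one variable at a time. *)
Lemma ricci_basis_change (R : realType) (V : vectType R) (br : V -> V -> V)
    (ip : {dot V for idfun}) (E F : seq V) (A : 'End(V)) : is_lie br ->
  basis_of {:V} E -> orthonormal ip E -> basis_of {:V} F -> orthonormal ip F ->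
  \sum_(x <- E) \sum_(y <- E)
     ip (A (br x y) - br (A x) y - br x (A y)) (br x y) =
  \sum_(x <- F) \sum_(y <- F)
     ip (A (br x y) - br (A x) y - br x (A y)) (br x y).
Proof.
move=> lie Eb oE Fb oF; have [br1 br2] := (lie_linearl lie, lie_linearr lie).
pose L x y := A (br x y) - br (A x) y - br x (A y).
have L1 y : linear (L^~ y).
  move=> k u v; rewrite /L br1 !linearP !br1 /= !scalerBr !opprD.
  by rewrite (addrACA (k *: A _)) [LHS]addrACA.
have L2 x : linear (L x).
  move=> k u v; rewrite /L br2 !linearP !br2 /= !scalerBr !opprD.
  by rewrite (addrACA (k *: A _)) [LHS]addrACA.
transitivity (\sum_(x <- E) \sum_(y <- F) ip (L x y) (br x y)).
  apply: eq_bigr => x _.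
  apply: (sum_orthonormal (phi := fun y z => ip (L x y) (br x z)) Eb oE Fb oF).
    by move=> z k u v; rewrite L2 linearDl linearZl_LR.
  by move=> y k u v; rewrite br2 linearD linearZ.
rewrite exchange_big [RHS]exchange_big; apply: eq_bigr => y _ /=.
apply: (sum_orthonormal (phi := fun x z => ip (L x y) (br z y)) Eb oE Fb oF).
  by move=> z k u v; rewrite L1 linearDl linearZl_LR.
by move=> x k u v; rewrite br1 linearD linearZ.
Qed.

(** * Triangular changes of basis and derivations *)

Section Filtration.
Variables (R : realType) (V : vectType R) (br : V -> V -> V) (D : seq nat).
Variables (C : nat -> nat -> R) (e : nat -> V).
Hypothesis (Du : uniq D) (lie : is_lie br) (gr : graded br D C e).
Local Notation co := (gcoord D e).

Definition low (k : nat) (v : V) : Prop :=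
  forall a, a \in D -> (a < k)%N -> co a v = 0.

Lemma low0 k : low k 0.
Proof. by move=> a _ _; rewrite linear0. Qed.

Lemma lowD k u v : low k u -> low k v -> low k (u + v).
Proof. by move=> lu lv a aD ak; rewrite linearD /= lu// lv// addr0. Qed.

Lemma lowZ k c v : low k v -> low k (c *: v).
Proof. by move=> lv a aD ak; rewrite linearZ /= lv// mulr0. Qed.

Lemma lowB k u v : low k u -> low k v -> low k (u - v).
Proof. by move=> lu lv; rewrite -scaleN1r; apply/lowD/lowZ. Qed.

Lemma low_sum k (I : Type) (r : seq I) (P : pred I) F :
  (forall i, P i -> low k (F i)) -> low k (\sum_(i <- r | P i) F i).
Proof. move=> h; apply: big_ind => //; [exact: low0|exact: lowD]. Qed.

Lemma low_e k a : a \in D -> (k <= a)%N -> low k (e a).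
Proof.
move=> aD ka b bD bk; rewrite (gcoord_e Du gr.1)//; case: eqP => // ba; lia.
Qed.

Lemma lowW k l v : (k <= l)%N -> low l v -> low k v.
Proof. by move=> kl lv a aD ak; apply: lv => //; exact: leq_trans kl. Qed.

Lemma low_br k l u v : low k u -> low l v -> low (k + l)%N (br u v).
Proof.
move=> lu lv; rewrite (linear_gcoord Du gr.1 u (lie_linearl lie v)) big_seq.
apply: low_sum => a aD; have [ak|ka] := ltnP a k.
  by rewrite lu// scale0r; exact: low0.
apply: lowZ; rewrite (linear_gcoord Du gr.1 v (lie_linearr lie (e a))) big_seq.
apply: low_sum => b bD; have [bl|lb] := ltnP b l.
  by rewrite lv// scale0r; exact: low0.
apply: lowZ; rewrite gr.2//; case: ifP => abD; last exact: low0.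
by apply/lowZ/low_e => //; exact: leq_add.
Qed.

Lemma low_eq0 k v : (forall a, a \in D -> (a < k)%N) -> low k v -> v = 0.
Proof.
by move=> Dk lv; apply: (gcoord_inj Du gr.1) => a aD; rewrite lv ?Dk// linear0.
Qed.

(** For v in [low k], subtracting its k-th coordinate times f_k raises the level of v by one; as the
    degrees are bounded, this ends at 0 and writes v in terms of the f_a. *)
Lemma triangular_basis (f : nat -> V) :
  (forall a, a \in D -> low a.+1 (f a - e a)) ->
  basis_of {:V} [seq f a | a <- D].
Proof.
move=> fe; apply: (spanning_basis Du gr.1) => a aD.
pose N := (sumn D).+1.
have DN b : b \in D -> (b < N)%N.
  rewrite /N ltnS; elim: D => //= d s IH; rewrite inE => /orP[/eqP->|/IH]; first exact: leq_addr.
  by move=> /leq_trans; apply; exact: leq_addl.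
suff S m : forall k v, (N <= k + m)%N -> low k v -> v \in <<[seq f b | b <- D]>>%VS.
  apply: (S N a); [exact: leq_addl|exact: low_e].
elim: m => [|m IH] k v; first by rewrite addn0 => Nk /(low_eq0 (fun b bD => leq_trans (DN b bD) Nk)) ->; rewrite mem0v.
move=> Nk lv; have [kD|kD] := boolP (k \in D); last first.
  apply: (IH k.+1); first by rewrite addSnnS.
  move=> b bD; rewrite ltnS leq_eqVlt => /orP[/eqP bk|/lv]; last exact.
  by rewrite -bk bD in kD.
rewrite -[v](subrK (co k v *: f k)) rpredD ?rpredZ//; last first.
  by apply: memv_span; exact: map_f.
apply: (IH k.+1); first by rewrite addSnnS.
have -> : v - co k v *: f k = (v - co k v *: e k) - co k v *: (f k - e k).
  by rewrite scalerBr opprB addrA subrK.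
apply: lowB; last exact/lowZ/fe.
move=> b bD; rewrite ltnS leq_eqVlt => /orP[/eqP ->|bk].
  by rewrite linearB linearZ /= (gcoord_e Du gr.1)// eqxx mulr1 subrr.
by apply: (lowB lv _ bD bk); apply/lowZ/low_e.
Qed.
End Filtration.

Section Derivations.
Variables (R : realType) (V : vectType R) (br : V -> V -> V) (n : nat).
Variables (C : nat -> nat -> R) (e : nat -> V).
Let D := iota 1 n.
Hypothesis (lie : is_lie br) (gr : graded br D C e).
Hypothesis (n5 : (5 <= n)%N).
Hypothesis C1 : forall k, (2 <= k < n)%N -> C 1 k = 1.
Variable Dr : 'End(V).
Hypothesis der : derivation br Dr.
Local Notation co := (gcoord D e).
Local Notation low := (low D e).

Let Du : uniq D. Proof. exact: iota_uniq. Qed.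
Let inD k : (k \in D) = (0 < k <= n)%N.
Proof. by rewrite mem_iota add1n ltnS. Qed.

Lemma br1 k : (2 <= k < n)%N -> br (e 1%N) (e k) = e k.+1.
Proof.
move=> /[dup] k2 /C1 c; rewrite gr.2 ?inD; try lia.
by rewrite (_ : (0 < 1 + k <= n)%N) ?c ?scale1r//; lia.
Qed.

(** From k = 3 on, e_k is a bracket with e_1. A possible e_1-component of [Dr (e 2)] is killed by
    [e_1, e_1] = 0, so the level does not drop at e_3, nor afterwards. *)
Lemma der_low_ge3 k : (3 <= k <= n)%N -> low k (Dr (e k)).
Proof.
have low1 v : low 1 v by move=> a; rewrite inD; lia.
elim: k => // -[|[|[|k]]] // IH kn.
  rewrite -br1; last by lia.
  rewrite der; apply: lowD.
    by apply: (low_br Du lie gr (k := 1) (l := 2)) => //; apply: (low_e Du gr); rewrite ?inD; lia.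
  have -> : br (e 1%N) (Dr (e 2%N)) = br (e 1%N) (Dr (e 2%N) - co 1 (Dr (e 2%N)) *: e 1%N).
    rewrite (linear_funD _ _ (lie_linearr lie _)) -scaleNr (linear_funZ _ _ (lie_linearr lie _)).
    by rewrite (lie_alt lie) scaler0 addr0.
  apply: (low_br Du lie gr (k := 1) (l := 2)) => //.
  move=> a aD a2; have -> : a = 1%N by move: aD; rewrite inD; lia.
  by rewrite linearB linearZ /= (gcoord_e Du gr.1) ?inD ?eqxx ?mulr1 ?subrr//; lia.
rewrite -br1; last by lia.
rewrite der; apply: lowD.
  by apply: (low_br Du lie gr (k := 1) (l := k.+3)) => //; apply: (low_e Du gr); rewrite ?inD; lia.
by apply: (low_br Du lie gr (k := 1) (l := k.+3)) => //; apply: IH; lia.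
Qed.

(** Only an e_1-component of [Dr (e 2)] could violate the claim. Applying the derivation to
    [e_2, e_3], it would contribute a multiple of [e_1, e_3] = e_4, while all other terms have
    weight at least 5. *)
Lemma der_low k : (1 <= k <= n)%N -> low k (Dr (e k)).
Proof.
have low1 v : low 1 v by move=> a; rewrite inD; lia.
move=> kn; have [k3|k3] := leqP 3 k; first by apply: der_low_ge3; lia.
have [->//|k1] := eqVneq k 1%N.
have -> : k = 2%N by lia.
move=> a aD a2; have -> : a = 1%N by move: aD; rewrite inD; lia.
have /(congr1 (co 4)) := der (e 2%N) (e 3%N).
rewrite gr.2 ?inD; try lia.
rewrite (_ : (0 < 2 + 3 <= n)%N); last lia.
rewrite !linearZ linearD /=.
rewrite (@gcoord_brl _ _ _ _ _ _ Du lie gr _ 1 3) ?inD; try lia.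
rewrite C1 ?mulr1; last lia.
have -> : co 4 (Dr (e (2 + 3)%N)) = 0.
  by apply: der_low_ge3; rewrite ?inD; lia.
have -> : co 4 (br (e 2%N) (Dr (e 3%N))) = 0.
  apply: (low_br Du lie gr (k := 2) (l := 3)); rewrite ?inD//; try lia.
    by apply: (low_e Du gr); rewrite ?inD; lia.
  by apply: der_low_ge3; lia.
by rewrite mulr0 addr0.
Qed.

Let lam k := co k (Dr (e k)).

Lemma der_diag_add i j : i \in D -> j \in D -> (i + j)%N \in D -> C i j != 0 ->
  lam (i + j) = lam i + lam j.
Proof.
move=> iD jD ijD Cij; have /(congr1 (co (i + j)%N)) := der (e i) (e j).
rewrite gr.2// ijD !linearZ linearD /= (gcoord_brl Du lie gr)// (gcoord_brr Du lie gr)//.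
by rewrite -mulrDl mulrC => /(mulIf Cij).
Qed.

(** Brackets with e_1 give lam_k = lam_2 + (k - 2) lam_1; any further nonzero bracket then forces
    lam_2 = 2 lam_1. *)
Lemma der_diag : (exists i j, [/\ (2 <= i)%N, (2 <= j)%N, (i + j <= n)%N & C i j != 0]) ->
  forall k, (1 <= k <= n)%N -> lam k = k%:R * lam 1.
Proof.
move=> [i [j [i2 j2 ijn Cij]]].
have lamS k : (2 <= k <= n)%N -> lam k = lam 2 + (k - 2)%:R * lam 1.
  elim: k => // -[|[|k]] IH kn //; first by rewrite subnn mul0r addr0.
  rewrite -[k.+3]add1n der_diag_add ?inD ?C1 ?oner_eq0//; try lia.
  rewrite (IH ltac:(lia)).
  rewrite !subSS !subn0 -natr1; ring.
have iD : i \in D by rewrite inD; lia.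
have jD : j \in D by rewrite inD; lia.
have ijD : (i + j)%N \in D by rewrite inD; lia.
have := der_diag_add iD jD ijD Cij; rewrite (lamS i) ?(lamS j) ?(lamS (i + j)%N); try lia.
have [i' ->] : exists i', i = i'.+2 by exists (i - 2)%N; lia.
have [j' ->] : exists j', j = j'.+2 by exists (j - 2)%N; lia.
rewrite (_ : i'.+2 + j'.+2 - 2 = i' + j' + 2)%N; last lia.
rewrite !subSS !subn0 !natrD => h.
have l2 : lam 2 = 2 * lam 1 by move: h; lra.
move=> k k1; have [->|k2] := eqVneq k 1%N; first by rewrite mul1r.
rewrite (lamS k); last lia.
rewrite l2 -mulrDl -natrD; congr (_%:R * _); lia.
Qed.
End Derivations.

(** * Necessity: from an Einstein metric to a solution of the linear system *)

Section Necessity.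
Variables (R : realType) (V : vectType R) (br : V -> V -> V) (n : nat).
Variables (C : nat -> nat -> R) (e : nat -> V).
Let D := iota 1 n.
Hypothesis (lie : is_lie br) (gr : graded br D C e).
Hypothesis (n5 : (5 <= n)%N).
Hypothesis C1 : forall k, (2 <= k < n)%N -> C 1 k = 1.
Hypothesis Cn0 : exists i j, [/\ (2 <= i)%N, (2 <= j)%N, (i + j <= n)%N & C i j != 0].
Local Notation co := (gcoord D e).
Local Notation low := (low D e).

Let Du : uniq D. Proof. exact: iota_uniq. Qed.
Let inD k : (k \in D) = (0 < k <= n)%N.
Proof. by rewrite mem_iota add1n ltnS. Qed.

(** Back substitution: on [low k] the operator [Dr] - l is triangular with nonzero diagonal
    entries. *)
Lemma triangular_solve (Dr : 'End(V)) (l : R) (k : nat) (y : V) :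
  (forall a, a \in D -> low a (Dr (e a))) ->
  (forall a, a \in D -> (k <= a)%N -> co a (Dr (e a)) != l) ->
  low k y -> exists2 z, low k z & Dr z - l *: z = y.
Proof.
move=> Dlow.
suff S m : forall k y, (n < k + m)%N ->
    (forall a, a \in D -> (k <= a)%N -> co a (Dr (e a)) != l) ->
    low k y -> exists2 z, low k z & Dr z - l *: z = y.
  by apply: (S n.+1); lia.
elim: m => [|m IH] {}k {}y nk hl ly.
  exists 0; first exact: low0.
  rewrite linear0 scaler0 subrr (low_eq0 Du gr _ ly)// => a; rewrite inD; lia.
have hl' a : a \in D -> (k.+1 <= a)%N -> co a (Dr (e a)) != l.
  by move=> aD ka; apply: hl => //; lia.
have [kD|kD] := boolP (k \in D); last first.
  case: (IH k.+1 y); [lia|exact: hl'| |].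
    move=> a aD; rewrite ltnS leq_eqVlt => /orP[/eqP ak|/ly]; last exact.
    by rewrite -ak aD in kD.
  by move=> z lz zP; exists z => //; apply: lowW lz.
pose t := co k y / (co k (Dr (e k)) - l).
have ek : low k (e k) by exact: (low_e Du gr).
case: (IH k.+1 (y - (Dr (t *: e k) - l *: (t *: e k)))); [lia|exact: hl'| |].
  move=> a aD; rewrite ltnS leq_eqVlt => /orP[/eqP ->|ak].
    rewrite linearZ scalerA !linearB /= !linearZ /= (gcoord_e Du gr.1)// eqxx mulr1.
    rewrite /t; field; rewrite subr_eq0; exact: hl.
  apply: (lowB ly) => //; rewrite linearZ; apply: lowB; first exact/lowZ/Dlow.
  exact/lowZ/lowZ.
move=> z lz zP; exists (z + t *: e k); first by apply: lowD; [apply: lowW lz|exact: lowZ].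
rewrite linearD scalerDr opprD addrACA zP. by rewrite subrK.
Qed.

Lemma eigenbasis (Dr : 'End(V)) (l : R) : l != 0 ->
  (forall a, a \in D -> low a (Dr (e a))) ->
  (forall a, a \in D -> co a (Dr (e a)) = a%:R * l) ->
  exists f : nat -> V, (forall a, a \in D -> low a.+1 (f a - e a)) /\
    (forall a, a \in D -> Dr (f a) = (a%:R * l) *: f a).
Proof.
move=> l0 Dlow Ddiag.
have H a : exists v, a \in D -> low a.+1 (v - e a) /\ Dr v = (a%:R * l) *: v.
  have [aD|aD] := boolP (a \in D); last by exists 0.
  have la : low a.+1 (Dr (e a) - (a%:R * l) *: e a).
    move=> b bD; rewrite ltnS leq_eqVlt => /orP[/eqP ->|ba].
      by rewrite linearB linearZ /= (gcoord_e Du gr.1)// eqxx mulr1 Ddiag// subrr.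
    by apply: (lowB (Dlow a aD)) ba => //; apply/lowZ/(low_e Du gr).
  have [b bD ab|z lz zP] := triangular_solve (l := a%:R * l) Dlow _ la.
    by rewrite Ddiag// (inj_eq (mulIf l0)) eqr_nat; lia.
  exists (e a - z) => _; split; first by rewrite addrAC subrr sub0r -sub0r; apply: lowB => //; exact: low0.
  rewrite linearB scalerBr /=.
  have -> : Dr (e a) = Dr z - (a%:R * l) *: z + (a%:R * l) *: e a by rewrite zP subrK.
  by rewrite addrAC (addrAC (Dr z)) subrr sub0r addrC.
have [f fP] := boolp.choice H.
by exists f; split=> a aD; have [] := fP a aD.
Qed.

(** A bracket of eigenvectors is an eigenvector for the sum of the eigenvalues, and these are
    simple, so it is a multiple of f_(i+j). The factor is read off at the leading term: each f_a is
    e_a plus higher degrees, hence the constants stay the same. *)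
Lemma graded_eigenbasis (Dr : 'End(V)) (l : R) (f : nat -> V) : l != 0 ->
  derivation br Dr ->
  (forall a, a \in D -> low a.+1 (f a - e a)) ->
  (forall a, a \in D -> Dr (f a) = (a%:R * l) *: f a) ->
  graded br D C f.
Proof.
move=> l0 der fe Df; have fb := triangular_basis Du gr fe.
split=> // i j iD jD.
set v := br (f i) (f j).
have Dv : Dr v = ((i + j)%:R * l) *: v.
  rewrite /v der !Df// (linear_funZ _ _ (lie_linearl lie _)) (linear_funZ _ _ (lie_linearr lie _)).
  by rewrite -scalerDl natrD mulrDl.
have cov a : a \in D -> a != (i + j)%N -> gcoord D f a v = 0.
  move=> aD /negPf aij; have /(congr1 (gcoord D f a)) := Dv.
  rewrite {1}(gcoord_sum Du fb v) linear_sum linear_sum /= (bigD1_seq a)//=.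
  rewrite big_seq_cond big1 ?addr0 => [|b /andP[bD /negPf ba]]; last first.
    by rewrite linearZ /= Df// !linearZ /= (gcoord_e Du fb)// eq_sym ba !mulr0.
  rewrite linearZ /= Df// !linearZ /= (gcoord_e Du fb)// eqxx mulr1 mulrC => /eqP.
  rewrite -subr_eq0 -mulrBl mulf_eq0 -mulrBl mulf_eq0 (negPf l0) orbF subr_eq0.
  by rewrite eqr_nat aij => /eqP.
case: ifPn => [ijD|ijD]; last first.
  apply: (gcoord_inj Du fb) => a aD; rewrite linear0 cov//.
  by apply: contraNneq ijD => <-.
have vf : v = gcoord D f (i + j)%N v *: f (i + j)%N.
  rewrite {1}(gcoord_sum Du fb v) (bigD1_seq (i + j)%N)//= big_seq_cond big1 ?addr0//.
  by move=> b /andP[bD bij]; rewrite cov// scale0r.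
suff : gcoord D f (i + j)%N v = C i j by move=> <-.
have cof : co (i + j)%N (f (i + j)%N) = 1.
  have := fe _ ijD _ ijD (ltnSn _); rewrite linearB /= (gcoord_e Du gr.1)// eqxx => /eqP.
  by rewrite subr_eq0 => /eqP.
transitivity (co (i + j)%N v); first by rewrite [in RHS]vf linearZ /= cof mulr1.
have l1 k : k \in D -> low k (f k).
  move=> kD; rewrite -[f k](subrK (e k)); apply: lowD; first exact: lowW (fe k kD).
  exact: (low_e Du gr).
have -> : v = br (f i - e i) (f j) + (br (e i) (f j - e j) + br (e i) (e j)).
  rewrite -(linear_funD _ _ (lie_linearr lie _)) subrK.
  by rewrite -(linear_funD _ _ (lie_linearl lie _)) subrK.
rewrite !linearD /= (low_br Du lie gr (fe i iD) (l1 j jD))// ?addSn//.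
rewrite (low_br Du lie gr (low_e Du gr iD (leqnn i)) (fe j jD))// ?addnS//.
by rewrite gr.2// ijD linearZ /= (gcoord_e Du gr.1)// eqxx mulr1 !add0r.
Qed.

Lemma einstein_feasible : einstein_nilradical br -> feasible D C.
Proof.
move=> [_ [ip [c [Dr [ric [[rsym [E [Eb oE trE]]] c0 der ricE]]]]]].
pose N := diag_op D e (fun a => a%:R).
have derN : derivation br N := degree_derivation Du lie gr.
have diag := der_diag lie gr n5 C1 der Cn0.
pose l := co 1 (Dr (e 1%N)).
have Ddiag a : a \in D -> co a (Dr (e a)) = a%:R * l.
  by rewrite inD => aD; rewrite diag.
have Dlow a : a \in D -> low a (Dr (e a)).
  by rewrite inD => aD; exact: (der_low lie gr n5 C1 der).
(* Tr (ric N) = 0 as N is a derivation, whereas Tr (ric N) = c Tr N < 0 if l = 0. *)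
have l0 : l != 0.
  apply/eqP => l0; have := trE N.
  rewrite big1 ?mulr0; last first.
    move=> x _; apply: big1 => y _; rewrite derN [X in X - _]addrAC subrr add0r subrr.
    by rewrite linear0l.
  rewrite (lftrace_gcoord Du gr.1) ricE.
  rewrite (eq_big_seq (fun a : nat => c * a%:R)) => [|a aD].
    move=> /eqP; rewrite -mulr_sumr mulf_eq0 lt_eqF//= => /eqP s0.
    have : 0 < \sum_(i <- D) i%:R :> R.
      rewrite (bigD1_seq 1%N) ?inD//=; last by lia.
      by rewrite ltr_pwDl// sumr_ge0.
    by rewrite s0 ltxx.
  rewrite comp_lfunE (diag_opE Du gr.1)// add_lfunE scale_lfunE id_lfunE.
  by rewrite !linearD !linearZ /= (gcoord_e Du gr.1)// eqxx Ddiag// l0 !mulr0 addr0 mulr1.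
have [f [fe Df]] := eigenbasis l0 Dlow Ddiag.
have fgr := graded_eigenbasis l0 der fe Df.
have ricf a : a \in D -> ric (f a) = (c + a%:R * l) *: f a.
  by move=> aD; rewrite ricE add_lfunE scale_lfunE id_lfunE Df// scalerDl.
have fo a b : a \in D -> b \in D -> a != b -> ip (f a) (f b) = 0.
  move=> aD bD /negPf ab; have := rsym (f a) (f b); rewrite !ricf//.
  rewrite linearZl_LR linearZ /= => /eqP; rewrite -subr_eq0 -mulrBl mulf_eq0.
  have -> : c + a%:R * l - (c + b%:R * l) = (a%:R - b%:R) * l by ring.
  by rewrite mulf_eq0 subr_eq0 eqr_nat ab (negPf l0) /= => /eqP.
pose g a := if a \in D then ip (f a) (f a) else 1.
have g0 a : 0 < g a.
  rewrite /g; case: ifP => // aD; apply: neq0_dnorm_gt0; exact: (e_neq0 Du fgr).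
pose h a := (Num.sqrt (g a))^-1.
have h2 a : h a ^+ 2 = (g a)^-1 by rewrite exprVn sqr_sqrtr ?ltW.
have h0 a : h a != 0 by rewrite invr_eq0 gt_eqF// sqrtr_gt0.
have ipE x y : ip x y = \sum_(a <- D) g a * gcoord D f a x * gcoord D f a y.
  rewrite {1}(gcoord_sum Du fgr.1 x) linear_sumlz; apply: eq_big_seq => a aD.
  rewrite {1}(gcoord_sum Du fgr.1 y) linear_sumr (bigD1_seq a)//=.
  rewrite big_seq_cond big1 ?addr0 => [|b /andP[bD ba]]; last first.
    by rewrite linearZl_LR linearZ /= fo ?mulr0// eq_sym.
  by rewrite linearZl_LR linearZ /= /g aD; ring.
have Fb : basis_of {:V} [seq h a *: f a | a <- D].
  apply: (spanning_basis Du fgr.1 (f := fun a => h a *: f a)) => a aD.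
  rewrite -[f a](scalerK (h0 a)) rpredZ//; apply: memv_span.
  exact: (map_f (fun a => h a *: f a)).
have Fo : orthonormal ip [seq h a *: f a | a <- D].
  apply/orthonormal_nth => i j; rewrite size_map => iD jD.
  rewrite !(nth_map 0%N)//; set a := nth _ _ i; set b := nth _ _ j.
  have aD : a \in D by exact: mem_nth.
  have bD : b \in D by exact: mem_nth.
  rewrite -(nth_uniq 0%N iD jD Du) -/a -/b linearZl_LR linearZ /=.
  case: eqP => [<-|/eqP ab]; last by rewrite fo// !mulr0.
  by have := h2 a; rewrite /g aD mulrA -expr2 => ->; rewrite mulVf// gt_eqF//; have := g0 a; rewrite /g aD.
exists (fun a b => C a b ^+ 2 * (g (a + b)%N / (g a * g b))), (- 2 * c), (2 * l); split.
- by rewrite mulNr oppr_gt0 pmulr_rlt0.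
- move=> a b aD bD ab abD; case: eqP => [->|/eqP Cab]; first by rewrite expr0n /= mul0r.
  by rewrite mulr_gt0 ?exprn_even_gt0 ?divr_gt0 ?mulr_gt0.
move=> T; pose A := diag_op D f T.
have := trE A; rewrite (ricci_basis_change A lie Eb oE Fb Fo).
rewrite (ricci_sum Du lie fgr A ipE h2) (lftrace_gcoord Du fgr.1).
have -> : \sum_(a <- D) gcoord D f a ((ric \o A)%VF (f a)) =
          \sum_(a <- D) (c + a%:R * l) * T a.
  apply: eq_big_seq => a aD; rewrite comp_lfunE (diag_opE Du fgr.1)// linearZ /= ricf//.
  by rewrite !linearZ /= (gcoord_e Du fgr.1)// eqxx mulr1 mulrC.
set S := \sum_(a <- D) (c + _) * _ => h1.
suff -> : \sum_(a <- D) \sum_(b <- D | (a < b)%N && ((a + b)%N \in D))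
   C a b ^+ 2 * (g (a + b)%N / (g a * g b)) * (T a + T b - T (a + b)%N) = - 2 * S.
  by rewrite /S mulr_sumr; apply: eq_bigr => a _; ring.
rewrite h1 !mulrA; have -> : -2 * 4^-1 * (-2) = 1 :> R by lra.
rewrite mul1r; apply: eq_big_seq => a aD.
rewrite [LHS]big_mkcond [RHS]big_mkcond; apply: eq_big_seq => b bD.
case: ifP => // /andP[_ abD].
by rewrite /A !(diag_opE Du fgr.1)// !linearZ /= !(gcoord_e Du fgr.1)// !eqxx !mulr1.
Qed.
End Necessity.

(** * Structure constants *)

(* The relations satisfied by the structure constants c of [e_i, e_j], i, j >= 2,
   up to weight m: skew-symmetry and the Jacobi identity for e_1, e_i, e_j and for
   e_i, e_j, e_l. *)
Record coef_sys (R : realType) (m : nat) (c : nat -> nat -> R) : Prop := CoefSys {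
  cs_anti : forall i j, (2 <= i)%N -> (2 <= j)%N -> (i + j <= m)%N ->
    c j i = - c i j;
  cs_rec : forall i j, (2 <= i)%N -> (2 <= j)%N -> (i + j < m)%N ->
    c i j = c i.+1 j + c i j.+1;
  cs_jac : forall i j l, (2 <= i)%N -> (2 <= j)%N -> (2 <= l)%N -> (i + j + l <= m)%N ->
    c j l * c i (j + l)%N + c l i * c j (l + i)%N + c i j * c l (i + j)%N = 0 }.

Section Coefficients.
Variables (R : realType) (m : nat) (c : nat -> nat -> R).
Hypothesis sys : coef_sys m c.

Lemma cs_diag i : (2 <= i)%N -> (i + i <= m)%N -> c i i = 0.
Proof. by move=> i2 im; have := cs_anti sys i2 i2 im; lra. Qed.

Definition agree (c' : nat -> nat -> R) (w : nat) : Prop :=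
  forall i j, (2 <= i)%N -> (2 <= j)%N -> (i + j <= w)%N -> c i j = c' i j.
End Coefficients.

Section Agree.
Variables (R : realType) (m : nat) (c c' : nat -> nat -> R).
Hypotheses (sys : coef_sys m c) (sys' : coef_sys m c').

(** When two solutions agree in weight w, the recursion coming from e_1 makes their difference in
    weight w + 1 change sign from each pair to the next. Each weight thus carries at most one
    unknown. *)
Lemma agree_alternate w : (w < m)%N -> agree c c' w ->
  forall k l, (k.+2 + l = w.+1)%N -> (2 <= l)%N ->
  c k.+2 l - c' k.+2 l = (-1) ^+ k * (c 2 (w - 1)%N - c' 2 (w - 1)%N).
Proof.
move=> wm ag; elim=> [|k IH] l kl l2.
  by rewrite expr0 mul1r (_ : l = w - 1)%N//; lia.
rewrite exprS -mulrA -(IH l.+1) ?mulN1r; try lia.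
have h1 := cs_rec sys (i := k.+2) (j := l) ltac:(lia) ltac:(lia) ltac:(lia).
have h2 := cs_rec sys' (i := k.+2) (j := l) ltac:(lia) ltac:(lia) ltac:(lia).
have h3 := ag k.+2 l ltac:(lia) ltac:(lia) ltac:(lia).
by move: h1 h2 h3; lra.
Qed.

Lemma agree_step w i j : (w < m)%N -> agree c c' w -> (2 <= i)%N -> (2 <= j)%N ->
  (i + j = w.+1)%N -> c i j = c' i j -> agree c c' w.+1.
Proof.
move=> wm ag i2 j2 ij ci; have alt := agree_alternate wm ag.
have z0 : c 2 (w - 1)%N - c' 2 (w - 1)%N = 0.
  have := alt (i - 2)%N j ltac:(lia) j2; rewrite (_ : (i - 2).+2 = i); last lia.
  by rewrite ci subrr => /esym/eqP; rewrite mulf_eq0 signr_eq0 /= => /eqP.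
move=> k l k2 l2; rewrite leq_eqVlt => /orP[/eqP kl|]; last by rewrite ltnS => kl; exact: ag.
have := alt (k - 2)%N l ltac:(lia) l2.
rewrite z0 mulr0 (_ : (k - 2).+2 = k); last lia.
by move/eqP; rewrite subr_eq0 => /eqP.
Qed.

(** In even weight the diagonal entry is zero by skew-symmetry, which settles the unknown. *)
Lemma agree_even w : (w < m)%N -> agree c c' w -> (4 <= w.+1)%N -> ~~ odd w.+1 ->
  agree c c' w.+1.
Proof.
move=> wm ag w4 we; apply: (agree_step (i := w.+1./2) (j := w.+1./2) wm ag); try lia.
by rewrite (cs_diag sys) ?(cs_diag sys')//; lia.
Qed.

(** The Jacobi identity of e_2, e_3, e_(w-4) is linear in the entries of weight w + 1, with
    coefficients of lower weight. By alternation the difference of the two identities is the unknown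
    times the sum assumed nonzero. From weight 9 on the three vectors are distinct. *)
Lemma agree_odd w : (w < m)%N -> agree c c' w -> (9 <= w.+1)%N -> odd w.+1 ->
  c 3 (w - 4)%N + c 2 (w - 4)%N + c 2 3 != 0 -> agree c c' w.+1.
Proof.
move=> wm ag w9 wo n0; have alt := agree_alternate wm ag.
apply: (agree_step (i := 2) (j := w - 1) wm ag) => //; try lia.
have := cs_jac sys (i := 2) (j := 3) (l := w - 4) ltac:(lia) ltac:(lia) ltac:(lia) ltac:(lia).
have := cs_jac sys' (i := 2) (j := 3) (l := w - 4) ltac:(lia) ltac:(lia) ltac:(lia) ltac:(lia).
rewrite -!(ag 2 3 ltac:(lia) ltac:(lia) ltac:(lia)).
rewrite -!(ag 3 (w - 4)%N ltac:(lia) ltac:(lia) ltac:(lia)).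
rewrite -!(ag (w - 4)%N 2 ltac:(lia) ltac:(lia) ltac:(lia)).
rewrite (cs_anti sys (i := 2) (j := w - 4) ltac:(lia) ltac:(lia) ltac:(lia)).
rewrite (_ : (3 + (w - 4) = w - 1)%N); last lia.
rewrite (_ : (w - 4 + 2 = w - 2)%N); last lia.
have := alt 1%N (w - 2)%N ltac:(lia) ltac:(lia); rewrite expr1 mulN1r.
have := alt (w - 6)%N 5%N ltac:(lia) ltac:(lia); rewrite -signr_odd.
rewrite (_ : odd (w - 6) = false) ?expr0 ?mul1r; last by move: wo; lia.
rewrite (_ : (w - 6).+2 = w - 4)%N; last lia.
rewrite (_ : (2 + 3 = 5)%N)//.
set x := c 2 (w - 1)%N; set x' := c' 2 (w - 1)%N.
set y := c 3 (w - 2)%N; set y' := c' 3 (w - 2)%N.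
set z := c (w - 4)%N 5%N; set z' := c' (w - 4)%N 5%N => h1 h2 h3 h4.
have : (c 3 (w - 4)%N + c 2 (w - 4)%N + c 2 3) * (x - x') = 0.
  have zE : z = z' + (x - x') by lra.
  have yE : y = y' - (x - x') by lra.
  by move: h3 h4; rewrite zE yE; lra.
by move/eqP; rewrite mulf_eq0 (negPf n0) subr_eq0 => /eqP.
Qed.
End Agree.

(* V(n), rescaled so that [e_1, e_i] = e_(i+1) and the coefficient at (2, 3) is 1. *)
Definition witt_coef (R : realType) (i j : nat) : R :=
  6 * (j%:R - i%:R) * ((i - 2)`!)%:R * ((j - 2)`!)%:R / ((i + j - 2)`!)%:R.

(** The algebra m_2: besides those with e_1, the only brackets are [e_2, e_j] = e_(j+2). *)
Definition m2_table (R : realType) (i j : nat) : R :=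
  if i == j then 0 else if i == 2%N then 1 else if j == 2%N then -1 else 0.

Lemma coef_sysZ (R : realType) m (c : nat -> nat -> R) k :
  coef_sys m c -> coef_sys m (fun i j => k * c i j).
Proof.
move=> [ca cr cj]; split=> [i j i2 j2 ij|i j i2 j2 ij|i j l i2 j2 l2 ijl].
- by rewrite ca// mulrN.
- by rewrite cr// mulrDr.
- have := cj i j l i2 j2 l2 ijl; move: (c j l) (c l i) (c i j) (c i _) (c j _) (c l _).
  by move=> x y z x' y' z' h; rewrite -[RHS](mulr0 (k * k)) -h; ring.
Qed.

Lemma witt_coefE (R : realType) i j :
  witt_coef R i.+2 j.+2 =
  6 * (j%:R - i%:R) * (i`!)%:R * (j`!)%:R / ((i + j).+2`!)%:R.
Proof.
rewrite /witt_coef (_ : (i.+2 + j.+2 - 2 = (i + j).+2)%N); last lia.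
rewrite !subSS !subn0.
by rewrite -![_.+2%:R]natr1; congr (_ / _); ring.
Qed.

Lemma witt_coef_sys (R : realType) m : coef_sys m (@witt_coef R).
Proof.
have f0 (k : nat) : (k`!)%:R != 0 :> R by rewrite pnatr_eq0 -lt0n fact_gt0.
split=> [i j i2 j2 ij|[|[|i]] [|[|j]]//= _ _ ij|[|[|i]] [|[|j]] [|[|l]]//= _ _ _ ijl].
- rewrite /witt_coef addnC; ring.
- rewrite !witt_coefE addSn addnS !factS !natrM -!natr1 natrD.
  by field; rewrite f0 -natrD !natr1 !pnatr_eq0.
- rewrite (_ : j.+2 + l.+2 = (j + l).+2.+2)%N; last lia.
  rewrite (_ : l.+2 + i.+2 = (l + i).+2.+2)%N; last lia.
  rewrite (_ : i.+2 + j.+2 = (i + j).+2.+2)%N; last lia.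
  rewrite !witt_coefE.
  rewrite (_ : i + (j + l).+2 = (i + j + l).+2)%N; last lia.
  rewrite (_ : j + (l + i).+2 = (i + j + l).+2)%N; last lia.
  rewrite (_ : l + (i + j).+2 = (i + j + l).+2)%N; last lia.
  move: (f0 (i + j + l).+2.+2) (f0 (j + l).+2) (f0 (l + i).+2) (f0 (i + j).+2).
  move: (_.+4`!%:R) ((j + l).+2`!%:R) ((l + i).+2`!%:R) ((i + j).+2`!%:R) => A B C E *.
  rewrite -!natr1 !natrD.
  by field; apply/and4P.
Qed.

Lemma m2_table_sys (R : realType) m : coef_sys m (@m2_table R).
Proof.
split=> [i j i2 j2 ij|i j i2 j2 ij|i j l i2 j2 l2 ijl]; rewrite /m2_table.
- by do ![case: eqP => ?]; try lia; lra.
- by do ![case: eqP => ?]; try lia; lra.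
- by do ![case: eqP => ?; try lia]; lra.
Qed.

(** * Coefficients of weight at most 12 in terms of c_23, c_34, c_45, c_56 *)

Section Tables.
Variables (R : realType) (m : nat) (c : nat -> nat -> R).
Hypothesis sys : coef_sys m c.
Local Notation a := (c 2 3).
Local Notation b := (c 3 4).
Local Notation u := (c 4 5).
Local Notation w := (c 5 6).

(** Each weight is solved from its innermost pair outwards: in odd weight c_(k,k+1) is a new
    parameter, in even weight c_kk = 0 starts the recursion. *)
Lemma cs_weight6 : (6 <= m)%N -> c 2 4 = a.
Proof.
move=> m6; have := cs_rec sys (i := 2) (j := 3) isT isT m6.
by rewrite (cs_diag sys (i := 3))// add0r.
Qed.

Lemma cs_weight7 : (7 <= m)%N -> c 2 5 = a - b.
Proof.
move=> m7; have := cs_rec sys (i := 2) (j := 4) isT isT m7.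
by rewrite cs_weight6; [lra|lia].
Qed.

Lemma cs_weight8 : (8 <= m)%N -> c 2 6 = a - 2 * b /\ c 3 5 = b.
Proof.
move=> m8; have := cs_rec sys (i := 2) (j := 5) isT isT m8.
have := cs_rec sys (i := 3) (j := 4) isT isT m8.
by rewrite (cs_diag sys (i := 4))// cs_weight7; [split; lra|lia].
Qed.

Lemma cs_weight9 : (9 <= m)%N -> c 2 7 = a - 3 * b + u /\ c 3 6 = b - u.
Proof.
move=> m9; have := cs_rec sys (i := 2) (j := 6) isT isT m9.
have := cs_rec sys (i := 3) (j := 5) isT isT m9.
by have [-> ->] := cs_weight8 (ltnW m9); split; lra.
Qed.

Lemma cs_weight10 : (10 <= m)%N ->
  [/\ c 2 8 = a - 4 * b + 3 * u, c 3 7 = b - 2 * u & c 4 6 = u].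
Proof.
move=> m10; have := cs_rec sys (i := 2) (j := 7) isT isT m10.
have := cs_rec sys (i := 3) (j := 6) isT isT m10.
have := cs_rec sys (i := 4) (j := 5) isT isT m10.
have [-> ->] := cs_weight9 (ltnW m10).
by rewrite (cs_diag sys (i := 5))//; split; lra.
Qed.

Lemma cs_weight11 : (11 <= m)%N ->
  [/\ c 2 9 = a - 5 * b + 6 * u - w, c 3 8 = b - 3 * u + w & c 4 7 = u - w].
Proof.
move=> m11; have := cs_rec sys (i := 2) (j := 8) isT isT m11.
have := cs_rec sys (i := 3) (j := 7) isT isT m11.
have := cs_rec sys (i := 4) (j := 6) isT isT m11.
by have [-> -> ->] := cs_weight10 (ltnW m11); split; lra.
Qed.

Lemma cs_weight12 : (12 <= m)%N -> [/\ c 3 9 = b - 4 * u + 3 * w, c 4 8 = u - 2 * w & c 5 7 = w].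
Proof.
move=> m12.
have := cs_rec sys (i := 3) (j := 8) isT isT m12.
have := cs_rec sys (i := 4) (j := 7) isT isT m12.
have := cs_rec sys (i := 5) (j := 6) isT isT m12.
have [_ -> ->] := cs_weight11 (ltnW m12).
by rewrite (cs_diag sys (i := 6))//; split; lra.
Qed.

(** The first Jacobi identity not involving e_1 is that of e_2, e_3, e_4. The triples (2, 4, 5) and
    (3, 4, 5) give the relations of weights 11 and 12 below. *)
Lemma cs_rel9 : (9 <= m)%N -> u * (2 * a + b) = 3 * b ^+ 2.
Proof.
move=> m9; have := cs_jac sys (i := 2) (j := 3) (l := 4) isT isT isT m9.
rewrite /= (cs_anti sys (i := 2) (j := 4)) ?(cs_anti sys (i := 4) (j := 5))//; try lia.
rewrite cs_weight6; last lia.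
by rewrite !addnS !addn0 /=; have [-> ->] := cs_weight9 m9; lra.
Qed.

Lemma cs_rel11 : (11 <= m)%N -> w * (2 * a - b - u) = 4 * b * u - 6 * u ^+ 2.
Proof.
move=> m11; have := cs_jac sys (i := 2) (j := 4) (l := 5) isT isT isT m11.
rewrite /= (cs_anti sys (i := 2) (j := 5)) ?(cs_anti sys (i := 5) (j := 6))//; try lia.
rewrite !addnS !addn0 /= cs_weight7; last lia.
rewrite cs_weight6; last lia.
by have [-> _ ->] := cs_weight11 m11; lra.
Qed.

Lemma cs_rel12 : (12 <= m)%N -> 3 * w * (b + u) = 4 * u ^+ 2.
Proof.
move=> m12; have := cs_jac sys (i := 3) (j := 4) (l := 5) isT isT isT m12.
rewrite /= (cs_anti sys (i := 3) (j := 5)) ?(cs_anti sys (i := 5) (j := 7))//; try lia.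
rewrite !addnS !addn0 /=; have [_ ->] := cs_weight8 ltac:(lia).
by have [-> -> ->] := cs_weight12 m12; lra.
Qed.

(** The relations of weights 9, 11 and 12 leave a single ray, (a, b, u, w) proportional to (70, 7,
    1, 1/6), on which [witt_coef] lies. All higher weights follow by [agree_even] and
    [agree_odd]. *)
Lemma cs_case_witt : (12 <= m)%N -> b != 0 -> a != 0 /\ agree c (fun i j => a * witt_coef R i j) m.
Proof.
move=> m12 b0.
have r9 := cs_rel9 ltac:(lia); have r11 := cs_rel11 ltac:(lia); have r12 := cs_rel12 m12.
have u0 : u != 0.
  apply/eqP => u0; move: r9; rewrite u0 mul0r => /esym/eqP.
  by rewrite mulf_eq0 expf_eq0 (negPf b0) pnatr_eq0.
have bE : b = 7 * u.
  (* This combination eliminates w between the relations of weights 11 and 12, and a by that of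
     weight 9. *)
  have : 2 * u ^+ 2 * (7 * u - b) = 0.
    have -> : 2 * u ^+ 2 * (7 * u - b) =
      3 * (b + u) * (w * (2 * a - b - u) - (4 * b * u - 6 * u ^+ 2))
      - (2 * a - b - u) * (3 * w * (b + u) - 4 * u ^+ 2)
      - 4 * u * (u * (2 * a + b) - 3 * b ^+ 2) by ring.
    by rewrite r9 r11 r12 !subrr !mulr0 !subr0.
  move/eqP; rewrite !mulf_eq0 ?expf_eq0 (negPf u0) pnatr_eq0 /= subr_eq0.
  by move=> /eqP ->.
have aE : a = 70 * u.
  apply: (mulfI u0); move: r9; rewrite bE => h; nra.
have wE : w = u / 6.
  apply: (mulfI u0); move: r12; rewrite bE => h; nra.
have a0 : a != 0 by rewrite aE mulf_neq0// pnatr_eq0.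
split=> //.
have sysw := coef_sysZ a (@witt_coef_sys R m).
pose c' i j := a * witt_coef R i j.
have wt i j (x : R) : 6 * (j%:R - i%:R) * (i`!)%:R * (j`!)%:R = x * ((i + j).+2`!)%:R ->
    witt_coef R i.+2 j.+2 = x.
  move=> h; rewrite witt_coefE h mulfK// pnatr_eq0 -lt0n fact_gt0//.
have w23 : c 2 3 = c' 2 3 by rewrite /c' (wt 0 1 1) ?mulr1// !factS !natrM fact0; ring.
have w34 : c 3 4 = c' 3 4.
  by rewrite /c' (wt 1 2 10^-1); [rewrite bE aE; field|rewrite !factS !natrM fact0; field].
have w45 : c 4 5 = c' 4 5.
  by rewrite /c' (wt 2 3 70^-1); [rewrite aE; field|rewrite !factS !natrM fact0; field].
have w56 : c 5 6 = c' 5 6.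
  rewrite /c' (wt 3 4 420^-1); first by rewrite wE aE; field.
  rewrite (_ : (3 + 4).+2 = 9)%N// !factS !natrM fact0. by field.
have e4 : agree c c' 4.
  move=> i j i2 j2 ij; have [-> ->] : i = 2 /\ j = 2 by lia.
  by rewrite /c' /witt_coef subrr !(mulr0, mul0r) (cs_diag sys)//; lia.
suff S k : (4 + k <= m)%N -> agree c c' (4 + k) by have := S (m - 4)%N; rewrite subnKC; [apply|]; lia.
elim: k => [_|k IH km]; first exact: e4.
have {}IH := IH ltac:(lia); rewrite addnS; rewrite addnS in km.
have [ke|ko] := boolP (odd (4 + k).+1); last exact: (agree_even sys sysw km IH isT ko).
have [k8|k8] := leqP 13 (4 + k).+1; last first.
  have [k1|[k1|[k1|k1]]] : k = 0 \/ k = 2 \/ k = 4 \/ k = 6 by move: ke k8; lia.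
  - by apply: (agree_step (i := 2) (j := 3) sys sysw km IH isT isT _ w23); rewrite k1.
  - by apply: (agree_step (i := 3) (j := 4) sys sysw km IH isT isT _ w34); rewrite k1.
  - by apply: (agree_step (i := 4) (j := 5) sys sysw km IH isT isT _ w45); rewrite k1.
  - by apply: (agree_step (i := 5) (j := 6) sys sysw km IH isT isT _ w56); rewrite k1.
(* The sum in [agree_odd] is c_23 times a sum of three values of [witt_coef] at pairs i < j, all of
   them positive. *)
apply: (agree_odd sys sysw) => //; first by lia.
rewrite !IH; try lia.
have wpos i j : (i < j)%N -> 0 < witt_coef R i.+2 j.+2.
  move=> ij; rewrite witt_coefE divr_gt0// ?ltr0n ?fact_gt0//.
  by rewrite !mulr_gt0 ?ltr0n ?fact_gt0// subr_gt0 ltr_nat.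
rewrite /c' -!mulrDr mulf_neq0// gt_eqF// !addr_gt0//; first 1 last.
- by have := wpos 0 (4 + k - 6)%N; rewrite (_ : (4 + k - 6).+2 = 4 + k - 4)%N; [apply|]; lia.
- exact: (wpos 0 1).
by have := wpos 1 (4 + k - 6)%N; rewrite (_ : (4 + k - 6).+2 = 4 + k - 4)%N; [apply|]; lia.
Qed.
End Tables.

(** * Structure constants with c_34 = 0 *)

Section Cases.
Variables (R : realType) (m : nat) (c : nat -> nat -> R).
Hypothesis sys : coef_sys m c.
Hypothesis m7 : (7 <= m)%N.

(** For the table of m_2 the sum in [agree_odd] is 2 c_23, so no parameter besides c_23 survives. *)
Lemma cs_case_m2 : c 3 4 = 0 -> c 2 3 != 0 ->
  agree c (fun i j => c 2 3 * m2_table R i j) m.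
Proof.
move=> b0 a0; pose c' i j := c 2 3 * m2_table R i j.
have sysm := coef_sysZ (c 2 3) (@m2_table_sys R m).
have e4 : agree c c' 4.
  move=> i j i2 j2 ij; have [-> ->] : i = 2 /\ j = 2 by lia.
  by rewrite /c' /m2_table eqxx mulr0 (cs_diag sys)//; lia.
suff S k : (4 + k <= m)%N -> agree c c' (4 + k) by have := S (m - 4)%N; rewrite subnKC; [apply|]; lia.
elim: k => [_|k IH km]; first exact: e4.
have {}IH := IH ltac:(lia); rewrite addnS; rewrite addnS in km.
have [ke|ko] := boolP (odd (4 + k).+1); last exact: (agree_even sys sysm km IH isT ko).
have [k8|k8] := leqP 9 (4 + k).+1; last first.
  have [k1|k1] : k = 0 \/ k = 2 by move: ke k8; lia.
    apply: (agree_step sys sysm (i := 2) (j := 3) km IH) => //; first by rewrite k1.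
    by rewrite /m2_table /= mulr1.
  apply: (agree_step sys sysm (i := 3) (j := 4) km IH) => //; first by rewrite k1.
  by rewrite /m2_table /= mulr0.
apply: (agree_odd sys sysm) => //.
have h3 : m2_table R 3 (4 + k - 4) = 0 by rewrite /m2_table; do ![case: eqP => ?; try lia].
have h2 : m2_table R 2 (4 + k - 4) = 1 by rewrite /m2_table; do ![case: eqP => ?; try lia].
rewrite (IH 3) ?(IH 2 (4 + k - 4)%N); try lia.
by rewrite /c' h3 h2 mulr0 mulr1 add0r -mulr2n mulrn_eq0.
Qed.

Lemma coef_sys0 : coef_sys m (fun _ _ => 0 : R).
Proof. by split=> *; lra. Qed.

(* The algebras m_{0,1}, m_{0,2}, m_{0,3}: the lowest weight w of a nonzero
   coefficient is odd, and w >= m - 2. *)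
Lemma cs_case_zero : c 3 4 = 0 -> c 2 3 = 0 ->
  (exists i j, [/\ (2 <= i)%N, (2 <= j)%N, (i + j <= m)%N & c i j != 0]) ->
  exists w (d : R),
    [/\ odd w, (9 <= w <= m)%N & (m <= w + 2)%N] /\
    [/\ d != 0,
        forall i j, (2 <= i)%N -> (2 <= j)%N -> (i + j < w)%N -> c i j = 0,
        forall i j, (2 <= i)%N -> (2 <= j)%N -> (i + j = w)%N -> c i j = (-1) ^+ i * d,
        (w < m)%N -> c 2 (w - 1)%N = ((w - 3)./2)%:R * d &
        (w + 2 <= m)%N -> c 2 w = 0 /\ c 3 (w - 1)%N = c 2 (w - 1)%N].
Proof.
move=> b0 a0 [i0 [j0 [i02 j02 ij0 cn0]]].
pose P w := has (fun i => c i.+2 (w - i.+2)%N != 0) (iota 0 (w - 3)).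
have PP w : (w <= m)%N -> ~~ P w ->
    forall i j, (2 <= i)%N -> (2 <= j)%N -> (i + j = w)%N -> c i j = 0.
  move=> wm /negP nP i j i2 j2 ij; apply/eqP/negPn/negP => cn; apply: nP.
  have [i' iE] : exists i', i = i'.+2 by exists (i - 2)%N; lia.
  apply/hasP; exists i'; first by rewrite mem_iota; lia.
  by rewrite -iE (_ : (w - i)%N = j)//; lia.
have exP : exists w, P w.
  exists (i0 + j0)%N; apply/negPn/negP => nP.
  by move: cn0; rewrite (PP _ ij0 nP i0 j0)// eqxx.
case: (ex_minnP exP) => w Pw wmin.
have wm : (w <= m)%N.
  rewrite leqNgt; apply/negP => mw; move: cn0; rewrite (PP _ ij0 _ i0 j0) ?eqxx//.
  by apply/negP => /wmin; lia.
have low i j : (2 <= i)%N -> (2 <= j)%N -> (i + j < w)%N -> c i j = 0.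
  move=> i2 j2 ijw; apply: (PP (i + j)%N) => //; first by lia.
  by apply/negP => /wmin; lia.
have w4 : (4 <= w)%N.
  by case/hasP: Pw => i; rewrite mem_iota; lia.
have [w' wE] : exists w', w = w'.+1 by exists w.-1; lia.
have ag : agree c (fun _ _ => 0) w' by move=> i j i2 j2 ij; apply: low; lia.
have w'm : (w' < m)%N by lia.
have nag : ~ agree c (fun _ _ => 0) w'.+1.
  move=> ag'; case/hasP: Pw => i; rewrite mem_iota => iw /negP; apply; apply/eqP.
  by apply: ag'; lia.
have wodd : odd w.
  apply/negPn/negP => we; apply: nag; rewrite -wE.
  have := agree_even sys coef_sys0 w'm ag.
  by rewrite -wE; apply.
have w9 : (9 <= w)%N.
  have [//|w8] := leqP 9 w; have [w5|w7] : w = 5 \/ w = 7 by move: wodd w8 w4; lia.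
    by case: nag; apply: (agree_step sys coef_sys0 (i := 2) (j := 3) w'm ag) => //; lia.
  by case: nag; apply: (agree_step sys coef_sys0 (i := 3) (j := 4) w'm ag) => //; lia.
pose d := c 2 (w - 2)%N.
have cw i j : (2 <= i)%N -> (2 <= j)%N -> (i + j = w)%N -> c i j = (-1) ^+ i * d.
  case: i => [|[|i]]// _ j2 ij.
  have := agree_alternate sys coef_sys0 w'm ag (k := i) (l := j) ltac:(lia) j2.
  have -> : (w' - 1 = w - 2)%N by lia.
  by rewrite !subr0 => ->; rewrite !exprS !mulN1r opprK.
have d0 : d != 0.
  apply/eqP => d0; apply: nag; apply: (agree_step sys coef_sys0 (i := 2) (j := w - 2) w'm ag) => //; lia.
pose k := w./2; have kE : w = (k + k).+1 by rewrite /k; lia.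
have k4 : (4 <= k)%N by lia.
have c1 : (w < m)%N -> forall j l, (j.+2 + l = w.+1)%N -> (2 <= l)%N ->
    c j.+2 l = (-1) ^+ j * (c 2 (w - 1)%N - j%:R * d).
  move=> wm1; elim=> [|j IH] l jl l2.
    by rewrite expr0 mul1r mul0r subr0; congr (c 2 _); lia.
  have := cs_rec sys (i := j.+2) (j := l) ltac:(lia) ltac:(lia) ltac:(lia).
  rewrite (cw j.+2 l) ?(IH l.+1); try lia.
  by rewrite !exprS -natr1; move: ((-1) ^+ j) => s; lra.
(* As w = 2k + 1, weight w + 1 contains the diagonal pair (k + 1, k + 1), where the formula must
   vanish. *)
have c1p : (w < m)%N -> c 2 (w - 1)%N = (k - 1)%:R * d.
  move=> wm1; have := c1 wm1 (k - 1)%N k.+1 ltac:(lia) ltac:(lia).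
  rewrite (_ : (k - 1).+2 = k.+1) ?(cs_diag sys); try lia.
  move=> /esym/eqP; rewrite mulf_eq0 signr_eq0 /= subr_eq0 => /eqP //.
have c2 : (w + 2 <= m)%N -> c 2 w = 0.
  move=> wm2; have := cs_jac sys (i := 2) (j := 3) (l := w - 3) ltac:(lia) ltac:(lia) ltac:(lia) ltac:(lia).
  rewrite (low 2 3) ?(low (w - 3)%N 2) ?(cw 3 (w - 3)%N); try lia.
  rewrite (_ : (3 + (w - 3) = w)%N); last lia.
  rewrite !mul0r !addr0 (_ : (-1) ^+ 3 * d = - d) ?mulNr; last by ring.
  by move=> /eqP; rewrite oppr_eq0 mulf_eq0 (negPf d0) => /eqP.
(* Solving the recursion in weight w + 2 gives binomial coefficients of order 2, whose denominator
   the factor 2 clears; the factor 6 plays this role in weight w + 3. *)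
have c2H : (w + 2 <= m)%N -> forall j l, (j.+2 + l = w.+2)%N -> (2 <= l)%N ->
    2 * c j.+2 l = (-1) ^+ j * - (2 * j%:R * c 2 (w - 1)%N - j%:R * (j%:R - 1) * d).
  move=> wm2; elim=> [|j IH] l jl l2.
    rewrite (_ : l = w) ?c2; try lia.
    by rewrite expr0; lra.
  have := cs_rec sys (i := j.+2) (j := l) ltac:(lia) ltac:(lia) ltac:(lia).
  rewrite (c1 ltac:(lia) j l); try lia.
  have := IH l.+1 ltac:(lia) ltac:(lia).
  by rewrite !exprS -natr1; move: ((-1) ^+ j) => s; lra.
exists w, d; split; last first.
  split=> //; first by move=> wm1; rewrite c1p//; congr (_%:R * _); lia.
  move=> wm2; split; first exact: c2.
  have := c2H wm2 1%N (w - 1)%N ltac:(lia) ltac:(lia); rewrite expr1; lra.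
split=> //; first by lia.
rewrite leqNgt; apply/negP => wm3.
have c3 : c 2 w.+1 = 0.
  have := cs_jac sys (i := 2) (j := 4) (l := w - 3) ltac:(lia) ltac:(lia) ltac:(lia) ltac:(lia).
  rewrite (low 2 4) ?(low (w - 3)%N 2); try lia.
  rewrite (_ : (4 + (w - 3) = w.+1)%N); last lia.
  rewrite (c1 ltac:(lia) 2 (w - 3)%N ltac:(lia) ltac:(lia)) c1p; last lia.
  rewrite sqrrN expr1n mul1r -mulrBl !mul0r !addr0 => /eqP; rewrite !mulf_eq0 (negPf d0) orbF.
  by rewrite subr_eq0 eqr_nat => /orP[|/eqP//]; lia.
have c3K : forall j l, (j.+2 + l = w.+3)%N -> (2 <= l)%N ->
    6 * c j.+2 l = (-1) ^+ j * (3 * j%:R * (j%:R - 1) * c 2 (w - 1)%N - j%:R * (j%:R - 1) * (j%:R - 2) * d).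
  elim=> [|j IH] l jl l2.
    rewrite (_ : l = w.+1) ?c3; try lia.
    by rewrite expr0; lra.
  have := cs_rec sys (i := j.+2) (j := l) ltac:(lia) ltac:(lia) ltac:(lia).
  have := c2H ltac:(lia) j l ltac:(lia) ltac:(lia).
  have := IH l.+1 ltac:(lia) ltac:(lia).
  by rewrite !exprS -natr1; move: ((-1) ^+ j) => s; lra.
(* The diagonal pair of weight w + 3. Its entry is zero, whereas the formula gives a nonzero
   multiple of k (k - 1) (2k - 1) d. *)
have := c3K k k.+2 ltac:(lia) ltac:(lia).
rewrite (cs_diag sys) ?c1p ?mulr0; try lia.
move=> /esym/eqP; rewrite mulf_eq0 signr_eq0 /= natrB; last lia.
have -> : 3 * k%:R * (k%:R - 1) * ((k%:R - 1) * d) - k%:R * (k%:R - 1) * (k%:R - 2) * d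
  = k%:R * (k%:R - 1) * (2 * k%:R - 1) * d by ring.
have k0 : 4 <= k%:R :> R by rewrite (ler_nat _ 4).
by rewrite !mulf_eq0 (negPf d0) orbF => /orP[/orP[]|] /eqP; lra.
Qed.
End Cases.

(** * Feasibility *)

Definition pairs (D : seq nat) : rel nat := fun a b => (a < b)%N && ((a + b)%N \in D).

(* x is found by linear programming; Z is the set of vanishing brackets. *)
Definition table_check (D : seq nat) (Z : seq (nat * nat)) (x : nat -> nat -> nat)
    (s mu : nat) : bool :=
  [&& uniq D, (0 < s)%N,
      all (fun a => all (fun b => pairs D a b ==> ((x a b == 0%N) == ((a, b) \in Z))) D) D &
      all (fun k =>
        sumn [seq sumn [seq (if pairs D a b then x a b * ((k == a) + (k == b)) else 0)%N | b <- D] | a <- D]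
        + mu * k ==
        sumn [seq sumn [seq (if pairs D a b then x a b * (k == a + b) else 0)%N | b <- D] | a <- D]
        + s)%N D].

Lemma sum_delta (R : realType) (D : seq nat) (T : nat -> R) a :
  uniq D -> a \in D -> \sum_(k <- D) T k * (k == a)%:R = T a.
Proof.
move=> Du aD; rewrite (bigD1_seq a)//= eqxx mulr1 big1 ?addr0// => k /negPf ->.
by rewrite mulr0.
Qed.

(** The identity in T holds once the coefficients of each T_k agree. For tables of natural numbers,
    with the negative terms moved to the other side, this is a boolean computation. *)
Lemma table_feasible (R : realType) (D : seq nat) (C : nat -> nat -> R) Z x s mu :
  table_check D Z x s mu ->
  (forall a b, a \in D -> b \in D -> pairs D a b -> (C a b == 0) = ((a, b) \in Z)) ->
  feasible D C.
Proof.
case/and4P => Du s0 /allP xZ /allP xk CZ.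
exists (fun a b => (x a b)%:R), s%:R, mu%:R; split; first by rewrite ltr0n.
  move=> a b aD bD ab abD; have pab : pairs D a b by rewrite /pairs ab.
  have /eqP := implyP (allP (xZ a aD) b bD) pab; rewrite -CZ// => <-.
  by case: eqP => [->//|/eqP]; rewrite -lt0n ltr0n.
move=> T.
have sumE (F : nat -> nat -> nat) :
  (sumn [seq sumn [seq (if pairs D a b then F a b else 0)%N | b <- D] | a <- D])%:R =
  \sum_(a <- D) \sum_(b <- D | pairs D a b) (F a b)%:R :> R.
  rewrite sumnE big_map natr_sum; apply: eq_bigr => a _.
  rewrite sumnE big_map natr_sum [RHS]big_mkcond; apply: eq_bigr => b _.
  by case: ifP.
transitivity (\sum_(k <- D) T k * (\sum_(a <- D) \sum_(b <- D | pairs D a b)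
   (x a b)%:R * ((k == a)%:R + (k == b)%:R - (k == a + b)%N%:R))).
  under [RHS]eq_bigr => k _ do rewrite mulr_sumr.
  rewrite exchange_big /=; apply: eq_big_seq => a aD.
  under [RHS]eq_bigr => k _ do rewrite mulr_sumr.
  rewrite [RHS]exchange_big /= big_seq_cond [RHS]big_seq_cond.
  apply: eq_bigr => b /andP[bD /andP[ab abD]].
  rewrite -{1}(sum_delta T Du aD) -{1}(sum_delta T Du bD) -{1}(sum_delta T Du abD).
  rewrite -big_split -sumrB /= mulr_sumr; apply: eq_bigr => k _; ring.
apply: eq_big_seq => k kD; rewrite mulrC; congr (_ * _).
have /eqP/(congr1 (fun i => i%:R : R)) := xk k kD.
rewrite !natrD natrM !sumE => h.
under eq_bigr => a _ do under eq_bigr => b _ do rewrite mulrBr.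
under eq_bigr => a _ do rewrite sumrB.
rewrite sumrB.
under eq_bigr => a _ do under eq_bigr => b _ do rewrite -natrD -natrM.
under [X in _ - X]eq_bigr => a _ do under eq_bigr => b _ do rewrite -natrM.
by move: h; lra.
Qed.

(* Taking T = id in the definition of feasible determines the ratio s : mu. *)
Lemma infeasible_test (R : realType) (D : seq nat) (C : nat -> nat -> R) (T : nat -> R) a0 b0 :
  uniq D -> all (fun a => (0 < a)%N) D ->
  (forall a b, a \in D -> b \in D -> pairs D a b -> C a b != 0 ->
     0 <= T a + T b - T (a + b)%N) ->
  [/\ a0 \in D, b0 \in D, pairs D a0 b0, C a0 b0 != 0 & 0 < T a0 + T b0 - T (a0 + b0)%N] ->
  \sum_(k <- D) (\sum_(j <- D) j%:R ^+ 2 - k%:R * \sum_(j <- D) j%:R) * T k <= 0 ->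
  ~ feasible D C.
Proof.
move=> Du Dpos Tpos [a0D b0D p0 C0 T0] TV [x [s [mu [s0 xC xT]]]].
have xge a b : a \in D -> b \in D -> pairs D a b -> 0 <= x a b.
  by move=> aD bD /andP[ab abD]; have := xC a b aD bD ab abD; case: eqP => [_ ->//|_ /ltW].
have xpos : 0 < x a0 b0.
  have /andP[ab abD] := p0; have := xC a0 b0 a0D b0D ab abD; by rewrite (negPf C0).
have smu : s * \sum_(j <- D) j%:R = mu * \sum_(j <- D) j%:R ^+ 2.
  have := xT (fun k => k%:R); rewrite big1 => [h|a _]; last first.
    by apply: big1 => b _; rewrite natrD subrr mulr0.
  apply/eqP; rewrite -subr_eq0; apply/eqP; rewrite [RHS]h !mulr_sumr -sumrB.
  by apply: eq_bigr => k _; ring.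
have S20 : 0 < \sum_(j <- D) j%:R ^+ 2 :> R.
  rewrite (bigD1_seq a0)//= ltr_pwDl ?sumr_ge0// => [|j _]; last exact: sqr_ge0.
  by rewrite exprn_gt0// ltr0n (allP Dpos).
suff : 0 < \sum_(a <- D) (s - mu * a%:R) * T a.
  rewrite ltNge => /negP; apply.
  rewrite -(pmulr_rle0 _ S20) mulr_sumr.
  have -> : \sum_(i <- D) (\sum_(j <- D) j%:R ^+ 2) * ((s - mu * i%:R) * T i) =
     s * \sum_(k <- D) (\sum_(j <- D) j%:R ^+ 2 - k%:R * \sum_(j <- D) j%:R) * T k.
    rewrite mulr_sumr; apply: eq_bigr => k _.
    move: smu; move: (\sum_(j <- D) _) (\sum_(j <- D) _) => S1 S2 h.
    rewrite !mulrA; congr (_ * _); rewrite [RHS]mulrBr mulrBr.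
    by rewrite [s * (_ * _)]mulrCA h; ring.
  by rewrite pmulr_rle0.
rewrite -xT; apply: (@lt_le_trans _ _ (x a0 b0 * (T a0 + T b0 - T (a0 + b0)%N))).
  exact: mulr_gt0.
have term_ge0 a b : a \in D -> b \in D -> pairs D a b ->
    0 <= x a b * (T a + T b - T (a + b)%N).
  move=> aD bD pab; have [C00|Cn0] := eqVneq (C a b) 0; last first.
    by rewrite mulr_ge0 ?xge// Tpos.
  have /andP[ab abD] := pab; have := xC a b aD bD ab abD; rewrite C00 eqxx => ->.
  by rewrite mul0r.
have inner_ge0 a : a \in D ->
    0 <= \sum_(b <- D | pairs D a b) x a b * (T a + T b - T (a + b)%N).
  move=> aD; rewrite big_seq_cond; apply: sumr_ge0 => b /andP[bD pab].
  exact: term_ge0.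
rewrite (bigD1_seq a0)//= ler_wpDr//.
  by rewrite big_seq_cond; apply: sumr_ge0 => a /andP[aD _]; exact: inner_ge0.
rewrite big_mkcond (bigD1_seq b0)//= ler_wpDr//; last by rewrite ifT.
rewrite big_seq_cond; apply: sumr_ge0 => b /andP[bD _]; case: ifP => // pab.
exact: term_ge0.
Qed.

Lemma iota1_index n : iota 1 n = index_iota 1 n.+1.
Proof. by rewrite /index_iota subn1. Qed.

Lemma mem_iota1 n k : (k \in iota 1 n) = (0 < k <= n)%N.
Proof. by rewrite mem_iota add1n ltnS. Qed.

Lemma sum_by_weight (R : realType) n (F : nat -> nat -> R) :
  \sum_(a <- iota 1 n) \sum_(b <- iota 1 n | pairs (iota 1 n) a b) F a b =
  \sum_(1 <= w < n.+1) \sum_(1 <= a < w | (a < w - a)%N) F a (w - a)%N.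
Proof.
transitivity (\sum_(1 <= w < n.+1) \sum_(1 <= a < n.+1 | (a < w - a)%N) F a (w - a)%N); last first.
  rewrite big_nat_cond [RHS]big_nat_cond; apply: eq_bigr => w /andP[wn _].
  rewrite (big_cat_nat _ _ (n := w)) //=; try lia.
  rewrite [X in _ + X]big_nat_cond [X in _ + X]big1 ?addr0// => a; lia.
rewrite [RHS](exchange_big_dep xpredT) //= iota1_index big_nat_cond [RHS]big_nat_cond.
apply: eq_bigr => a /andP[an _].
rewrite [RHS](big_cat_nat _ _ (n := 1 + a)) //=; try lia.
rewrite [X in _ = X + _]big_nat_cond [X in _ = X + _]big1 ?add0r => [|w]; last lia.
rewrite [LHS](big_cat_nat _ _ (n := n.+1 - a)) //=; try lia.
rewrite [X in _ + X = _]big_nat_cond [X in _ + X = _]big1 ?addr0 => [|b]; last first.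
  by rewrite /pairs -iota1_index mem_iota1; lia.
rewrite big_addn big_nat_cond [RHS]big_nat_cond; apply: eq_big => b.
  by rewrite /pairs -iota1_index mem_iota1; lia.
by rewrite addnK.
Qed.

Lemma sum_reflect (R : realType) N (T : nat -> R) :
  \sum_(1 <= a < N | (a < N - a)%N) (T a + T (N - a)%N) +
    (if odd N then 0 else \sum_(1 <= a < N | a == N./2) T a) =
  \sum_(1 <= a < N) T a.
Proof.
rewrite big_split /= [RHS](bigID (fun a => (a < N - a)%N)) /= -addrA; congr (_ + _).
rewrite [RHS](bigID (fun a => (N - a < a)%N)) /=; congr (_ + _).
  rewrite big_nat_rev /= big_nat_cond [RHS]big_nat_cond; apply: eq_big => a; first lia.
  by move=> h; congr T; lia.
case: ifP => [o|/negbT o].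
  by rewrite big_nat_cond big1// => a; lia.
by rewrite big_nat_cond [RHS]big_nat_cond; apply: eq_bigl => a; lia.
Qed.

Lemma weight_sum_odd (R : realType) (T : nat -> R) w : odd w ->
  \sum_(1 <= a < w | (a < w - a)%N) (2 + ((w - a)%N == a.+2)%:R) * (T a + T (w - a)%N - T w) =
  2 * (\sum_(1 <= a < w) T a) - (w.-1)%:R * T w.
Proof.
move=> ow; have := sum_reflect w T; have := sum_reflect w (fun=> T w).
rewrite ow !addr0 sumr_const_nat => h1 <-.
rewrite [_ * T w]mulr_natl; rewrite subn1 in h1.
rewrite -h1 mulr_sumr -sumrB big_nat_cond [RHS]big_nat_cond.
apply: eq_bigr => a /andP[aw alt]; rewrite (_ : (_ == _) = false) ?addr0; [ring|lia].
Qed.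

(** In weight 2m the index m has no partner, which leaves a defect - 2 T_m. One more unit on the
    pair (m - 1, m + 1) completes it to a second difference. *)
Lemma weight_sum_even (R : realType) (T : nat -> R) m : (2 <= m)%N ->
  \sum_(1 <= a < m.*2 | (a < m.*2 - a)%N)
     (2 + ((m.*2 - a)%N == a.+2)%:R) * (T a + T (m.*2 - a)%N - T m.*2) =
  2 * (\sum_(1 <= a < m.*2) T a) - (m.*2.-1)%:R * T m.*2
   + (T m.-1 - 2 * T m + T m.+1).
Proof.
move=> m2; have := sum_reflect m.*2 T; have := sum_reflect m.*2 (fun=> T m.*2).
rewrite odd_double doubleK !big_nat1_eq; have -> : (1 <= m < m.*2)%N by lia.
rewrite sumr_const_nat => h1 <-.
transitivity (2 * (\sum_(1 <= a < m.*2 | (a < m.*2 - a)%N) (T a + T (m.*2 - a)%N))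
   - \sum_(1 <= a < m.*2 | (a < m.*2 - a)%N) (T m.*2 + T m.*2)
   + \sum_(1 <= a < m.*2 | a == m.-1) (T a + T (m.*2 - a)%N - T m.*2)).
  rewrite [X in _ + X](_ : _ = \sum_(1 <= a < m.*2 | (a < m.*2 - a)%N)
     ((m.*2 - a)%N == a.+2)%:R * (T a + T (m.*2 - a)%N - T m.*2)).
    by rewrite mulr_sumr -sumrB -big_split; apply: eq_bigr => a _ /=; ring.
  rewrite [LHS]big_mkcond [RHS]big_mkcond big_nat [RHS]big_nat; apply: eq_bigr => a aw.
  case: eqP => [aE|aE].
    have -> : (m.*2 - a == a.+2)%N by apply/eqP; lia.
    have -> : (a < m.*2 - a)%N by lia.
    by rewrite mul1r.
  have -> : (m.*2 - a == a.+2)%N = false by apply/eqP; lia.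
  by rewrite mul0r if_same.
rewrite big_nat1_eq; have -> : (1 <= m.-1 < m.*2)%N by lia.
have -> : (m.*2 - m.-1 = m.+1)%N by lia.
by rewrite subn1 in h1; rewrite [_ * T m.*2]mulr_natl -h1; ring.
Qed.

Lemma feasible_full (R : realType) n (C : nat -> nat -> R) : (4 <= n)%N ->
  (forall a b, (0 < a)%N -> (a < b)%N -> (a + b <= n)%N -> C a b != 0) ->
  feasible (iota 1 n) C.
Proof.
move=> n4 Cn0.
(* Passing from n - 1 to n adds the brackets of weight n, with weights 2 or 3; the last
   summand of x is the correction that the induction leaves over. *)
pose x a b : R := 2 + (b == a.+2)%:R + ((a == 1%N) && (b == n./2))%:R.
exists x, (2 * n%:R + 1), 3; split; first by rewrite ltr_wpDl// mulr_ge0.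
  move=> a b; rewrite !mem_iota1 => aD bD ab abD; have Cab : C a b != 0 by apply: Cn0; lia.
  rewrite (negPf Cab).
  by rewrite /x -addrA ltr_pwDl// addr_ge0.
move=> T.
(* The second differences of the even weights telescope to minus the term of the pair (1, h), h
   being half the dimension; the last summand of [x] adds it back. *)
have base k : \sum_(1 <= w < k.+3) \sum_(1 <= a < w | (a < w - a)%N)
     (2 + ((w - a)%N == a.+2)%:R) * (T a + T (w - a)%N - T w) =
   \sum_(1 <= j < k.+3) (2 * k.+2%:R + 1 - 3 * j%:R) * T j
   - (T 1%N + T (k.+2)./2 - T (k.+2)./2.+1).
  elim: k => [|k IH].
    by rewrite /index_iota /= !(big_cons, big_nil) /=; ring.
  rewrite big_nat_recr //= {}IH [X in _ = X - _]big_nat_recr //=.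
  have -> : \sum_(1 <= j < k.+3) (2 * k.+3%:R + 1 - 3 * j%:R) * T j =
    \sum_(1 <= j < k.+3) (2 * k.+2%:R + 1 - 3 * j%:R) * T j + 2 * \sum_(1 <= j < k.+3) T j.
    by rewrite mulr_sumr -big_split; apply: eq_bigr => j _ /=; rewrite -[k.+3%:R]natr1; ring.
  have [ko|ke] := boolP (odd k.+3).
    rewrite weight_sum_odd// (_ : (k.+1)./2.+1 = (k.+2)./2); last by move: ko => /=; lia.
    by rewrite /= -[k.+3%:R]natr1; ring.
  have kE : k.+3 = ((k.+3)./2).*2 by move: ke; lia.
  have := @weight_sum_even R T (k.+3)./2; rewrite -kE => ->; last by move: ke => /=; lia.
  rewrite (_ : ((k.+3)./2).-1 = (k.+2)./2) /=; last by move: ke => /=; lia.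
  rewrite (_ : (k./2).+1 = (k.+1)./2); last by move: ke => /=; lia.
  by rewrite -[k.+3%:R]natr1; ring.
rewrite sum_by_weight.
have [k nE] : exists k, n = k.+2 by exists (n - 2)%N; lia.
rewrite iota1_index [in RHS]nE -[RHS](subrK (T 1%N + T (k.+2)./2 - T (k.+2)./2.+1)) -base.
rewrite -nE.
have -> : T 1%N + T n./2 - T n./2.+1 = \sum_(1 <= w < n.+1 | w == n./2.+1)
     \sum_(1 <= a < w | a == 1%N) (T a + T (w - a)%N - T w).
  rewrite big_nat1_eq (_ : (1 <= n./2.+1 < n.+1)%N); last lia.
  by rewrite big_nat1_eq (_ : (1 <= 1 < n./2.+1)%N) ?subn1//; lia.
rewrite [X in _ = _ + X]big_mkcond -big_split; apply: eq_bigr => w _ /=.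
transitivity (\sum_(1 <= a < w | (a < w - a)%N)
    (2 + ((w - a)%N == a.+2)%:R) * (T a + T (w - a)%N - T w) +
  \sum_(1 <= a < w | (a < w - a)%N)
    ((a == 1%N) && ((w - a)%N == n./2))%:R * (T a + T (w - a)%N - T w)).
  rewrite -big_split; apply: eq_bigr => a aw /=.
  by rewrite /x subnKC ?mulrDl//; lia.
congr (_ + _); rewrite big_mkcond big_nat; case: eqP => wn.
  rewrite [RHS]big_mkcond [RHS]big_nat; apply: eq_bigr => a aw.
  have [a1|a1] := eqVneq a 1%N; last by rewrite mul0r if_same.
  have -> : (a < w - a)%N by lia.
  have -> : (w - a == n./2)%N by apply/eqP; lia.
  by rewrite mul1r.
apply: big1 => a aw; have -> : (a == 1%N) && ((w - a)%N == n./2) = false by lia.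
by rewrite mul0r if_same.
Qed.

Lemma sum_iota1 (R : realType) n : \sum_(k <- iota 1 n) k%:R = n%:R * (n%:R + 1) / 2 :> R.
Proof.
elim: n => [|n IH]; first by rewrite big_nil !mul0r.
by rewrite -[n.+1 in LHS]addn1 iotaD big_cat IH big_seq1 add1n /= -[n.+1%:R]natr1; field.
Qed.

Lemma sum_iota1_sqr (R : realType) n :
  \sum_(k <- iota 1 n) k%:R ^+ 2 = n%:R * (n%:R + 1) * (2 * n%:R + 1) / 6 :> R.
Proof.
elim: n => [|n IH]; first by rewrite big_nil !mul0r.
by rewrite -[n.+1 in LHS]addn1 iotaD big_cat IH big_seq1 add1n /= -[n.+1%:R]natr1; field.
Qed.

(** The sums of k and of k^2 up to n turn the weights of [infeasible_test] into n (n + 1) / 6 times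
    2n + 1 - 3k. *)
Lemma infeasible_iota (R : realType) n (C : nat -> nat -> R) (T : nat -> R) a0 b0 :
  (forall a b, (0 < a)%N -> (a < b)%N -> (a + b <= n)%N -> C a b != 0 ->
     0 <= T a + T b - T (a + b)%N) ->
  [/\ (0 < a0)%N, (a0 < b0)%N, (a0 + b0 <= n)%N, C a0 b0 != 0 & 0 < T a0 + T b0 - T (a0 + b0)%N] ->
  \sum_(k <- iota 1 n) (2 * n%:R + 1 - 3 * k%:R) * T k <= 0 ->
  ~ feasible (iota 1 n) C.
Proof.
move=> Tpos [a0p ab0 abn C0 T0] TV; apply: (@infeasible_test _ _ _ T a0 b0).
- exact: iota_uniq.
- by apply/allP => a; rewrite mem_iota1 => /andP[].
- move=> a b; rewrite mem_iota1 => aD bD; rewrite /pairs mem_iota1 => /andP[ab abD] Cab.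
  by apply: Tpos => //; lia.
- by rewrite /pairs !mem_iota1; split=> //; lia.
rewrite sum_iota1 sum_iota1_sqr.
rewrite (eq_bigr (fun k => n%:R * (n%:R + 1) / 6 * ((2 * n%:R + 1 - 3 * k%:R) * T k))).
  by rewrite -mulr_sumr mulr_ge0_le0// divr_ge0// mulr_ge0// addr_ge0.
by move=> k _; field.
Qed.

Lemma sum_tail (R : realType) n m : (m <= n)%N ->
  \sum_(k <- iota 1 n) (2 * n%:R + 1 - 3 * k%:R) * (m < k)%N%:R =
  (n%:R - m%:R) * (2 * n%:R + 1) - 3 * (n%:R * (n%:R + 1) - m%:R * (m%:R + 1)) / 2 :> R.
Proof.
move=> mn; transitivity (\sum_(k <- iota 1 n) (2 * n%:R + 1 - 3 * k%:R) -
   \sum_(k <- iota 1 m) (2 * n%:R + 1 - 3 * k%:R) : R).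
  rewrite -(subnKC mn) iotaD !big_cat /= addrAC subrr add0r.
  rewrite [X in X + _]big_seq big1 => [|k]; last first.
    by rewrite mem_iota1 => km; rewrite (_ : (m < k)%N = false) ?mulr0//; lia.
  rewrite add0r big_seq [RHS]big_seq; apply: eq_bigr => k.
  by rewrite mem_iota add1n => km; rewrite (_ : (m < k)%N) ?mulr1//; lia.
have cst j (c : R) : \sum_(k <- iota 1 j) c = j%:R * c.
  by rewrite big_const_seq count_predT size_iota iter_addr_0 mulr_natl.
by rewrite !sumrB -!mulr_sumr !sum_iota1 !cst; field.
Qed.

(** The test vector is 0 at degrees 1 and 2 and - 1 above. Brackets of e_1 or e_2 with e_k, k >= 3,
    contribute 0, [e_1, e_2] contributes 1, and the pairing with 2n + 1 - 3k is - (n - 2) (n - 7) /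
    2. *)
Lemma infeasible_m2 (R : realType) n (C : nat -> nat -> R) : (8 <= n)%N ->
  (forall a, (2 <= a < n)%N -> C 1 a = 1) ->
  (forall a b, (3 <= a)%N -> (3 <= b)%N -> (a + b <= n)%N -> C a b = 0) ->
  ~ feasible (iota 1 n) C.
Proof.
move=> n8 C1 C0; pose T k : R := - (2 < k)%N%:R.
apply: (@infeasible_iota _ _ _ T 1 2).
- move=> a b a0 ab abn; have [a3|a2] := leqP 3 a; first by rewrite C0 ?eqxx//; lia.
  move=> _; rewrite /T (_ : (2 < a)%N = false); last lia.
  rewrite (_ : (2 < a + b)%N = true); last lia.
  by case: (2 < b)%N => /=; lra.
- split=> //; first by lia.
    by rewrite C1 ?oner_eq0//; lia.
  by rewrite /T /=; lra.
rewrite /T; under eq_bigr do rewrite mulrN.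
rewrite sumrN sum_tail ?oppr_le0; last lia.
have n8' : 8 <= n%:R :> R by rewrite (ler_nat _ 8).
nra.
Qed.

(** The test vector is 0 at degree 1, - 1 from 2 to w - 1 and - 2 from w on. A nonzero bracket of
    two vectors of degrees between 2 and w - 1 has weight at least w and contributes 0;
    [e_1, e_(w-1)] contributes 1. Only [e_2, e_w] would be negative, and it vanishes. *)
Lemma infeasible_high_weight (R : realType) n w (C : nat -> nat -> R) :
  (9 <= w <= n)%N -> (n <= w + 2)%N ->
  (forall a, (2 <= a < n)%N -> C 1 a = 1) ->
  (forall a b, (2 <= a)%N -> (2 <= b)%N -> (a + b < w)%N -> C a b = 0) ->
  ((w + 2 <= n)%N -> C 2 w = 0) ->
  ~ feasible (iota 1 n) C.
Proof.
move=> wn nw C1 C0 C2; pose T k : R := - (1 < k)%N%:R - (w.-1 < k)%N%:R.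
have T1 : T 1%N = 0.
  rewrite /T; have -> : (w.-1 < 1)%N = false by lia.
  by rewrite ltnn /= oppr0 addr0.
have Tlo k : (2 <= k < w)%N -> T k = -1.
  move=> kw; rewrite /T; have -> : (1 < k)%N by lia.
  have -> : (w.-1 < k)%N = false by lia.
  by rewrite subr0.
have Thi k : (w <= k)%N -> T k = -2.
  move=> kw; rewrite /T; have -> : (1 < k)%N by lia.
  have -> : (w.-1 < k)%N by lia.
  by rewrite -opprD.
apply: (@infeasible_iota _ _ _ T 1 w.-1).
- move=> a b a0 ab abn Cab; have [a1|a1] := eqVneq a 1%N.
    rewrite a1 T1 in abn *; have [wb|wb] := leqP w b; first by rewrite !Thi; lra || lia.
    rewrite (Tlo b); last by rewrite a1 in ab; lia.
    have [wb'|wb'] := leqP w (1 + b); first by rewrite Thi//; lra.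
    by rewrite Tlo; lra || lia.
  have wab : (w <= a + b)%N by rewrite leqNgt; apply/negP => h; move: Cab; rewrite C0 ?eqxx//; lia.
  have bw : (b < w)%N.
    rewrite ltnNge; apply/negP => wb.
    have aE : a = 2 by lia.
    have bE : b = w by lia.
    by move: Cab; rewrite aE bE C2 ?eqxx//; lia.
  have aw : (2 <= a < w)%N by lia.
  have bw' : (2 <= b < w)%N by lia.
  by rewrite (Tlo a aw) (Tlo b bw') (Thi _ wab); lra.
- have w2 : (2 <= w.-1 < w)%N by lia.
  split; [by []|lia|lia|by rewrite C1 ?oner_eq0//; lia|].
  by rewrite T1 (Tlo _ w2) Thi; [lra|lia].
rewrite /T; under eq_bigr do rewrite mulrBr mulrN.
rewrite sumrB sumrN !sum_tail; try by lia.
have w9 : 9 <= w%:R :> R by rewrite (ler_nat _ 9); lia.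
have wE : w.-1%:R = w%:R - 1 :> R by rewrite -subn1 natrB//; lia.
have [s [sE]] : exists s, n = (w + s)%N /\ (s = 0 \/ s = 1 \/ s = 2)%N by exists (n - w)%N; lia.
rewrite wE sE natrD; case=> [->|[->|->]]; nra.
Qed.

(** The certificate is integral. The list [T] begins with the value at degree 1, hence the shift in
    [t]. The pairs in [Z] are those whose bracket is known to vanish; every other pair is tested,
    whatever its constant. *)
Definition test_function_check (n : nat) (Z : seq (nat * nat)) (T : seq int) a0 b0 : bool :=
  let t k := nth 0 T k.-1 in
  [&& all (fun a => all (fun b => pairs (iota 1 n) a b ==> ((a, b) \notin Z) ==>
        (0 <= t a + t b - t (a + b)%N)) (iota 1 n)) (iota 1 n),
      [&& (a0 \in iota 1 n), (b0 \in iota 1 n), pairs (iota 1 n) a0 b0, (a0, b0) \notin Z &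
        0 < t a0 + t b0 - t (a0 + b0)%N] &
      foldr (fun k s => ((n.*2.+1)%:Z - (3 * k)%:Z) * t k + s) 0 (iota 1 n) <= 0].

Lemma test_infeasible (R : realType) n (C : nat -> nat -> R) Z T a0 b0 :
  test_function_check n Z T a0 b0 ->
  (forall a b, (a, b) \in Z -> C a b = 0) -> C a0 b0 != 0 ->
  ~ feasible (iota 1 n) C.
Proof.
move=> /and3P[/allP Tpos /and5P[aD bD pab _ t0] TV] CZ C0.
apply: (@infeasible_iota _ _ _ (fun k => (nth 0 T k.-1)%:~R) a0 b0).
- move=> a b a1 ab abn Cab; have aD' : a \in iota 1 n by rewrite mem_iota1; lia.
  have bD' : b \in iota 1 n by rewrite mem_iota1; lia.
  have pab' : pairs (iota 1 n) a b by rewrite /pairs mem_iota1; lia.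
  have abZ : (a, b) \notin Z by apply: contra Cab => /CZ ->.
  have := implyP (implyP (allP (Tpos a aD') b bD') pab') abZ.
  by rewrite -rmorphD -rmorphB /= ler0z.
- move: aD bD pab; rewrite /pairs !mem_iota1 => aD bD pab.
  by split=> //; try lia; rewrite -rmorphD -rmorphB /= ltr0z.
have -> : \sum_(k <- iota 1 n) (2 * n%:R + 1 - 3 * k%:R) * (nth 0 T k.-1)%:~R =
  (foldr (fun k s => ((n.*2.+1)%:Z - (3 * k)%:Z) * nth 0 T k.-1 + s) 0 (iota 1 n))%:~R :> R.
  elim: (iota 1 n) => [|k r IH]; first by rewrite big_nil.
  rewrite big_cons IH /= rmorphD rmorphM rmorphB /=; congr (_ * _ + _).
  by rewrite -[n.*2.+1]addn1 -mul2n -!pmulrn natrD !natrM.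
by rewrite lerz0.
Qed.

(* The structure constants of an algebra with [e_1, e_i] = e_(i+1). *)
Definition ext (R : realType) (c : nat -> nat -> R) (i j : nat) : R :=
  if i == 1%N then (j != 1%N)%:R else if j == 1%N then -1 else c i j.

Lemma ext1 (R : realType) (c : nat -> nat -> R) k : (2 <= k)%N -> ext c 1 k = 1.
Proof. by case: k => [|[|k]]. Qed.

Lemma ext_ge2 (R : realType) (c : nat -> nat -> R) i j : (2 <= i)%N -> (2 <= j)%N ->
  ext c i j = c i j.
Proof. by case: i j => [|[|i]] [|[|j]]. Qed.

Lemma feasible_eq0 (R : realType) (D : seq nat) (C C' : nat -> nat -> R) :
  (forall a b, a \in D -> b \in D -> (a < b)%N -> (a + b)%N \in D ->
     (C a b == 0) = (C' a b == 0)) ->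
  feasible D C -> feasible D C'.
Proof.
move=> CC' [x [s [mu [s0 xC xT]]]]; exists x, s, mu; split=> // a b aD bD ab abD.
by rewrite -CC'//; exact: xC.
Qed.

Lemma feasible_ext_scale (R : realType) n (c : nat -> nat -> R) k : k != 0 ->
  feasible (iota 1 n) (ext (fun i j => k * c i j)) <-> feasible (iota 1 n) (ext c).
Proof.
move=> k0; have H a b : (ext (fun i j => k * c i j) a b == 0) = (ext c a b == 0).
  by rewrite /ext; case: ifP => // _; case: ifP => // _; rewrite mulf_eq0 (negPf k0).
by split; apply: feasible_eq0 => a b *; rewrite H.
Qed.

Lemma feasible_ext_full (R : realType) n (c : nat -> nat -> R) : (4 <= n)%N ->
  (forall a b, (2 <= a)%N -> (a < b)%N -> (a + b <= n)%N -> c a b != 0) ->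
  feasible (iota 1 n) (ext c).
Proof.
move=> n4 cn0; apply: feasible_full => // a b a0 ab abn.
have [->|a1] := eqVneq a 1%N; first by rewrite ext1 ?oner_eq0//; lia.
by rewrite ext_ge2 ?cn0//; lia.
Qed.

Definition table_entry (t : seq (seq nat)) (a b : nat) : nat := nth 0 (nth [::] t a) b.

Lemma feasible_ext_table (R : realType) n (c : nat -> nat -> R) Z t s mu :
  table_check (iota 1 n) Z (table_entry t) s mu ->
  all (fun p : nat * nat => 1 < p.1)%N Z ->
  (forall a b, (2 <= a)%N -> (a < b)%N -> (a + b <= n)%N -> (c a b == 0) = ((a, b) \in Z)) ->
  feasible (iota 1 n) (ext c).
Proof.
move=> tab Z2 cZ; apply: (table_feasible tab) => a b.
rewrite !mem_iota1 /pairs mem_iota1 => aD bD /andP[ab abD].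
have [->|a1] := eqVneq a 1%N.
  rewrite ext1 ?oner_eq0; last lia.
  by apply/esym/negP => /(allP Z2).
by rewrite ext_ge2 ?cZ//; lia.
Qed.

(** * Vanishing of the coefficients as a condition on c_23, when c_34 = 1 *)

Section Normalized.
Variables (R : realType) (n : nat) (c : nat -> nat -> R).
Hypotheses (sys : coef_sys n c) (n8 : (8 <= n)%N) (b1 : c 3 4 = 1).
Local Notation a := (c 2 3).

Lemma weight8_eq0 : [/\ (c 2 4 == 0) = (a == 0), (c 2 5 == 0) = (a == 1),
  (c 2 6 == 0) = (a == 2), (c 3 4 == 0) = false & (c 3 5 == 0) = false].
Proof.
have [-> ->] := cs_weight8 sys n8.
rewrite (cs_weight6 sys) ?(cs_weight7 sys) ?b1; try by lia.
by rewrite oner_eq0 subr_eq0 mulr1 subr_eq0.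
Qed.

Lemma weight9_rel : (9 <= n)%N -> [/\ 2 * a + 1 != 0, c 4 5 != 0 & c 4 5 * (2 * a + 1) = 3].
Proof.
move=> n9; have r := cs_rel9 sys n9; rewrite b1 expr1n mulr1 in r.
have : c 4 5 * (2 * a + 1) != 0 by rewrite r pnatr_eq0.
by rewrite mulf_eq0 negb_or => /andP[].
Qed.

Lemma weight9_eq0 : (9 <= n)%N -> [/\ (c 2 7 == 0) = (a == 0) || (2 * a == 5),
  (c 3 6 == 0) = (a == 1) & (c 4 5 == 0) = false].
Proof.
move=> n9; have [p0 u0 r] := weight9_rel n9; have [-> ->] := cs_weight9 sys n9.
split; last exact: negPf.
  rewrite -(mulIr_eq0 _ (mulIf p0)) b1.
  have -> : (a - 3 * 1 + c 4 5) * (2 * a + 1) = a * (2 * a - 5) by move: r; lra.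
  by rewrite mulf_eq0 subr_eq0.
rewrite -(mulIr_eq0 _ (mulIf p0)) b1.
have -> : (1 - c 4 5) * (2 * a + 1) = 2 * (a - 1) by move: r; lra.
by rewrite mulf_eq0 pnatr_eq0 subr_eq0.
Qed.

Lemma weight10_eq0 : (10 <= n)%N -> [/\ (c 2 8 == 0) = (2 * a == 5) || (a == 1),
  (c 3 7 == 0) = (2 * a == 5) & (c 4 6 == 0) = false].
Proof.
move=> n10; have [p0 u0 r] := weight9_rel (ltnW n10); have [-> -> ->] := cs_weight10 sys n10.
split; last exact: negPf.
  rewrite -(mulIr_eq0 _ (mulIf p0)) b1.
  have -> : (a - 4 * 1 + 3 * c 4 5) * (2 * a + 1) = (2 * a - 5) * (a - 1) by move: r; lra.
  by rewrite mulf_eq0 !subr_eq0.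
rewrite -(mulIr_eq0 _ (mulIf p0)) b1.
have -> : (1 - 2 * c 4 5) * (2 * a + 1) = 2 * a - 5 by move: r; lra.
by rewrite subr_eq0.
Qed.

(** If the factor of c_56 in the relation of weight 11 were zero, c_45 would be 2/3, against weight
    9. Times 2 c_23 + 1 this factor is 4 (alpha + 1) (alpha + 3), which is why alpha = -1 and alpha
    = -3 do not reach dimension 11. *)
Lemma weight11_rel : (11 <= n)%N -> [/\ a != 1,
  c 5 6 * (2 * a - 1 - c 4 5) = 4 * c 4 5 - 6 * c 4 5 ^+ 2 &
  2 * a - 1 - c 4 5 != 0].
Proof.
move=> n11; have [p0 u0 r] := weight9_rel ltac:(lia).
have r11 := cs_rel11 sys n11; rewrite b1 mulr1 in r11.
have q0 : 2 * a - 1 - c 4 5 != 0.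
  apply/eqP => q0; move: r11; rewrite q0 mulr0 => /esym/eqP.
  have -> : 4 * c 4 5 - 6 * c 4 5 ^+ 2 = 2 * c 4 5 * (2 - 3 * c 4 5) by ring.
  rewrite !mulf_eq0 (negPf u0) pnatr_eq0 /= subr_eq0 => /eqP uE.
  have aE : 2 * a = 1 + c 4 5 by lra.
  by move: r; rewrite aE; nra.
split=> //; apply/eqP => aE; rewrite aE in r r11.
have uE : c 4 5 = 1 by lra.
by move: q0; rewrite aE uE; lra.
Qed.

(** The numerator of this entry is a multiple of 2 (alpha + 1)^2 + 3, without real zeros. *)
Lemma weight11_c47_neq0 : (11 <= n)%N -> (c 4 7 == 0) = false.
Proof.
move=> n11; have [p0 u0 r] := weight9_rel ltac:(lia).
have [a1 r11 q0] := weight11_rel n11; have [_ _ ->] := cs_weight11 sys n11.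
apply/negP; rewrite subr_eq0 => /eqP uw; rewrite -uw in r11.
have : 2 * a - 1 - c 4 5 = 4 - 6 * c 4 5.
  by apply: (mulfI u0); rewrite r11; ring.
move=> h; have uE : c 4 5 = 1 - 2 / 5 * a by lra.
move: r; rewrite uE => r.
have : 4 * (a - 1) ^+ 2 + 6 = 0 by lra.
by have := sqr_ge0 (a - 1); lra.
Qed.

(** At most one of c_29, c_38, c_56 vanishes, and none does at a value of alpha for which something
    of lower weight vanishes. One table for each of these three entries therefore suffices. *)
Lemma weight11_excl : (11 <= n)%N ->
  [/\ c 2 9 = 0 -> [/\ a != 0, a != 2, 2 * a != 5, c 3 8 != 0 & c 5 6 != 0],
      c 3 8 = 0 -> [/\ a != 0, a != 2, 2 * a != 5 & c 5 6 != 0] &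
      c 5 6 = 0 -> [/\ a != 0, a != 2 & 2 * a != 5]].
Proof.
move=> n11; have [p0 u0 r] := weight9_rel ltac:(lia).
have [a1 r11 q0] := weight11_rel n11; have [-> -> _] := cs_weight11 sys n11.
rewrite b1; move: r r11 p0 u0 a1 q0; move: a (c 4 5) (c 5 6) => x u w r r11 p0 u0 a1 q0.
have x0 : x = 0 -> u = 3 /\ w = 21 / 2.
  move=> xE; rewrite xE in r r11; have uE : u = 3 by lra.
  by rewrite uE in r11; split=> //; lra.
have x2 : x = 2 -> u = 3 / 5 /\ w = 10^-1.
  move=> xE; rewrite xE in r r11; have uE : u = 3 / 5 by lra.
  by rewrite uE in r11; split=> //; lra.
have x5 : 2 * x = 5 -> u = 2^-1 /\ w = 7^-1.
  move=> xE; rewrite xE in r r11; have uE : u = 2^-1 by lra.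
  by rewrite uE in r11; split=> //; lra.
have w0 : w = 0 -> x = 7 / 4 /\ u = 2 / 3.
  move=> wE; rewrite wE mul0r in r11.
  have uE : u = 2 / 3 by apply: (mulfI u0); lra.
  by rewrite uE in r; split=> //; lra.
split.
- move=> h; split; apply/eqP => E.
  + by have [uE wE] := x0 E; move: h; rewrite E uE wE; lra.
  + by have [uE wE] := x2 E; move: h; rewrite E uE wE; lra.
  + by have [uE wE] := x5 E; move: h; rewrite uE wE; lra.
  + have : (2 * x - 5) * (x - 1) = 0.
      have -> : (2 * x - 5) * (x - 1) = (x - 4 + 3 * u) * (2 * x + 1) by lra.
      by rewrite (_ : x - 4 + 3 * u = 0) ?mul0r//; lra.
    move/eqP; rewrite mulf_eq0 !subr_eq0 (negPf a1) orbF => /eqP E5.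
    by have [uE wE] := x5 E5; move: h; rewrite uE wE; lra.
  + by have [xE uE] := w0 E; move: h; rewrite E uE xE; lra.
- move=> h; split; apply/eqP => E.
  + by have [uE wE] := x0 E; move: h; rewrite uE wE; lra.
  + by have [uE wE] := x2 E; move: h; rewrite uE wE; lra.
  + by have [uE wE] := x5 E; move: h; rewrite uE wE; lra.
  + by have [xE uE] := w0 E; move: h; rewrite E uE; lra.
- by move=> /w0[xE uE]; split; apply/eqP; rewrite xE; lra.
Qed.
End Normalized.

(* The values of alpha + 2 at which some relation of g_alpha(n), n <= 10, vanishes. *)
Variant special_value (R : realType) (a : R) : bool -> bool -> bool -> bool -> Prop :=
  | Special0 of a = 0 : special_value a true false false false
  | Special1 of a = 1 : special_value a false true false false
  | Special2 of a = 2 : special_value a false false true false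
  | Special5 of 2 * a = 5 : special_value a false false false true
  | SpecialN of a != 0 & a != 1 & a != 2 & 2 * a != 5 :
      special_value a false false false false.

Lemma special_valueP (R : realType) (a : R) :
  special_value a (a == 0) (a == 1) (a == 2) (2 * a == 5).
Proof.
case: (eqVneq a 0) => [E|n0].
  have -> : (a == 1) = false by apply/eqP; lra.
  have -> : (a == 2) = false by apply/eqP; lra.
  have -> : (2 * a == 5) = false by apply/eqP; lra.
  exact: Special0.
case: (eqVneq a 1) => [E|n1].
  have -> : (a == 2) = false by apply/eqP; lra.
  have -> : (2 * a == 5) = false by apply/eqP; lra.
  exact: Special1.
case: (eqVneq a 2) => [E|n2].
  have -> : (2 * a == 5) = false by apply/eqP; lra.
  exact: Special2.
by case: (eqVneq (2 * a) 5) => [E|n5]; [exact: Special5|exact: SpecialN].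
Qed.

Lemma pairs_upto11 (P : nat -> nat -> Prop) n : (n <= 11)%N ->
  (forall p, p \in [:: (2, 3); (2, 4); (2, 5); (2, 6); (2, 7); (2, 8); (2, 9);
       (3, 4); (3, 5); (3, 6); (3, 7); (3, 8); (4, 5); (4, 6); (4, 7); (5, 6)]%N ->
     (p.1 + p.2 <= n)%N -> P p.1 p.2) ->
  forall a b, (2 <= a)%N -> (a < b)%N -> (a + b <= n)%N -> P a b.
Proof.
move=> n11 HP a b a2 ab abn; apply: (HP (a, b)) => //.
have : (a <= 5)%N by lia.
have : (b <= 9)%N by lia.
have : (a + b <= 11)%N by lia.
by move: a b a2 ab {abn} => [|[|[|[|[|[|a]]]]]] [|[|[|[|[|[|[|[|[|[|b]]]]]]]]]].
Qed.

Ltac solve_pairs :=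
  let p := fresh "p" in
  apply: pairs_upto11 => // p; rewrite !inE;
  do ?[case/orP]; move=> /eqP -> //= _.

(** * Feasibility in dimensions 8 to 11 *)

Section Normalized.
Variables (R : realType) (c : nat -> nat -> R).
Hypothesis b1 : c 3 4 = 1.

Lemma feasible8 : coef_sys 8 c -> feasible (iota 1 8) (ext c) <-> c 2 3 != 0.
Proof.
move=> sys; have [f24 f25 f26 f34 f35] := weight8_eq0 sys isT b1.
have [y yE] : exists y, c 2 3 = y by exists (c 2 3).
have f23 : (c 2 3 == 0) = (y == 0) by rewrite yE.
rewrite f23; rewrite yE in f24 f25 f26.
case: (special_valueP y) f23 f24 f25 f26 => [_|_|_|_|_ _ _ _] f23 f24 f25 f26; split=> // F0.
(* Here alpha = -2. The values are residues modulo 4 of least absolute value, with - 2 at degree 2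
   and 2 at degree 6; the only negative terms are those of the pairs (2, 3) and (2, 4), whose
   brackets vanish. *)
- exfalso; move: F0; apply: (@test_infeasible _ _ _ [:: (2, 3); (2, 4)]%N
    [:: 1; -2%:Z; -1; 0; 1; 2; -1; 0] 1 6).
  + by vm_compute.
  + by move=> i j; rewrite !inE => /orP[] /eqP[-> ->]; apply/eqP; rewrite ext_ge2 ?f23 ?f24 ?f25 ?f26 ?f34 ?f35.
  + by rewrite ext1 ?oner_eq0.
- apply: (@feasible_ext_table _ _ _ [:: (2, 5)]%N
    [:: [::]; [:: 0; 0; 3; 3; 3; 11; 5; 3]; [:: 0; 0; 0; 7; 4; 0; 8]; [:: 0; 0; 0; 0; 6; 3]]%N
    34 6); [by vm_compute|by []|].
  by solve_pairs; rewrite ?f23 ?f24 ?f25 ?f26 ?f34 ?f35.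
- apply: (@feasible_ext_table _ _ _ [:: (2, 6)]%N
    [:: [::]; [:: 0; 0; 3; 3; 4; 3; 4; 11]; [:: 0; 0; 0; 7; 3; 9]; [:: 0; 0; 0; 0; 6; 3]]%N
    34 6); [by vm_compute|by []|].
  by solve_pairs; rewrite ?f23 ?f24 ?f25 ?f26 ?f34 ?f35.
- apply: feasible_ext_full => //.
  by solve_pairs; rewrite ?f23 ?f24 ?f25 ?f26 ?f34 ?f35.
- apply: feasible_ext_full => //.
  by solve_pairs; rewrite ?f23 ?f24 ?f25 ?f26 ?f34 ?f35.
Qed.

Lemma feasible9 : coef_sys 9 c -> feasible (iota 1 9) (ext c) <-> c 2 3 != 0.
Proof.
move=> sys; have [f24 f25 f26 f34 f35] := weight8_eq0 sys isT b1.
have [f27 f36 f45] := weight9_eq0 sys b1 isT.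
have [y yE] : exists y, c 2 3 = y by exists (c 2 3).
have f23 : (c 2 3 == 0) = (y == 0) by rewrite yE.
rewrite f23; rewrite yE in f24 f25 f26 f27 f36.
case: (special_valueP y) f23 f24 f25 f26 f27 f36 => [_|_|_|_|_ _ _ _] f23 f24 f25 f26 f27 f36; split=> // F0.
- exfalso; move: F0; apply: (@test_infeasible _ _ _ [:: (2, 3); (2, 4); (2, 7)]%N
    [:: 1; -2%:Z; -1; 0; 1; 2; -1; 0; 1] 1 6).
  + by vm_compute.
  + by move=> i j; rewrite !inE => /or3P[] /eqP[-> ->]; apply/eqP; rewrite ext_ge2 ?f23 ?f24 ?f25 ?f26 ?f34 ?f35 ?f27 ?f36 ?f45.
  + by rewrite ext1 ?oner_eq0.
- apply: (@feasible_ext_table _ _ _ [:: (2, 5); (3, 6)]%N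
    [:: [::]; [:: 0; 0; 3; 6; 3; 8; 3; 3; 6]; [:: 0; 0; 0; 3; 3; 0; 10; 7]; [:: 0; 0; 0; 0; 11; 3]; [:: 0; 0; 0; 0; 0; 3]]%N
    38 6); [by vm_compute|by []|].
  by solve_pairs; rewrite ?f23 ?f24 ?f25 ?f26 ?f34 ?f35 ?f27 ?f36 ?f45.
- apply: (@feasible_ext_table _ _ _ [:: (2, 6)]%N
    [:: [::]; [:: 0; 0; 5; 5; 5; 5; 8; 15; 5]; [:: 0; 0; 0; 9; 5; 11; 0; 9]; [:: 0; 0; 0; 0; 11; 5; 5]; [:: 0; 0; 0; 0; 0; 5]]%N
    57 9); [by vm_compute|by []|].
  by solve_pairs; rewrite ?f23 ?f24 ?f25 ?f26 ?f34 ?f35 ?f27 ?f36 ?f45.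
- apply: (@feasible_ext_table _ _ _ [:: (2, 7)]%N
    [:: [::]; [:: 0; 0; 5; 5; 5; 5; 5; 9; 14]; [:: 0; 0; 0; 9; 11; 5; 9]; [:: 0; 0; 0; 0; 5; 11; 5]; [:: 0; 0; 0; 0; 0; 5]]%N
    57 9); [by vm_compute|by []|].
  by solve_pairs; rewrite ?f23 ?f24 ?f25 ?f26 ?f34 ?f35 ?f27 ?f36 ?f45.
- apply: feasible_ext_full => //.
  by solve_pairs; rewrite ?f23 ?f24 ?f25 ?f26 ?f34 ?f35 ?f27 ?f36 ?f45.
Qed.

Lemma feasible10 : coef_sys 10 c ->
  feasible (iota 1 10) (ext c) <-> [&& c 2 3 != 0, c 2 3 != 1 & 2 * c 2 3 != 5].
Proof.
move=> sys; have [f24 f25 f26 f34 f35] := weight8_eq0 sys isT b1.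
have [f27 f36 f45] := weight9_eq0 sys b1 isT.
have [f28 f37 f46] := weight10_eq0 sys b1 isT.
have [y yE] : exists y, c 2 3 = y by exists (c 2 3).
have f23 : (c 2 3 == 0) = (y == 0) by rewrite yE.
rewrite f23; rewrite yE in f24 f25 f26 f27 f36 f28 f37 *.
case: (special_valueP y) f23 f24 f25 f26 f27 f36 f28 f37 => [_|_|_|_|_ _ _ _] f23 f24 f25 f26 f27 f36 f28 f37; split=> // F0.
- exfalso; move: F0; apply: (@test_infeasible _ _ _ [:: (2, 3); (2, 4); (2, 7)]%N
    [:: 1; -2%:Z; -1; 0; 1; 2; -1; 0; 1; -2%:Z] 1 6).
  + by vm_compute.
  + by move=> i j; rewrite !inE => /or3P[] /eqP[-> ->]; apply/eqP; rewrite ext_ge2 ?f23 ?f24 ?f25 ?f26 ?f34 ?f35 ?f27 ?f36 ?f45 ?f28 ?f37 ?f46.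
  + by rewrite ext1 ?oner_eq0.
(* Here alpha = -1. The values are the residues modulo 3 in {-1, 0, 1}; a term is negative only if
   both degrees are 2 modulo 3, that is for (2, 5) and (2, 8), whose brackets vanish. *)
- exfalso; move: F0; apply: (@test_infeasible _ _ _ [:: (2, 5); (3, 6); (2, 8)]%N
    [:: 1; -1; 0; 1; -1; 0; 1; -1; 0; 1] 1 4).
  + by vm_compute.
  + by move=> i j; rewrite !inE => /or3P[] /eqP[-> ->]; apply/eqP; rewrite ext_ge2 ?f23 ?f24 ?f25 ?f26 ?f34 ?f35 ?f27 ?f36 ?f45 ?f28 ?f37 ?f46.
  + by rewrite ext1 ?oner_eq0.
- apply: (@feasible_ext_table _ _ _ [:: (2, 6)]%N
    [:: [::]; [:: 0; 0; 2; 2; 2; 2; 2; 4; 2; 2]; [:: 0; 0; 0; 3; 2; 4; 0; 2; 2]; [:: 0; 0; 0; 0; 2; 3; 2; 2]; [:: 0; 0; 0; 0; 0; 2; 3]]%N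
    21 3); [by vm_compute|by []|].
  by solve_pairs; rewrite ?f23 ?f24 ?f25 ?f26 ?f34 ?f35 ?f27 ?f36 ?f45 ?f28 ?f37 ?f46.
(* Here alpha = 1/2 and c_25 is nonzero. The residues modulo 3 are lowered by 3 at degree 7, which
   moves the negative terms to (2, 7), (2, 8) and (3, 7), whose brackets vanish. *)
- exfalso; move: F0; apply: (@test_infeasible _ _ _ [:: (2, 7); (2, 8); (3, 7)]%N
    [:: 1; -1; 0; 1; -1; 0; -2%:Z; -1; 0; 1] 1 4).
  + by vm_compute.
  + by move=> i j; rewrite !inE => /or3P[] /eqP[-> ->]; apply/eqP; rewrite ext_ge2 ?f23 ?f24 ?f25 ?f26 ?f34 ?f35 ?f27 ?f36 ?f45 ?f28 ?f37 ?f46.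
  + by rewrite ext1 ?oner_eq0.
- apply: feasible_ext_full => //.
  by solve_pairs; rewrite ?f23 ?f24 ?f25 ?f26 ?f34 ?f35 ?f27 ?f36 ?f45 ?f28 ?f37 ?f46.
Qed.

Lemma feasible11 : coef_sys 11 c -> feasible (iota 1 11) (ext c).
Proof.
move=> sys; have [f24 f25 f26 f34 f35] := weight8_eq0 sys isT b1.
have [f27 f36 f45] := weight9_eq0 sys b1 isT.
have [f28 f37 f46] := weight10_eq0 sys b1 isT.
have f47 := weight11_c47_neq0 sys isT b1 isT.
have [y1 _ _] := weight11_rel sys isT b1 isT.
have [ex29 ex38 ex56] := weight11_excl sys isT b1 isT.
have [y yE] : exists y, c 2 3 = y by exists (c 2 3).
have f23 : (c 2 3 == 0) = (y == 0) by rewrite yE.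
rewrite yE in f24 f25 f26 f27 f36 f28 f37 y1 ex29 ex38 ex56.
have [/eqP f29|f29'] := boolP (c 2 9 == 0).
  have [n0 n2 n5 /negPf f38 /negPf f56] := ex29 f29; move/eqP: f29 => f29.
  rewrite (negPf y1) (negPf n0) (negPf n2) (negPf n5) /= in f23 f24 f25 f26 f27 f36 f28 f37.
  apply: (@feasible_ext_table _ _ _ [:: (2, 9)]%N
      [:: [::]; [:: 0; 0; 13; 13; 13; 13; 13; 13; 13; 24; 25]; [:: 0; 0; 0; 13; 23; 14; 19; 13; 24]; [:: 0; 0; 0; 0; 13; 29; 13; 13; 17]; [:: 0; 0; 0; 0; 0; 13; 13; 15]; [:: 0; 0; 0; 0; 0; 0; 13]]%N
      161 21); [by vm_compute|by []|].
    by solve_pairs; rewrite ?f23 ?f24 ?f25 ?f26 ?f34 ?f35 ?f27 ?f36 ?f45 ?f28 ?f37 ?f46 ?f29 ?f38 ?f47 ?f56.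
have f29 := negPf f29'.
have [/eqP f38|f38'] := boolP (c 3 8 == 0).
  have [n0 n2 n5 /negPf f56] := ex38 f38; move/eqP: f38 => f38.
  rewrite (negPf y1) (negPf n0) (negPf n2) (negPf n5) /= in f23 f24 f25 f26 f27 f36 f28 f37.
  apply: (@feasible_ext_table _ _ _ [:: (3, 8)]%N
      [:: [::]; [:: 0; 0; 13; 13; 13; 18; 13; 13; 29; 13; 15]; [:: 0; 0; 0; 13; 13; 13; 13; 13; 13; 28]; [:: 0; 0; 0; 0; 24; 23; 13; 25]; [:: 0; 0; 0; 0; 0; 14; 13; 13]; [:: 0; 0; 0; 0; 0; 0; 14]]%N
      161 21); [by vm_compute|by []|].
    by solve_pairs; rewrite ?f23 ?f24 ?f25 ?f26 ?f34 ?f35 ?f27 ?f36 ?f45 ?f28 ?f37 ?f46 ?f29 ?f38 ?f47 ?f56.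
have f38 := negPf f38'.
have [/eqP f56|f56'] := boolP (c 5 6 == 0).
  have [n0 n2 n5] := ex56 f56; move/eqP: f56 => f56.
  rewrite (negPf y1) (negPf n0) (negPf n2) (negPf n5) /= in f23 f24 f25 f26 f27 f36 f28 f37.
  apply: (@feasible_ext_table _ _ _ [:: (5, 6)]%N
      [:: [::]; [:: 0; 0; 7; 14; 7; 7; 8; 9; 7; 14; 7]; [:: 0; 0; 0; 7; 7; 7; 7; 7; 7; 19]; [:: 0; 0; 0; 0; 7; 9; 12; 7; 7]; [:: 0; 0; 0; 0; 0; 23; 7; 7]]%N
      92 12); [by vm_compute|by []|].
    by solve_pairs; rewrite ?f23 ?f24 ?f25 ?f26 ?f34 ?f35 ?f27 ?f36 ?f45 ?f28 ?f37 ?f46 ?f29 ?f38 ?f47 ?f56.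
have f56 := negPf f56'.
move: y1; case: (special_valueP y) f23 f24 f25 f26 f27 f36 f28 f37 => [_|_|_|_|_ _ _ _] f23 f24 f25 f26 f27 f36 f28 f37 // _.
- apply: (@feasible_ext_table _ _ _ [:: (2, 3); (2, 4); (2, 7)]%N
    [:: [::]; [:: 0; 0; 1; 1; 14; 1; 1; 5; 1; 1; 15]; [:: 0; 0; 0; 0; 0; 1; 4; 0; 26; 2]; [:: 0; 0; 0; 0; 1; 21; 4; 1; 1]; [:: 0; 0; 0; 0; 0; 6; 1; 1]; [:: 0; 0; 0; 0; 0; 0; 1]]%N
    46 6); [by vm_compute|by []|].
  by solve_pairs; rewrite ?f23 ?f24 ?f25 ?f26 ?f34 ?f35 ?f27 ?f36 ?f45 ?f28 ?f37 ?f46 ?f29 ?f38 ?f47 ?f56.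
- apply: (@feasible_ext_table _ _ _ [:: (2, 6)]%N
    [:: [::]; [:: 0; 0; 2; 2; 2; 2; 2; 4; 2; 2; 2]; [:: 0; 0; 0; 3; 2; 4; 0; 2; 2; 2]; [:: 0; 0; 0; 0; 2; 3; 2; 2; 2]; [:: 0; 0; 0; 0; 0; 2; 3; 2]; [:: 0; 0; 0; 0; 0; 0; 2]]%N
    23 3); [by vm_compute|by []|].
  by solve_pairs; rewrite ?f23 ?f24 ?f25 ?f26 ?f34 ?f35 ?f27 ?f36 ?f45 ?f28 ?f37 ?f46 ?f29 ?f38 ?f47 ?f56.
- apply: (@feasible_ext_table _ _ _ [:: (2, 7); (2, 8); (3, 7)]%N
    [:: [::]; [:: 0; 0; 1; 1; 1; 1; 1; 6; 14; 14; 1]; [:: 0; 0; 0; 1; 12; 1; 3; 0; 0; 16]; [:: 0; 0; 0; 0; 1; 8; 17; 0; 1]; [:: 0; 0; 0; 0; 0; 7; 1; 1]; [:: 0; 0; 0; 0; 0; 0; 1]]%N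
    46 6); [by vm_compute|by []|].
  by solve_pairs; rewrite ?f23 ?f24 ?f25 ?f26 ?f34 ?f35 ?f27 ?f36 ?f45 ?f28 ?f37 ?f46 ?f29 ?f38 ?f47 ?f56.
- apply: feasible_ext_full => //.
  by solve_pairs; rewrite ?f23 ?f24 ?f25 ?f26 ?f34 ?f35 ?f27 ?f36 ?f45 ?f28 ?f37 ?f46 ?f29 ?f38 ?f47 ?f56.
Qed.
End Normalized.

(** * Lie algebras given by structure constants *)

Lemma sum_iota_ord (V : nmodType) n (F : nat -> V) :
  \sum_(k <- iota 1 n) F k = \sum_(k < n) F k.+1.
Proof.
by have /= -> := iotaDl 1 0 n; rewrite big_map -[in LHS](subn0 n) -/(index_iota 0 n) big_mkord.
Qed.

Section ScBracket.
Variables (R : realType) (n : nat) (s : nat -> nat -> nat -> R).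
Local Notation W := 'rV[R]_n.
Local Notation sc := (@sc_bracket R n s).

Lemma sc_linearl y : linear (sc^~ y).
Proof.
move=> k u v; apply/rowP => l; rewrite !mxE mulr_sumr -big_split; apply: eq_bigr => i _.
by rewrite mulr_sumr -big_split; apply: eq_bigr => j _ /=; rewrite !mxE; ring.
Qed.

Lemma sc_linearr x : linear (sc x).
Proof.
move=> k u v; apply/rowP => l; rewrite !mxE mulr_sumr -big_split; apply: eq_bigr => i _.
by rewrite mulr_sumr -big_split; apply: eq_bigr => j _ /=; rewrite !mxE; ring.
Qed.

Lemma sc_alt x : sc x x = 0.
Proof.
apply/rowP => l; rewrite !mxE; apply: big1 => i _; apply: big1 => j _.
by rewrite [x 0 j * _]mulrC subrr mul0r.
Qed.

Definition unit_row (i : nat) : W := \row_k (k.+1 == i)%:R.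

Lemma row_unit_sum (v : W) : v = \sum_(k < n) v 0 k *: unit_row k.+1.
Proof.
apply/rowP => l; rewrite summxE (bigD1 l)//= !mxE eqxx mulr1 big1 ?addr0// => k kl.
by rewrite !mxE eqSS val_eqE eq_sym (negPf kl) mulr0.
Qed.

Lemma sc_unit i j : (0 < i)%N -> (i < j)%N -> (j <= n)%N ->
  sc (unit_row i) (unit_row j) = \sum_(k <- iota 1 n) s i j k *: unit_row k.
Proof.
move=> i0 ij jn; have i1n : (i.-1 < n)%N by lia.
have j1n : (j.-1 < n)%N by lia.
pose i' := Ordinal i1n; pose j' := Ordinal j1n.
have iE : i'.+1 = i by rewrite /= prednK.
have jE : j'.+1 = j by rewrite /= prednK//; lia.
have -> : \sum_(k <- iota 1 n) s i j k *: unit_row k = \row_l s i j l.+1.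
  by rewrite [RHS]row_unit_sum sum_iota_ord; apply: eq_bigr => k _; rewrite mxE.
have termE (k m : 'I_n) : (k < m)%N ->
    unit_row i 0 k * unit_row j 0 m - unit_row i 0 m * unit_row j 0 k =
    ((k == i') && (m == j'))%:R.
  move=> km; rewrite !mxE -iE -jE !eqSS !val_eqE.
  have h : (m == i') && (k == j') = false.
    by apply/andP => -[/eqP mi /eqP kj]; move: km; rewrite mi kj /=; lia.
  by rewrite -!natrM !mulnb h subr0.
apply/rowP => l; rewrite !mxE (bigD1 i')//= (bigD1 j') /=; last by lia.
rewrite termE ?eqxx ?mul1r /=; last by lia.
rewrite [X in _ + X + _]big1 => [|m /andP[im mj]]; last first.
  by rewrite termE// (negPf mj) andbF mul0r.
rewrite [X in _ + X]big1 => [|k ki]; last first.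
  by apply: big1 => m km; rewrite termE// (negPf ki) mul0r.
by rewrite !addr0; congr (s _ _ _); [exact: iE|exact: jE].
Qed.
End ScBracket.

Section Isomorphisms.
Variables (R : realType) (V : vectType R) (br : V -> V -> V).
Variables (n : nat) (s : nat -> nat -> nat -> R).

(** Having such a basis amounts to being isomorphic to [sc_bracket s]; the relations with i < j
    determine the rest by skew-symmetry. *)
Definition sc_basis (u : nat -> V) : Prop :=
  basis_of {:V} [seq u i | i <- iota 1 n] /\
  forall i j, (0 < i)%N -> (i < j)%N -> (j <= n)%N ->
    br (u i) (u j) = \sum_(k <- iota 1 n) s i j k *: u k.

Lemma iso_sc_basis : lie_isom br (@sc_bracket R n s) -> exists u, sc_basis u.
Proof.
move=> [f [[g fK gK] fbr]].
have fi : injective f := can_inj fK.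
have gl : linear g by move=> k x y; apply: fi; rewrite linearP /= !gK.
exists (fun i => g (unit_row R n i)); split; last first.
  move=> i j i0 ij jn; apply: fi; rewrite fbr !gK sc_unit// linear_sum /=.
  by apply: eq_bigr => k _; rewrite linearZ /= gK.
rewrite basisEdim size_map size_iota; apply/andP; split.
  apply/subvP => v _; rewrite -(fK v) (row_unit_sum (f v)) linear_fun_sum//.
  apply: rpred_sum => k _; rewrite linear_funZ// rpredZ//; apply: memv_span.
  by apply: (map_f (fun i => g (unit_row R n i))); rewrite mem_iota1 /=.
have -> : \dim {:V} = \dim (f @: {:V}).
  apply/esym/limg_dim_eq; apply/eqP; rewrite -subv0; apply/subvP => v.
  rewrite memv_cap memv_ker => /andP[_ /eqP fv].
  by rewrite memv0 -(inj_eq fi) fv linear0.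
have -> : (f @: {:V})%VS = fullv.
  by apply/vspaceP => w; rewrite memvf -(gK w) memv_img// memvf.
by rewrite dimvf /dim /= mul1n.
Qed.

Lemma sc_basis_iso u : is_lie br -> sc_basis u -> lie_isom br (@sc_bracket R n s).
Proof.
move=> lie [ub ubr]; pose D := iota 1 n.
have Du : uniq D := iota_uniq 1 n.
pose f0 (v : V) : 'rV[R]_n := \row_(k < n) gcoord D u k.+1 v.
have f0l : linear f0 by move=> k x y; apply/rowP => i; rewrite !mxE linearP.
pose f0L := HB.pack_for {linear V -> 'rV[R]_n} f0
  (GRing.isLinear.Build R V 'rV[R]_n _ f0 f0l).
pose f : 'Hom(V, 'rV[R]_n) := linfun f0L.
have fE v : f v = f0 v by rewrite lfunE.
have inD (k : 'I_n) : k.+1 \in D by rewrite mem_iota1 /=.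
have fu i : i \in D -> f (u i) = unit_row R n i.
  by move=> iD; rewrite fE; apply/rowP => k; rewrite !mxE (gcoord_e Du ub).
exists f; split.
  exists (fun w : 'rV[R]_n => \sum_(k < n) w 0 k *: u k.+1) => [v|w].
    rewrite {2}(gcoord_sum Du ub v) sum_iota_ord; apply: eq_bigr => k _.
    by rewrite fE mxE.
  rewrite linear_sum [RHS]row_unit_sum; apply: eq_bigr => k _.
  by rewrite linearZ /= fu.
have sl := @sc_linearl R n s; have sr := @sc_linearr R n s.
apply: (bilinear_ext Du ub) => [y k x z|x k y z|y k x z|x k y z|a b].
- by rewrite (lie_linearl lie) linearP.
- by rewrite (lie_linearr lie) linearP.
- by rewrite linearP /= sl.
- by rewrite linearP /= sr.
wlog ab : a b / (a <= b)%N.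
  move=> H aD bD; have [ab|ba] := leqP a b; first exact: H.
  have anti (x y : 'rV[R]_n) : sc_bracket s x y = - sc_bracket s y x.
    have := sc_alt s (x + y); rewrite (linear_funD _ _ (sr _)) !(linear_funD _ _ (sl _)).
    by rewrite !sc_alt add0r addr0 => /eqP; rewrite addr_eq0 => /eqP ->; rewrite opprK.
  by rewrite (lie_anti lie) linearN /= H// 1?ltnW// -anti.
move=> aD bD; have [<-|ab'] := eqVneq a b.
  by rewrite (lie_alt lie) linear0 sc_alt.
rewrite !fu// sc_unit; first last.
- by move: bD; rewrite mem_iota1 => /andP[].
- by lia.
- by move: aD; rewrite mem_iota1 => /andP[].
rewrite ubr; first last.
- by move: bD; rewrite mem_iota1 => /andP[].
- by lia.
- by move: aD; rewrite mem_iota1 => /andP[].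
rewrite linear_sum /= big_seq [RHS]big_seq; apply: eq_bigr => k kD.
by rewrite linearZ /= fu.
Qed.
End Isomorphisms.

Lemma lie_isom_is_lie (R : realType) (V W : vectType R) (brV : V -> V -> V)
    (brW : W -> W -> W) : lie_isom brV brW -> is_lie brW -> is_lie brV.
Proof.
move=> [f [[g fK gK] fbr]] lie; have fi : injective f := can_inj fK.
split=> [y k u v|x k u v|x|x y z]; apply: fi.
- by rewrite linearP /= !fbr linearP /= (lie_linearl lie).
- by rewrite linearP /= !fbr linearP /= (lie_linearr lie).
- by rewrite fbr (lie_alt lie) linear0.
- by rewrite !linearD linear0 /= !fbr (lie_jacobi lie).
Qed.

Lemma lie_isom_refl (R : realType) (V : vectType R) (br : V -> V -> V) : lie_isom br br.
Proof.
exists \1%VF; split=> [|x y]; last by rewrite !id_lfunE.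
by exists id => x; rewrite id_lfunE.
Qed.

Section GradedLie.
Variables (R : realType) (V : vectType R) (br : V -> V -> V) (D : seq nat).
Variables (C : nat -> nat -> R) (e : nat -> V).
Hypothesis (Du : uniq D) (gr : graded br D C e).

Lemma graded_rescale (t : nat -> R) : is_lie br -> (forall a, a \in D -> t a != 0) ->
  graded br D (fun a b => t a * t b / t (a + b)%N * C a b) (fun a => t a *: e a).
Proof.
move=> lie t0; have [br1 br2] := (lie_linearl lie, lie_linearr lie); split.
  apply: (spanning_basis Du gr.1 (f := fun a => t a *: e a)) => a aD.
  rewrite -[e a](scalerK (t0 a aD)) rpredZ//; apply: memv_span.
  exact: (map_f (fun a => t a *: e a)).
move=> a b aD bD; rewrite (linear_funZ _ _ (br1 _)) (linear_funZ _ _ (br2 _)) gr.2//.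
case: ifP => abD; last by rewrite !scaler0.
by rewrite !scalerA; congr (_ *: _); field; exact: t0.
Qed.

Lemma graded_jacobi a b c : is_lie br -> a \in D -> b \in D -> c \in D ->
  (b + c)%N \in D -> (c + a)%N \in D -> (a + b)%N \in D -> (a + b + c)%N \in D ->
  C b c * C a (b + c)%N + C c a * C b (c + a)%N + C a b * C c (a + b)%N = 0.
Proof.
move=> lie aD bD cD bcD caD abD abcD; have br2 := lie_linearr lie.
have := lie_jacobi lie (e a) (e b) (e c).
rewrite !gr.2// bcD caD abD !(linear_funZ _ _ (br2 _)) !gr.2//.
rewrite (_ : (b + (c + a) = a + b + c)%N); last lia.
rewrite (_ : (c + (a + b) = a + b + c)%N); last lia.
rewrite addnA abcD !scalerA -!scalerDl => /eqP; rewrite scaler_eq0.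
by rewrite (negPf (e_neq0 Du gr abcD)) orbF => /eqP.
Qed.

(** The Jacobi sum of basis vectors is cyclic and alternating in the degrees, so increasing triples
    whose total is a degree suffice: a finite list. *)
Lemma graded_is_lie : (forall y, linear (br^~ y)) -> (forall x, linear (br x)) ->
  (forall x, br x x = 0) ->
  (forall a b, a \in D -> b \in D -> C b a = - C a b) ->
  (forall a b c, a \in D -> b \in D -> c \in D -> (a < b)%N -> (b < c)%N ->
     (a + b + c)%N \in D ->
     (if (b + c)%N \in D then C b c * C a (b + c)%N else 0) +
     (if (c + a)%N \in D then C c a * C b (c + a)%N else 0) +
     (if (a + b)%N \in D then C a b * C c (a + b)%N else 0) = 0) ->
  is_lie br.
Proof.
move=> br1 br2 alt anti jac; split=> // x y z.
pose J a b c := (if (b + c)%N \in D then C b c * C a (b + c)%N else 0) +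
     (if (c + a)%N \in D then C c a * C b (c + a)%N else 0) +
     (if (a + b)%N \in D then C a b * C c (a + b)%N else 0).
have Jrot a b c : J a b c = J b c a by rewrite /J -addrA addrC.
have Jswap a b c : a \in D -> b \in D -> c \in D -> J b a c = - J a b c.
  move=> aD bD cD; rewrite /J (addnC a c) (addnC c b) (addnC b a) (anti a b)// (anti c a)// (anti b c)//.
  by do ![case: ifP => _]; ring.
have Jdiag a c : a \in D -> c \in D -> J a a c = 0.
  move=> aD cD; rewrite /J (addnC c a) (anti a c)//.
  have -> : C a a = 0 by have := anti a a aD aD; lra.
  by do ![case: ifP => _]; ring.
have J0 a b c : a \in D -> b \in D -> c \in D -> (a + b + c)%N \in D -> J a b c = 0.
  have Jle a' b' c' : a' \in D -> b' \in D -> c' \in D -> (a' + b' + c')%N \in D ->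
      (a' <= b')%N -> (b' <= c')%N -> J a' b' c' = 0.
    move=> aD bD cD abcD; rewrite leq_eqVlt => /orP[/eqP ->|ab]; first by rewrite Jdiag.
    rewrite leq_eqVlt => /orP[/eqP ->|bc]; first by rewrite Jrot Jdiag.
    exact: jac.
  move=> aD bD cD abcD.
  have s1 : (b + c + a)%N \in D by rewrite (_ : (b + c + a = a + b + c)%N)//; lia.
  have s2 : (c + a + b)%N \in D by rewrite (_ : (c + a + b = a + b + c)%N)//; lia.
  have s3 : (b + a + c)%N \in D by rewrite (_ : (b + a + c = a + b + c)%N)//; lia.
  have s4 : (a + c + b)%N \in D by rewrite (_ : (a + c + b = a + b + c)%N)//; lia.
  have s5 : (c + b + a)%N \in D by rewrite (_ : (c + b + a = a + b + c)%N)//; lia.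
  have sw : J a b c = - J b a c by rewrite Jswap// opprK.
  have [ab|ba] := leqP a b.
    have [bc|cb] := leqP b c; first exact: Jle.
    have [ac|ca] := leqP a c; last by rewrite Jrot Jrot; apply: Jle => //; exact: ltnW.
    by rewrite sw Jrot Jle ?oppr0// ltnW.
  have [bc|cb] := leqP b c; last first.
    by rewrite sw Jrot Jrot Jle ?oppr0//; exact: ltnW.
  have [ac|ca] := leqP a c; first by rewrite sw Jle ?oppr0// ltnW.
  by rewrite Jrot; apply: Jle => //; exact: ltnW.
pose Jac x y z := br x (br y z) + br y (br z x) + br z (br x y).
have Jacrot u v w : Jac u v w = Jac v w u by rewrite /Jac -addrA addrC.
have Jac1 v w : linear (fun u => Jac u v w).
  move=> k u1 u2; rewrite /Jac !br1 !br2 !scalerDr.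
  by rewrite (addrACA (k *: _)) [LHS]addrACA.
rewrite -/(Jac x y z) (linear_gcoord Du gr.1 x (Jac1 y z)).
apply: big1_seq => a /andP[_ aD]; rewrite Jacrot.
rewrite (linear_gcoord Du gr.1 y (Jac1 z (e a))) big1_seq ?scaler0// => b /andP[_ bD].
rewrite Jacrot (linear_gcoord Du gr.1 z (Jac1 (e a) (e b))) big1_seq ?scaler0// => c /andP[_ cD].
apply/eqP; rewrite scaler_eq0; apply/orP; right; apply/eqP; rewrite Jacrot /Jac.
have H p q r : p \in D -> q \in D -> r \in D -> br (e p) (br (e q) (e r)) =
   (if (q + r)%N \in D then C q r * C p (q + r)%N else 0) *:
   (if (p + q + r)%N \in D then e (p + q + r)%N else 0).
  move=> pD qD rD; rewrite gr.2//; case: ifP => qrD; last by rewrite (linear_fun0 (br2 _)) scale0r.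
  rewrite (linear_funZ _ _ (br2 _)) gr.2// addnA; case: ifP => _; last by rewrite !scaler0.
  by rewrite scalerA.
rewrite !H// (_ : (b + c + a = a + b + c)%N); last lia.
rewrite (_ : (c + a + b = a + b + c)%N); last lia.
case abcD: ((a + b + c)%N \in D); last by rewrite !scaler0 !addr0.
by rewrite -!scalerDl -/(J a b c) J0// scale0r.
Qed.

(** All degrees being positive, the k-th term of the central series lives in degrees above k. *)
Lemma graded_nilpotent : is_lie br -> (forall a, a \in D -> (0 < a)%N) -> nilpotent_lie br.
Proof.
move=> lie Dpos; split=> //; exists (sumn D).
have lcs_low k v : v \in lcs br k -> low D e k.+1 v.
  elim: k v => [|k IH] v; first by move=> _ a /Dpos; lia.
  rewrite /lcs iterS -/(lcs br k); set S := [seq _ | _ <- _, _ <- _] => vS.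
  rewrite (coord_span (X := in_tuple S) vS); apply: low_sum => i _; apply: lowZ.
  have /allpairsP[[x y] /= [_ yU ->]] : (in_tuple S)`_i \in S by exact: mem_nth.
  apply: (low_br Du lie gr (k := 1) (l := k.+1)).
    by move=> a /Dpos; lia.
  by apply: IH; exact: vbasis_mem.
apply/eqP; rewrite -subv0; apply/subvP => v /lcs_low lv; rewrite memv0; apply/eqP.
apply: (low_eq0 Du gr _ lv) => a; rewrite ltnS.
elim: D => //= d r IH; rewrite inE => /orP[/eqP->|/IH]; first exact: leq_addr.
by move=> /leq_trans; apply; exact: leq_addl.
Qed.
End GradedLie.

(** * The class A_2 *)

Lemma classA2_graded (R : realType) (V : vectType R) (br : V -> V -> V) n :
  classA2 br n -> exists e c, graded br (iota 1 n) (ext c) e /\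
    exists i j, [/\ (2 <= i)%N, (2 <= j)%N, (i + j <= n)%N & c i j != 0].
Proof.
move=> [lie [n5 [e [c [eb [b1 bn bc b0 [i [j [i2 j2 ij cij]]]]]]]]].
exists e, c; split; last by exists i, j; split=> //; apply/eqP.
split=> // a b; rewrite !mem_iota1 => aD bD.
have H y : (0 < y <= n)%N ->
    br (e 1%N) (e y) = if (0 < 1 + y <= n)%N then ext c 1 y *: e (1 + y)%N else 0.
  move=> yD; have [->|y1] := eqVneq y 1%N.
    by rewrite (lie_alt lie) /ext /= scale0r if_same.
  have y2 : (2 <= y)%N by lia.
  rewrite ext1//; have [->|yn] := eqVneq y n.
    have -> : (0 < 1 + n <= n)%N = false by lia.
    exact: bn.
  have -> : (0 < 1 + y <= n)%N by lia.
  have yn' : (y <= n.-1)%N by lia.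
  by rewrite b1// scale1r.
have [->|a1] := eqVneq a 1%N; first exact: H.
have [->|b1'] := eqVneq b 1%N.
  rewrite (lie_anti lie) H// addnC; case: ifP => // _; last by rewrite oppr0.
  rewrite -scaleNr; congr (_ *: _).
  have a2 : (2 <= a)%N by lia.
  by rewrite ext1// /ext (negPf a1).
have a2 : (2 <= a <= n)%N by lia.
have b2 : (2 <= b <= n)%N by lia.
have [a2' b2'] := (proj1 (andP a2), proj1 (andP b2)).
rewrite ext_ge2//; have [abn|nab] := leqP (a + b) n.
  rewrite bc//; have -> : (0 < a + b)%N by lia.
  by [].
by rewrite b0// andbF.
Qed.

Lemma graded_coef_sys (R : realType) (V : vectType R) (br : V -> V -> V) D m C e :
  uniq D -> is_lie br -> graded br D C e ->
  (forall k, (0 < k <= m)%N -> k \in D) ->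
  (forall k, (2 <= k < m)%N -> C 1 k = 1) -> coef_sys m C.
Proof.
move=> Du lie gr Dm C1; split=> [i j i2 j2 ij|i j i2 j2 ij|i j l i2 j2 l2 ijl].
- by apply: (graded_anti Du lie gr); apply: Dm; lia.
- have := graded_jacobi (a := 1) (b := i) (c := j) Du gr lie.
  move=> /(_ (Dm _ _) (Dm _ _) (Dm _ _) (Dm _ _) (Dm _ _) (Dm _ _) (Dm _ _)).
  move=> /(_ ltac:(lia) ltac:(lia) ltac:(lia) ltac:(lia) ltac:(lia) ltac:(lia) ltac:(lia)).
  have C1ij : C 1 (i + j)%N = 1 by apply: C1; lia.
  have C1i : C 1 i = 1 by apply: C1; lia.
  have C1j : C 1 j = 1 by apply: C1; lia.
  rewrite C1ij C1i mulr1 mul1r.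
  rewrite (graded_anti Du lie gr (a := 1) (b := j)); try by apply: Dm; lia.
  rewrite C1j (addn1 j) (add1n i).
  rewrite (graded_anti Du lie gr (a := i.+1) (b := j)); try by apply: Dm; lia.
  by lra.
- by apply: (graded_jacobi Du gr lie); apply: Dm; lia.
Qed.

Lemma coef_sys_g (R : realType) n (c : nat -> nat -> R) (al : R) :
  coef_sys n c -> (7 <= n <= 11)%N -> c 3 4 = 1 -> al = c 2 3 - 2 ->
  forall i j, (2 <= i)%N -> (i < j)%N -> (i + j <= n)%N -> c i j = g_coef al i j.
Proof.
move=> sys n8 b1 ->.
have dE : 2 * (c 2 3 - 2) + 5 = 2 * c 2 3 + 1 by ring.
have u9 : (9 <= n)%N -> 2 * c 2 3 + 1 != 0 /\ c 4 5 = 3 / (2 * c 2 3 + 1).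
  move=> n9; have r := cs_rel9 sys n9; rewrite b1 expr1n mulr1 in r.
  have p0 : 2 * c 2 3 + 1 != 0.
    by apply/eqP => p0; move/eqP: r; rewrite p0 mulr0 eq_sym pnatr_eq0.
  by split=> //; rewrite -r mulfK.
pose q := 2 * ((c 2 3 - 2) ^+ 2 + 4 * (c 2 3 - 2) + 3).
have w11 : (11 <= n)%N -> q != 0 /\
    c 5 6 = 3 * (4 * (c 2 3 - 2) + 1) / (q * (2 * c 2 3 + 1)).
  move=> n11; have n8' : (8 <= n)%N by lia.
  have n9 : (9 <= n)%N by lia.
  have [_ r q0] := weight11_rel sys n8' b1 n11.
  have [p0 uE] := u9 n9.
  (* This identifies the denominator in the table of g_alpha(11) with the factor of c_56 in weight
     11, known to be nonzero. *)
  have qE : q = (2 * c 2 3 - 1 - c 4 5) * (2 * c 2 3 + 1) / 2.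
    by rewrite /q uE; field.
  have q0' : q != 0 by rewrite qE !mulf_neq0// invr_eq0 pnatr_eq0.
  split=> //; apply: (mulIf q0); rewrite r.
  have -> : 2 * c 2 3 - 1 - c 4 5 = 2 * q / (2 * c 2 3 + 1) by rewrite qE; field.
  by rewrite uE; field; rewrite p0.
apply: pairs_upto11; first by lia.
move=> p; rewrite !inE; do ?[case/orP]; move=> /eqP -> /= h; rewrite /g_coef ?dE -?/q.
- by ring.
- by rewrite (cs_weight6 sys)//; ring.
- by rewrite (cs_weight7 sys)// b1; ring.
- by have [-> _] := cs_weight8 sys h; rewrite b1; ring.
- have [p0 uE] := u9 h; have [-> _] := cs_weight9 sys h; rewrite b1 uE; field; exact: p0.
- have [p0 uE] := u9 (ltnW h); have [-> _ _] := cs_weight10 sys h; rewrite b1 uE; field; exact: p0.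
- have [p0 uE] := u9 (ltnW (ltnW h)); have [q0 wE] := w11 h.
  have [-> _ _] := cs_weight11 sys h; rewrite b1 uE wE; move: q0; rewrite /q mulf_eq0 negb_or => /andP[_ q0]; field.
  by rewrite ?p0 ?q0.
- by [].
- by have [_ ->] := cs_weight8 sys h.
- have [p0 uE] := u9 h; have [_ ->] := cs_weight9 sys h; rewrite b1 uE; field; exact: p0.
- have [p0 uE] := u9 (ltnW h); have [_ -> _] := cs_weight10 sys h; rewrite b1 uE; field; exact: p0.
- have [p0 uE] := u9 (ltnW (ltnW h)); have [q0 wE] := w11 h.
  have [_ -> _] := cs_weight11 sys h; rewrite b1 uE wE; move: q0; rewrite /q mulf_eq0 negb_or => /andP[_ q0]; field.
  by rewrite ?p0 ?q0.
- by have [p0 uE] := u9 h.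
- by have [p0 uE] := u9 (ltnW h); have [_ _ ->] := cs_weight10 sys h.
- have [p0 uE] := u9 (ltnW (ltnW h)); have [q0 wE] := w11 h.
  have [_ _ ->] := cs_weight11 sys h; rewrite uE wE; move: q0; rewrite /q mulf_eq0 negb_or => /andP[_ q0]; field.
  by rewrite ?p0 ?q0.
- by have [q0 wE] := w11 h.
Qed.

Definition alt_coef (R : realType) (g : nat -> nat -> R) (i j : nat) : R :=
  if (i < j)%N then g i j else if (j < i)%N then - g j i else 0.

Lemma alt_coef_lt (R : realType) (g : nat -> nat -> R) i j : (i < j)%N -> alt_coef g i j = g i j.
Proof. by rewrite /alt_coef => ->. Qed.

Section GradedSc.
Variables (R : realType) (V : vectType R) (br : V -> V -> V) (n : nat).
Variables (g : nat -> nat -> R) (u : nat -> V).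
Hypothesis lie : is_lie br.

Lemma graded_sc_sum i j : (0 < i)%N ->
  \sum_(k <- iota 1 n) graded_sc g i j k *: u k =
  if (i + j)%N \in iota 1 n then g i j *: u (i + j)%N else 0.
Proof.
move=> i0; case: ifP => ij.
  rewrite (bigD1_seq (i + j)%N) ?iota_uniq//= /graded_sc eqxx big1 ?addr0// => k /negPf ->.
  by rewrite scale0r.
rewrite big1_seq// => k /andP[_ kD]; rewrite /graded_sc; case: eqP => [kE|_]; last by rewrite scale0r.
by rewrite -kE kD in ij.
Qed.

Lemma graded_sc_basis (C : nat -> nat -> R) : graded br (iota 1 n) C u ->
  (forall i j, (0 < i)%N -> (i < j)%N -> (i + j <= n)%N -> C i j = g i j) ->
  sc_basis br n (graded_sc g) u.
Proof.
move=> [ub ubr] Cg; split=> // i j i0 ij jn; rewrite graded_sc_sum//.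
have iD : i \in iota 1 n by rewrite mem_iota1; lia.
have jD : j \in iota 1 n by rewrite mem_iota1; lia.
rewrite ubr// mem_iota1; case: ifP => // ijn; rewrite Cg//.
by case/andP: ijn.
Qed.

Lemma sc_basis_graded : sc_basis br n (graded_sc g) u -> graded br (iota 1 n) (alt_coef g) u.
Proof.
move=> [ub ubr]; split=> // a b; rewrite [a \in _]mem_iota1 [b \in _]mem_iota1 => /andP[a0 an] /andP[b0 bn].
rewrite /alt_coef; case: ltngtP => ab.
- by rewrite ubr// graded_sc_sum.
- rewrite (lie_anti lie) ubr// graded_sc_sum// addnC; case: ifP => // _; last by rewrite oppr0.
  by rewrite scaleNr.
- by rewrite ab (lie_alt lie) scale0r if_same.
Qed.
End GradedSc.

Lemma iso_graded (R : realType) (V : vectType R) (br : V -> V -> V) n g : is_lie br ->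
  lie_isom br (@sc_bracket R n (graded_sc g)) -> exists u, graded br (iota 1 n) (alt_coef g) u.
Proof.
by move=> lie /iso_sc_basis[u ub]; exists u; exact: sc_basis_graded.
Qed.

Lemma graded_iso (R : realType) (V : vectType R) (br : V -> V -> V) n C g u : is_lie br ->
  graded br (iota 1 n) C u ->
  (forall i j, (0 < i)%N -> (i < j)%N -> (i + j <= n)%N -> C i j = g i j) ->
  lie_isom br (@sc_bracket R n (graded_sc g)).
Proof.
by move=> lie gr Cg; apply: sc_basis_iso lie _; apply: graded_sc_basis gr Cg.
Qed.

Lemma coef_sys_iso_g (R : realType) (V : vectType R) (br : V -> V -> V) n c e : is_lie br ->
  graded br (iota 1 n) (ext c) e -> (7 <= n <= 11)%N -> coef_sys n c -> c 3 4 != 0 ->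
  lie_isom br (@g_bracket R (c 2 3 / c 3 4 - 2) n).
Proof.
move=> lie gr n7 sys b0; pose k := (c 3 4)^-1.
have k0 : k != 0 by rewrite invr_eq0.
(* Scaling e_2, ..., e_n by one factor preserves [e_1, e_i] = e_(i+1) and multiplies every other
   constant by it. *)
pose t a : R := if a == 1%N then 1 else k.
have t0 a : t a != 0 by rewrite /t; case: ifP => // _; exact: oner_neq0.
have gr' := graded_rescale (iota_uniq 1 n) gr lie (fun a _ => t0 a).
have sysk := coef_sysZ k sys.
have kb : k * c 3 4 = 1 by rewrite mulVf.
have al : c 2 3 / c 3 4 - 2 = k * c 2 3 - 2 by rewrite mulrC.
have cg := coef_sys_g sysk n7 kb al.
apply: (graded_iso lie gr') => i j i0 ij ijn.
have ij1 : (i + j == 1)%N = false by lia.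
have j1 : (j == 1)%N = false by lia.
have [i1|i1] := eqVneq i 1%N.
  have j2 : (2 <= j)%N by lia.
  rewrite i1 in ij1 *.
  by rewrite /t eqxx j1 ij1 ext1// mul1r mulr1 divff.
have i2 : (2 <= i)%N by lia.
have j2 : (2 <= j)%N by lia.
by rewrite /t (negPf i1) j1 ij1 mulfK// ext_ge2// cg.
Qed.

Lemma coef_sys_iso_V (R : realType) (V : vectType R) (br : V -> V -> V) n c e : is_lie br ->
  graded br (iota 1 n) (ext c) e -> (12 <= n)%N -> coef_sys n c -> c 3 4 != 0 ->
  lie_isom br (@V_bracket R n).
Proof.
move=> lie gr n12 sys b0; have [a0 ag] := cs_case_witt sys n12 b0.
pose s := (6 * c 2 3)^-1.
have s0 : s != 0 by rewrite invr_eq0 mulf_neq0// pnatr_eq0.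
have f0 (k : nat) : (k`!)%:R != 0 :> R by rewrite pnatr_eq0 -lt0n fact_gt0.
(* The factorials turn [e_1, e_j] = e_(j+1) into (j - 1) e_(j+1) and undo the denominators of
   [witt_coef]; [s] removes the factor 6 c_23. *)
pose t a : R := if a == 1%N then 1 else s / ((a - 2)`!)%:R.
have t0 a : t a != 0.
  by rewrite /t; case: ifP => _; [exact: oner_neq0|rewrite mulf_neq0// invr_eq0].
have gr' := graded_rescale (iota_uniq 1 n) gr lie (fun a _ => t0 a).
apply: (graded_iso lie gr') => i j i0 ij ijn.
have [i1|i1] := eqVneq i 1%N.
  have [j' jE] : exists j', j = j'.+2 by exists (j - 2)%N; lia.
  rewrite i1 jE ext1// /t /= !subSS !subn0 factS natrM.
  by rewrite -![_.+2%:R]natr1 -[_.+1%:R]natr1; field; rewrite s0 !f0 /= natr1 pnatr_eq0.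
have [i' iE] : exists i', i = i'.+2 by exists (i - 2)%N; lia.
have [j' jE] : exists j', j = j'.+2 by exists (j - 2)%N; lia.
have ijE : (i + j = (i' + j').+4)%N by lia.
rewrite ext_ge2; [|lia|lia].
rewrite ag; [|lia|lia|lia].
rewrite ijE iE jE witt_coefE /t /= !subSS !subn0.
by rewrite -![_.+2%:R]natr1 -![_.+1%:R]natr1 /s; field; rewrite !f0 a0.
Qed.

Lemma coef_sys_eq (R : realType) m (c c' : nat -> nat -> R) :
  (forall i j, (2 <= i)%N -> (2 <= j)%N -> (i + j <= m)%N -> c i j = c' i j) ->
  coef_sys m c -> coef_sys m c'.
Proof.
move=> cc' [ca cr cj]; split=> [i j i2 j2 ij|i j i2 j2 ij|i j l i2 j2 l2 ij].
- have e1 := cc' i j i2 j2 ij.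
  have e2 : c j i = c' j i by apply: cc'; lia.
  by rewrite -e1 -e2; exact: ca.
- have e1 : c i j = c' i j by apply: cc'; lia.
  have e2 : c i.+1 j = c' i.+1 j by apply: cc'; lia.
  have e3 : c i j.+1 = c' i j.+1 by apply: cc'; lia.
  by rewrite -e1 -e2 -e3; exact: cr.
- have e1 : c j l = c' j l by apply: cc'; lia.
  have e2 : c l i = c' l i by apply: cc'; lia.
  have e3 : c i j = c' i j by apply: cc'; lia.
  have e4 : c i (j + l)%N = c' i (j + l)%N by apply: cc'; lia.
  have e5 : c j (l + i)%N = c' j (l + i)%N by apply: cc'; lia.
  have e6 : c l (i + j)%N = c' l (i + j)%N by apply: cc'; lia.
  by rewrite -e1 -e2 -e3 -e4 -e5 -e6; exact: cj.
Qed.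

(** * Einstein nilradicals in the class A_2 *)

Section Part1.
Variables (R : realType) (V : vectType R) (br : V -> V -> V).

Lemma graded_einstein_iff n C e : nilpotent_lie br -> (8 <= n)%N ->
  graded br (iota 1 n) C e -> (forall k, (2 <= k < n)%N -> C 1 k = 1) ->
  (exists i j, [/\ (2 <= i)%N, (2 <= j)%N, (i + j <= n)%N & C i j != 0]) ->
  einstein_nilradical br <-> feasible (iota 1 n) (ext C).
Proof.
move=> nil n8 gr C1 Cn0.
have E a b : a \in iota 1 n -> b \in iota 1 n -> (a < b)%N -> (a + b)%N \in iota 1 n ->
    (C a b == 0) = (ext C a b == 0).
  rewrite !mem_iota1 => aD bD ab abD; have [a1|a1] := eqVneq a 1%N.
    have b2 : (2 <= b < n)%N by lia.
    have b2' : (2 <= b)%N by lia.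
    by rewrite a1 C1// ext1.
  have a2 : (2 <= a)%N by lia.
  have b2 : (2 <= b)%N by lia.
  by rewrite ext_ge2.
split=> [ein|F].
  apply: (feasible_eq0 E); apply: (einstein_feasible nil.1 gr) => //; lia.
apply: (feasible_einstein (iota_uniq 1 n) nil gr).
by apply: feasible_eq0 F => a b aD bD ab abD; rewrite E.
Qed.

Lemma g_einstein n (a : R) : nilpotent_lie br -> (8 <= n <= 11)%N ->
  lie_isom br (@g_bracket R a n) ->
  feasible (iota 1 n) (ext (alt_coef (g_coef a))) ->
  einstein_nilradical br.
Proof.
move=> nil n8 iso F; have [u gr] := iso_graded nil.1 iso.
apply/(graded_einstein_iff nil _ gr); [lia| | |exact: F].
  by move=> k /andP[k2 kn]; rewrite alt_coef_lt.
by exists 3, 4; split=> //; [lia|rewrite alt_coef_lt//= oner_eq0].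
Qed.

Lemma g_sys n (a : R) : nilpotent_lie br -> lie_isom br (@g_bracket R a n) ->
  coef_sys n (alt_coef (g_coef a)).
Proof.
move=> nil iso; have [u gr] := iso_graded nil.1 iso.
apply: (graded_coef_sys (iota_uniq 1 n) nil.1 gr) => [k|k /andP[k2 kn]].
  by rewrite mem_iota1.
by rewrite alt_coef_lt.
Qed.

Theorem classA2_einstein n : filiform br -> classA2 br n -> (8 <= n)%N ->
     (einstein_nilradical br <->
        lie_isom br (@V_bracket R n) \/
        (exists a : R, a <> -2 /\ lie_isom br (@g_bracket R a 8)) \/
        (exists a : R,
           [/\ a <> - (5 / 2), a <> -2 & lie_isom br (@g_bracket R a 9)]) \/
        (exists a : R,
           a <> - (5 / 2) /\
           [/\ a <> -2, a <> -1, a <> 1 / 2 &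
               lie_isom br (@g_bracket R a 10)]) \/
        (exists a : R,
           [/\ a <> -3, a <> - (5 / 2), a <> -1 &
               lie_isom br (@g_bracket R a 11)])).
Proof.
move=> [nil _] clA n8; have lie := nil.1.
have [e [c [gr cn0]]] := classA2_graded clA.
have sys : coef_sys n c.
  have sys' : coef_sys n (ext c).
    apply: (graded_coef_sys (iota_uniq 1 n) lie gr) => [k|k /andP[k2 kn]].
      by rewrite mem_iota1.
    by rewrite ext1.
  exact: coef_sys_eq (fun i j i2 j2 _ => ext_ge2 c i2 j2) sys'.
split=> [ein|].
  have F : feasible (iota 1 n) (ext c).
    apply: (einstein_feasible lie gr); [lia|by move=> k /andP[k2 _]; rewrite ext1| |exact: ein].
    by have [i [j [i2 j2 ij cij]]] := cn0; exists i, j; rewrite ext_ge2.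
  have b0 : c 3 4 != 0.
    apply/eqP => b0; have [a0|a0] := eqVneq (c 2 3) 0; last first.
      apply: (infeasible_m2 n8 _ _ F) => [k /andP[k2 _]|i j i3 j3 ij]; first by rewrite ext1.
      have ag := cs_case_m2 sys ltac:(lia) b0 a0.
      rewrite ext_ge2; [|lia|lia].
      rewrite ag; [|lia|lia|exact: ij].
      have i2 : (i == 2)%N = false by lia.
      have j2 : (j == 2)%N = false by lia.
      by rewrite /m2_table i2 j2 if_same mulr0.
    have [w [d [[_ w9 nw] [_ clow _ _ c2]]]] := cs_case_zero sys ltac:(lia) b0 a0 cn0.
    apply: (infeasible_high_weight w9 nw _ _ _ F) => [k /andP[k2 _]|i j i2 j2 ij|wn].
    - by rewrite ext1.
    - by rewrite ext_ge2// clow.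
    - have w2 : (2 <= w)%N by lia.
      by rewrite ext_ge2//; have [] := c2 wn.
  have [n12|n11] := leqP 12 n; first by left; exact: coef_sys_iso_V lie gr n12 sys b0.
  right; have iso := coef_sys_iso_g lie gr ltac:(lia) sys b0.
  pose k := (c 3 4)^-1; have k0 : k != 0 by rewrite invr_eq0.
  have kb : k * c 3 4 = 1 by rewrite mulVf.
  have sysk := coef_sysZ k sys.
  have Fk := (feasible_ext_scale n c k0).2 F.
  move: iso; rewrite [c 2 3 / _]mulrC -/k => iso.
  have nE : n = 8 \/ n = 9 \/ n = 10 \/ n = 11 by lia.
  have h5 : (9 <= n)%N -> k * c 2 3 - 2 <> - (5 / 2).
    move=> n9 E; have [p0 _ _] := weight9_rel sysk kb n9.
    by move/eqP: p0; apply; lra.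
  case: nE => [nE|[nE|[nE|nE]]]; rewrite nE in sysk Fk iso h5.
  - left; exists (k * c 2 3 - 2); split=> // E.
    by have /eqP := (feasible8 kb sysk).1 Fk; apply; lra.
  - right; left; exists (k * c 2 3 - 2); split=> //; first exact: h5.
    by move=> E; have /eqP := (feasible9 kb sysk).1 Fk; apply; lra.
  - right; right; left; exists (k * c 2 3 - 2).
    have /and3P[/eqP h0 /eqP h1 /eqP h2] := (feasible10 kb sysk).1 Fk.
    split; first exact: h5.
    split=> // E; [apply: h0|apply: h1|apply: h2]; lra.
  - right; right; right; exists (k * c 2 3 - 2).
    have [/eqP a1 r q0] := weight11_rel sysk isT kb isT.
    have [p0 _ r9] := weight9_rel sysk kb isT.
    split=> // E; first 1 last.
    + exact: (h5 isT).
    + by apply: a1; lra.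
    (* The value alpha = -3 makes c_45 = -3 and annihilates the factor of c_56 in weight 11. *)
    have aE : k * c 2 3 = -1 by lra.
    rewrite aE in r9 q0; move/eqP: q0; apply; lra.
case=> [iso|[[a [a2 iso]]|[[a [a5 a2 iso]]|[[a [a5 [a2 a1 ah iso]]]|[a [a3 a5 a1 iso]]]]]].
- have [u gru] := iso_graded lie iso.
  apply: (feasible_einstein (iota_uniq 1 n) nil gru); apply: feasible_full => [|x y x0 xy xyn].
    by lia.
  by rewrite alt_coef_lt// subr_eq0 eqr_nat; lia.
- apply: (g_einstein nil _ iso) => //.
  have := @feasible8 R (alt_coef (g_coef a)) erefl (g_sys nil iso) => ->.
  by rewrite alt_coef_lt//=; apply/eqP; lra.
- apply: (g_einstein nil _ iso) => //.
  have := @feasible9 R (alt_coef (g_coef a)) erefl (g_sys nil iso) => ->.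
  by rewrite alt_coef_lt//=; apply/eqP; lra.
- apply: (g_einstein nil _ iso) => //.
  have := @feasible10 R (alt_coef (g_coef a)) erefl (g_sys nil iso) => ->.
  by rewrite alt_coef_lt//=; apply/and3P; split; apply/eqP; lra.
- apply: (g_einstein nil _ iso) => //.
  exact: (@feasible11 R (alt_coef (g_coef a)) erefl (g_sys nil iso)).
Qed.
End Part1.

(** * The class B_2 *)

(** The last basis vector has degree n + 1, its eigenvalue under the degree derivation, and degree n
    is missing. The brackets [e_i, e_(n+1-i)] then respect the grading like all others. *)
Definition Bdegs (n : nat) : seq nat := rcons (iota 1 n.-1) n.+1.

Definition Bcoef (R : realType) (n : nat) (c : nat -> nat -> R) (a b : nat) : R :=
  if (a + b == n.+1)%N then (-1) ^+ a else c a b.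

Lemma mem_Bdegs n k : (k \in Bdegs n) = (0 < k <= n.-1)%N || (k == n.+1).
Proof. by rewrite mem_rcons inE mem_iota1 orbC. Qed.

Lemma Bdegs_uniq n : uniq (Bdegs n).
Proof. by rewrite rcons_uniq iota_uniq andbT mem_iota1; lia. Qed.

Lemma Bdegs_map (T : Type) n (u : nat -> T) : (0 < n)%N ->
  [seq (if a == n.+1 then u n else u a) | a <- Bdegs n] = [seq u i | i <- iota 1 n].
Proof.
move=> n0; have -> : iota 1 n = rcons (iota 1 n.-1) n.
  by have := iotaD 1 n.-1 1; rewrite addn1 prednK// add1n prednK// cats1.
rewrite !map_rcons eqxx; congr rcons; apply/eq_in_map => a; rewrite mem_iota1 => an.
by have -> : (a == n.+1) = false by lia.
Qed.

Lemma sign_reflect (R : pzRingType) n i : ~~ odd n -> (i <= n.+1)%N ->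
  (-1) ^+ (n.+1 - i) = - (-1) ^+ i :> R.
Proof.
by move=> ne iN; rewrite -signr_odd oddB //= ne -[in RHS]signr_odd; case: odd; rewrite ?opprK.
Qed.

Section ClassB2.
Variables (R : realType) (V : vectType R) (br : V -> V -> V) (n : nat).
Hypotheses (lie : is_lie br) (n6 : (6 <= n)%N) (ne : ~~ odd n).

Lemma central_sc_sum (g : nat -> nat -> R) (u : nat -> V) i j : (0 < i)%N ->
  \sum_(k <- iota 1 n) central_sc n g i j k *: u k =
  if (i + j <= n.-1)%N then g i j *: u (i + j)%N
  else if (2 <= i)%N && (i + j == n.+1)%N then (-1) ^+ i *: u n else 0.
Proof.
move=> i0; have nD : n \in iota 1 n by rewrite mem_iota1; lia.
rewrite (bigD1_seq n) ?iota_uniq//= {1}/central_sc eqxx.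
have [ijn|nij] := leqP (i + j) n.-1.
  have -> : (i + j == n.+1)%N = false by lia.
  have ijD : (i + j)%N \in iota 1 n by rewrite mem_iota1; lia.
  have ijn' : (i + j)%N != n by lia.
  rewrite andbF scale0r add0r big_mkcond (bigD1_seq (i + j)%N) ?iota_uniq//= ijn'.
  rewrite /central_sc (negPf ijn') /graded_sc eqxx big1 ?addr0// => k /negPf kij.
  by case: ifP => // /negPf kn; rewrite kn kij scale0r.
rewrite [X in _ + X]big1_seq ?addr0; first by case: ifP; rewrite ?scale0r.
move=> k /andP[kn]; rewrite mem_iota1 => kD; rewrite /central_sc (negPf kn) /graded_sc.
have -> : (k == i + j)%N = false by lia.
by rewrite scale0r.
Qed.

Lemma sc_basis_B2 (g : nat -> nat -> R) (u : nat -> V) :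
  sc_basis br n (central_sc n g) u ->
  (forall j, (2 <= j <= n.-2)%N -> g 1 j = 1) ->
  (exists i j, [/\ (2 <= i)%N, (i < j)%N, (i + j <= n.-1)%N & g i j != 0]) ->
  classB2 br n.
Proof.
move=> [ub ubr] g1 [i0 [j0 [i02 ij0 ijn0 gn0]]]; split=> //; split=> //; split=> //.
exists u, (alt_coef g); split=> //; split; last first.
  exists i0, j0; rewrite alt_coef_lt//; split=> //; first by lia.
  exact/eqP.
have H i j : (0 < i)%N -> (i < j)%N -> (j <= n)%N -> br (u i) (u j) =
  if (i + j <= n.-1)%N then g i j *: u (i + j)%N
  else if (2 <= i)%N && (i + j == n.+1)%N then (-1) ^+ i *: u n else 0.
  by move=> i1 ij jn; rewrite ubr// central_sc_sum.
split.
- move=> i i2 iN; rewrite H//; [|lia].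
  have -> : (1 + i <= n.-1)%N by lia.
  have i2n : (2 <= i <= n.-2)%N by lia.
  by rewrite g1// scale1r add1n.
- move=> i iN; rewrite H//; [|lia|lia].
  by have -> : (1 + i <= n.-1)%N = false by lia.
- move=> i j i2 j2 ij; rewrite /alt_coef; case: ltngtP => ij'.
  + by rewrite H//; [rewrite ij|lia|lia].
  + rewrite (lie_anti lie) H//; [|lia|lia].
    by rewrite addnC ij scaleNr.
  + by rewrite ij' (lie_alt lie) scale0r.
- move=> i i2 iN; case: (ltngtP i (n.+1 - i)) => ij'.
  + rewrite H//; [|lia|lia].
    have -> : (i + (n.+1 - i) <= n.-1)%N = false by lia.
    by have -> : (2 <= i)%N && (i + (n.+1 - i) == n.+1)%N by lia.
  + rewrite (lie_anti lie) H//; [|lia|lia].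
    have -> : (n.+1 - i + i <= n.-1)%N = false by lia.
    have -> : (2 <= n.+1 - i)%N && (n.+1 - i + i == n.+1)%N by lia.
    rewrite -scaleNr; congr (_ *: _).
    by rewrite sign_reflect ?opprK//; lia.
  + by move: ne; lia.
- move=> i j iN jN ijn ijn1; wlog ij : i j iN jN ijn ijn1 / (i <= j)%N.
    move=> Hw; have [|ji] := leqP i j; first exact: Hw.
    by rewrite (lie_anti lie) Hw ?oppr0//; lia.
  have [->|ij'] := eqVneq i j; first exact: lie_alt lie _.
  rewrite H//; [|lia|lia|lia].
  have -> : (i + j <= n.-1)%N = false by lia.
  by have -> : (2 <= i)%N && (i + j == n.+1)%N = false by lia.
Qed.

Lemma classB2_graded : classB2 br n ->
  exists e c, graded br (Bdegs n) (Bcoef n (ext c)) e /\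
    exists i j, [/\ (2 <= i)%N, (2 <= j)%N, (i + j <= n.-1)%N & c i j != 0].
Proof.
move=> [_ [_ [_ [u [c [ub [[u1 un uc uB u0] [i [j [i2 j2 ij cij]]]]]]]]]].
pose e a := if a == n.+1 then u n else u a.
exists e, c; split; last by exists i, j; split=> //; exact/eqP.
have n0 : (0 < n)%N by lia.
split; first by rewrite Bdegs_map.
move=> a b; rewrite !mem_Bdegs /Bcoef => aD bD.
have H y : (0 < y <= n.-1)%N || (y == n.+1) ->
   br (e 1%N) (e y) = if (0 < 1 + y <= n.-1)%N || (1 + y == n.+1)%N then
     ext c 1 y *: e (1 + y)%N else 0.
  move=> yD; have -> : (1 + y == n.+1)%N = false by lia.
  have [->|y1] := eqVneq y 1%N.
    by rewrite (lie_alt lie) /ext /= scale0r if_same.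
  have y2 : (2 <= y)%N by lia.
  have -> : e 1%N = u 1%N by rewrite /e; have -> : (1 == n.+1)%N = false by lia.
  have [yn|yn] := leqP (1 + y) n.-1; last first.
    rewrite andbF /= /e; case: ifP => [_|yn1]; apply: un; lia.
  have yn' : (y <= n.-2)%N by lia.
  rewrite /e; have -> : (y == n.+1)%N = false by lia.
  have -> : (1 + y == n.+1)%N = false by lia.
  by rewrite ext1// u1// scale1r.
have [a1|a1] := eqVneq a 1%N.
  rewrite a1 H//; have bn : (1 + b == n.+1)%N = false by lia.
  by rewrite bn.
have [b1|b1] := eqVneq b 1%N.
  have an : (a + 1 == n.+1)%N = false by lia.
  rewrite b1 an (lie_anti lie) H// [(1 + a)%N]addnC an; case: ifP => // _; last by rewrite oppr0.
  rewrite -scaleNr; congr (_ *: _).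
  have a2 : (2 <= a)%N by lia.
  by rewrite ext1// /ext (negPf a1).
have a2 : (2 <= a)%N by lia.
have b2 : (2 <= b)%N by lia.
rewrite ext_ge2//; have [abn|nab] := leqP (a + b) n.-1.
  have -> : (0 < a + b)%N by lia.
  rewrite /e /=.
  have -> : (a == n.+1) = false by lia.
  have -> : (b == n.+1) = false by lia.
  have -> : (a + b == n.+1)%N = false by lia.
  exact: uc.
rewrite andbF /=; case: eqP => abE.
  rewrite /e abE eqxx.
  have -> : (a == n.+1) = false by lia.
  have -> : (b == n.+1) = false by lia.
  have -> : b = (n.+1 - a)%N by lia.
  by apply: uB; lia.
rewrite /e; case: (eqVneq a n.+1) => [a3|a3]; case: (eqVneq b n.+1) => [b3|b3].
- exact: lie_alt lie _.
- by apply: u0; lia.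
- by apply: u0; lia.
- by apply: u0; lia.
Qed.

Lemma graded_central_sc (C : nat -> nat -> R) (g : nat -> nat -> R) (e : nat -> V) :
  graded br (Bdegs n) C e ->
  (forall i j, (0 < i)%N -> (i < j)%N -> (i + j <= n.-1)%N -> C i j = g i j) ->
  (forall i j, (2 <= i)%N -> (i < j)%N -> (i + j)%N = n.+1 -> C i j = (-1) ^+ i) ->
  sc_basis br n (central_sc n g) (fun k => if k == n then e n.+1 else e k).
Proof.
move=> [eb ebr] Cg CB; pose u k := if k == n then e n.+1 else e k; split.
  have -> : [seq u i | i <- iota 1 n] = [seq e a | a <- Bdegs n] => //.
  rewrite -Bdegs_map; [|lia]; apply/eq_in_map => a; rewrite mem_Bdegs /u eqxx => aD.
  case: eqP => [->//|an1].
  by have -> : (a == n) = false by lia.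
move=> i j i0 ij jn; rewrite central_sc_sum// -/(u i) -/(u j) -/(u (i + j)%N) -/(u n).
have inn : (i == n) = false by lia.
have iD : i \in Bdegs n by rewrite mem_Bdegs; lia.
rewrite {1 2}/u inn; case: eqP => jn'.
  rewrite ebr//; last by rewrite mem_Bdegs eqxx orbT.
  rewrite mem_Bdegs.
  have -> : (0 < i + n.+1 <= n.-1)%N || (i + n.+1 == n.+1)%N = false by lia.
  have -> : (i + j <= n.-1)%N = false by lia.
  by have -> : (2 <= i)%N && (i + j == n.+1)%N = false by lia.
rewrite ebr//; last by rewrite mem_Bdegs; lia.
rewrite mem_Bdegs; have -> : (0 < i + j)%N by lia.
have [abn|nab] := leqP (i + j) n.-1.
  rewrite /u Cg//.
  by have -> : (i + j == n)%N = false by lia.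
rewrite /=; case: eqP => ijE; last by rewrite andbF.
have i2 : (2 <= i)%N by lia.
by rewrite i2 CB// ijE /u eqxx.
Qed.
End ClassB2.

Lemma central_sc_graded (R : realType) (V : vectType R) (br : V -> V -> V) n
  (g : nat -> nat -> R) (u : nat -> V) :
  (6 <= n)%N -> ~~ odd n -> (forall x, br x x = 0) -> (forall x y, br x y = - br y x) ->
  sc_basis br n (central_sc n g) u ->
  graded br (Bdegs n) (Bcoef n (alt_coef g)) (fun a => if a == n.+1 then u n else u a).
Proof.
move=> n6 ne alt anti [ub ubr]; pose e a := if a == n.+1 then u n else u a.
have H a b : a \in Bdegs n -> b \in Bdegs n -> (a < b)%N -> br (e a) (e b) =
  if (a + b)%N \in Bdegs n then Bcoef n (alt_coef g) a b *: e (a + b)%N else 0.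
  rewrite !mem_Bdegs /Bcoef => aD bD ab.
  have an : (a == n.+1) = false by lia.
  have a0 : (0 < a)%N by lia.
  rewrite /e an; case: eqP => bn.
    have abD : (0 < a + b <= n.-1)%N || (a + b == n.+1)%N = false by lia.
    rewrite abD ubr//; [|lia]; rewrite central_sc_sum//.
    have -> : (a + n <= n.-1)%N = false by lia.
    by have -> : (2 <= a)%N && (a + n == n.+1)%N = false by lia.
  rewrite ubr//; [|lia]; rewrite central_sc_sum//.
  have [abn|nab] := leqP (a + b) n.-1.
    have abn1 : (a + b == n.+1)%N = false by lia.
    have ab0 : (0 < a + b)%N by lia.
    by rewrite ab0 abn1 alt_coef_lt.
  rewrite andbF /=; case: eqP => abE; last by rewrite andbF.
  by have -> : (2 <= a)%N by lia.
split; first by rewrite Bdegs_map//; lia.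
move=> a b aD bD; rewrite -/(e a) -/(e b) -/(e (a + b)%N).
case: (ltngtP a b) => ab; first exact: H.
  rewrite anti H// [(b + a)%N]addnC; case: ifP => abD; last by rewrite oppr0.
  rewrite -scaleNr /Bcoef [(b + a)%N]addnC; congr (_ *: _); case: eqP => abE.
    have -> : b = (n.+1 - a)%N by lia.
    by rewrite sign_reflect ?opprK//; lia.
  have ba : (a < b)%N = false by lia.
  by rewrite /alt_coef ab ba.
rewrite ab alt /Bcoef /alt_coef ltnn.
have -> : (b + b == n.+1)%N = false by lia.
by rewrite scale0r if_same.
Qed.

(* Jacobi for e_2, e_3, e_(m-3), whose bracket has weight m + 2 = n + 1. *)
Lemma central_rel_bound (R : realType) m (c : nat -> nat -> R) : (7 <= m)%N -> odd m ->
  coef_sys m c ->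
  (exists i j, [/\ (2 <= i)%N, (2 <= j)%N, (i + j <= m)%N & c i j != 0]) ->
  c 3 (m - 3)%N + c 2 (m - 3)%N + c 2 3 = 0 ->
  c 3 4 != 0 /\ (m <= 11)%N.
Proof.
move=> m7 mo sys cn0 rel; have b0 : c 3 4 != 0.
  apply/eqP => b0; have [a0|a0] := eqVneq (c 2 3) 0; last first.
    have ag := cs_case_m2 sys m7 b0 a0.
    have e2 := ag 2 (m - 3)%N isT ltac:(lia) ltac:(lia).
    have e3 := ag 3 (m - 3)%N isT ltac:(lia) ltac:(lia).
    have m32 : (2 == m - 3)%N = false by lia.
    have m33 : (3 == m - 3)%N = false by lia.
    have m3' : (m - 3 == 2)%N = false by lia.
    move: rel; rewrite e2 e3 /m2_table m32 m33 m3' /= mulr0 mulr1 => rel.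
    by move/eqP: a0; apply; lra.
  have [w [d [[wo w9 mw] [d0 clow cw c2 c3]]]] := cs_case_zero sys m7 b0 a0 cn0.
  (* Both w and m are odd, so w = m - 1 does not occur. *)
  have [wE|wE] : w = m \/ w.+2 = m by lia.
    have e3 := cw 3 (m - 3)%N isT ltac:(lia) ltac:(lia).
    have e2 := clow 2 (m - 3)%N isT ltac:(lia) ltac:(lia).
    by move: rel; rewrite e3 e2 a0 => rel; move/eqP: d0; apply; lra.
  have wm : (w < m)%N by lia.
  have wm2 : (w + 2 <= m)%N by lia.
  have e2 := c2 wm; have [_ e3] := c3 wm2.
  have mE : (m - 3 = w - 1)%N by lia.
  move: rel; rewrite mE e3 e2 a0 => rel.
  have : ((w - 3)./2)%:R * d != 0 by rewrite mulf_neq0// pnatr_eq0; lia.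
  by move/eqP; apply; lra.
split=> //; rewrite leqNgt; apply/negP => m12.
have [a0 ag] := cs_case_witt sys m12 b0.
have wpos i j : (i < j)%N -> 0 < witt_coef R i j.
  move=> ij; rewrite /witt_coef !mulr_gt0 ?invr_gt0 ?ltr0n ?fact_gt0//.
  by rewrite subr_gt0 ltr_nat.
have e2 := ag 2 (m - 3)%N isT ltac:(lia) ltac:(lia).
have e3 := ag 3 (m - 3)%N isT ltac:(lia) ltac:(lia).
have := wpos 2 (m - 3)%N ltac:(lia); have := wpos 3 (m - 3)%N ltac:(lia).
move: (witt_coef R 2 _) (witt_coef R 3 _) e2 e3 rel => x y -> -> rel y0 x0.
(* For the constants of V(n) the relation reads c_23 times a sum of positive numbers. *)
have : c 2 3 * (y + x + 1) == 0 by rewrite !mulrDr mulr1 rel.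
by rewrite mulf_eq0 (negPf a0) /= gt_eqF// !addr_gt0.
Qed.

Lemma central_rel8 (R : realType) (c : nat -> nat -> R) : coef_sys 7 c ->
  c 3 4 = 1 -> c 3 4 + c 2 4 + c 2 3 = 0 -> c 2 3 - 2 = - (5 / 2).
Proof.
by move=> sys b1; rewrite b1 (cs_weight6 sys)//; lra.
Qed.

(** The relation is c_45 = 2 c_23 - 1; with c_45 (2 c_23 + 1) = 3 from weight 9 it becomes c_23^2 =
    1. *)
Lemma central_rel10 (R : realType) (c : nat -> nat -> R) : coef_sys 9 c ->
  c 3 4 = 1 -> c 3 6 + c 2 6 + c 2 3 = 0 -> c 2 3 - 2 = -1 \/ c 2 3 - 2 = -3.
Proof.
move=> sys b1 rel; have r9 := cs_rel9 sys isT.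
have [_ e36] := cs_weight9 sys isT; have [e26 _] := cs_weight8 sys isT.
rewrite e36 e26 b1 in rel; rewrite b1 in r9.
have E : (c 2 3 - 1) * (c 2 3 + 1) = 0.
  have uE : c 4 5 = 2 * c 2 3 - 1 by lra.
  by move: r9; rewrite uE => r9; lra.
by move/eqP: E; rewrite mulf_eq0 => /orP[] /eqP h; [left|right]; lra.
Qed.

(** The relation is c_56 = 3 - 2 a. Inserting it and c_45 = 3 / (2 a + 1) into the relation of
    weight 11 leaves (2 a^2 - 5) (4 a^2 - 4 a + 3) = 0, whose second factor has no real zero. *)
Lemma central_rel12 (R : realType) (c : nat -> nat -> R) : coef_sys 11 c ->
  c 3 4 = 1 -> c 3 8 + c 2 8 + c 2 3 = 0 ->
  c 2 3 - 2 = (-4 + Num.sqrt 10) / 2 \/ c 2 3 - 2 = (-4 - Num.sqrt 10) / 2.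
Proof.
move=> sys b1 rel; have r9 := cs_rel9 sys isT; have r11 := cs_rel11 sys isT.
have [_ e38 _] := cs_weight11 sys isT; have [e28 _ _] := cs_weight10 sys isT.
rewrite e38 e28 b1 in rel; rewrite b1 in r9 r11; rewrite expr1n mulr1 in r9.
set a := c 2 3 in rel r9 r11 *; set u := c 4 5 in rel r9 r11 *.
have wE : c 5 6 = 3 - 2 * a by lra.
rewrite wE in r11.
have E : (2 * a ^+ 2 - 5) * (4 * a ^+ 2 - 4 * a + 3) = 0.
  have p0 : 2 * a + 1 != 0.
    by apply/eqP => p0; move/eqP: r9; rewrite p0 mulr0 eq_sym pnatr_eq0.
  have uE : u = 3 / (2 * a + 1) by rewrite -r9 mulfK.
  have -> : (2 * a ^+ 2 - 5) * (4 * a ^+ 2 - 4 * a + 3) =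
    - (2 * a + 1) ^+ 2 / 2 * ((3 - 2 * a) * (2 * a - 1 - u) - (4 * 1 * u - 6 * u ^+ 2)).
    by rewrite uE; field.
  by rewrite r11 subrr mulr0.
have q0 : 4 * a ^+ 2 - 4 * a + 3 != 0.
  have -> : 4 * a ^+ 2 - 4 * a + 3 = (2 * a - 1) ^+ 2 + 2 by ring.
  rewrite gt_eqF//.
  by rewrite ltr_wpDl ?sqr_ge0.
move: E => /eqP; rewrite mulf_eq0 (negPf q0) orbF => /eqP E.
have s2 : Num.sqrt 10 ^+ 2 = 10 :> R by rewrite sqr_sqrtr.
have : (2 * a - Num.sqrt 10) * (2 * a + Num.sqrt 10) = 0.
  by rewrite -subr_sqr exprMn s2; lra.
by move/eqP; rewrite mulf_eq0 => /orP[] /eqP h; [left|right]; lra.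
Qed.

Section ClassB2.
Variables (R : realType) (V : vectType R) (br : V -> V -> V) (n : nat).
Hypotheses (lie : is_lie br) (n6 : (6 <= n)%N) (ne : ~~ odd n).
Variables (e : nat -> V) (c : nat -> nat -> R).
Hypothesis gr : graded br (Bdegs n) (Bcoef n (ext c)) e.

Lemma Bcoef_sys : coef_sys n.-1 c.
Proof.
have sys : coef_sys n.-1 (Bcoef n (ext c)).
  apply: (graded_coef_sys (Bdegs_uniq n) lie gr) => [k|k kn].
    by rewrite mem_Bdegs => ->.
  have kE : (1 + k == n.+1)%N = false by lia.
  by rewrite /Bcoef kE ext1//; case/andP: kn.
apply: coef_sys_eq sys => i j i2 j2 ij.
have ijE : (i + j == n.+1)%N = false by lia.
by rewrite /Bcoef ijE ext_ge2.
Qed.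

(** In weight n + 1 all constants are alternating signs. The Jacobi identity of e_2, e_3, e_(n-4)
    therefore holds only if the very sum that [agree_odd] requires to be nonzero vanishes. *)
Lemma central_rel : (8 <= n)%N -> c 3 (n - 4)%N + c 2 (n - 4)%N + c 2 3 = 0.
Proof.
move=> n8; have inD k : (0 < k <= n.-1)%N -> k \in Bdegs n by rewrite mem_Bdegs => ->.
have sys := Bcoef_sys.
have := graded_jacobi (a := 2) (b := 3) (c := (n - 4)%N) (Bdegs_uniq n) gr lie.
have d1 : 2%N \in Bdegs n by apply: inD; lia.
have d2 : 3%N \in Bdegs n by apply: inD; lia.
have d3 : (n - 4)%N \in Bdegs n by apply: inD; lia.
have d4 : (3 + (n - 4))%N \in Bdegs n by apply: inD; lia.
have d5 : ((n - 4) + 2)%N \in Bdegs n by apply: inD; lia.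
have d6 : (2 + 3)%N \in Bdegs n by apply: inD; lia.
have d7 : (2 + 3 + (n - 4))%N \in Bdegs n by rewrite mem_Bdegs; lia.
move=> /(_ d1 d2 d3 d4 d5 d6 d7).
have d3' : (2 <= n - 4)%N by lia.
have d6' : (2 + 3 <= n.-1)%N by lia.
have H i j : (2 <= i)%N -> (2 <= j)%N -> (i + j <= n.-1)%N -> Bcoef n (ext c) i j = c i j.
  move=> i2 j2 ij; have ijE : (i + j == n.+1)%N = false by lia.
  by rewrite /Bcoef ijE ext_ge2.
have H1 i j : (i + j)%N = n.+1 -> Bcoef n (ext c) i j = (-1) ^+ i.
  by rewrite /Bcoef => ->; rewrite eqxx.
have h1 : (2 + (3 + (n - 4)) = n.+1)%N by lia.
have h2 : (3 + (n - 4 + 2) = n.+1)%N by lia.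
have h3 : (n - 4 + (2 + 3) = n.+1)%N by lia.
rewrite (H1 _ _ h1) (H1 _ _ h2) (H1 _ _ h3) (H 2 3 isT isT d6').
rewrite (H 3 (n - 4)%N isT d3' ltac:(lia)) (H (n - 4)%N 2 d3' isT ltac:(lia)).
rewrite (cs_anti sys (i := 2) (j := (n - 4)%N) isT d3' ltac:(lia)).
have -> : (-1) ^+ (n - 4) = 1 :> R by rewrite -signr_odd oddB ?(negPf ne)//; lia.
by move=> h; rewrite -[RHS]h; ring.
Qed.

Lemma classB2_iso (g : nat -> nat -> R) k : k != 0 ->
  (forall j, (2 <= j <= n.-2)%N -> g 1 j = 1) ->
  (forall i j, (2 <= i)%N -> (i < j)%N -> (i + j <= n.-1)%N -> k * c i j = g i j) ->
  lie_isom br (@sc_bracket R n (central_sc n g)).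
Proof.
(* Scaling e_2, ..., e_(n-1) by k multiplies the c_ij by k; the central vector takes k^2, so that
   the signs in [e_i, e_(n+1-i)] are unchanged. *)
move=> k0 g1 cg; pose t a : R := if a == 1%N then 1 else if a == n.+1 then k ^+ 2 else k.
have t0 a : t a != 0.
  by rewrite /t; case: ifP => _; [exact: oner_neq0|case: ifP => _//; rewrite expf_neq0].
have gr' := graded_rescale (Bdegs_uniq n) gr lie (fun a _ => t0 a).
apply: sc_basis_iso lie _; apply: (graded_central_sc n6 ne gr') => i j i0 ij ijn.
  have ijE : (i + j == n.+1)%N = false by lia.
  have jn : (j == n.+1)%N = false by lia.
  have iN : (i == n.+1)%N = false by lia.
  have ij1 : (i + j == 1)%N = false by lia.
  have j1 : (j == 1)%N = false by lia.
  have [i1|i1] := eqVneq i 1%N.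
    have j2 : (2 <= j <= n.-2)%N by lia.
    have [j2' _] := andP j2.
    rewrite i1 in ijE ij1 *.
    by rewrite /t /Bcoef ijE jn eqxx j1 ij1 ext1// mul1r mulr1 divff// g1.
  have i2 : (2 <= i)%N by lia.
  have j2 : (2 <= j)%N by lia.
  by rewrite /t /Bcoef ijE jn iN (negPf i1) j1 ij1 mulfK// ext_ge2// cg.
have jn : (j == n.+1)%N = false by lia.
have iN : (i == n.+1)%N = false by lia.
have i1 : (i == 1)%N = false by lia.
have j1 : (j == 1)%N = false by lia.
have n1 : (n.+1 == 1)%N = false by lia.
rewrite /t /Bcoef ijn eqxx jn iN i1 j1 n1.
by rewrite expr2 divff ?mul1r// mulf_neq0.
Qed.

Lemma classB2_iso_b :
  (exists i j, [/\ (2 <= i)%N, (2 <= j)%N, (i + j <= n.-1)%N & c i j != 0]) ->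
  exists b : b_algebra, lie_isom br (@b_bracket R b).
Proof.
move=> cn0; have sys := Bcoef_sys; have [n8|n7] := leqP 8 n; last first.
  (* In dimension 6 the only constant up to skew-symmetry is c_23, and normalising it to 1 is all
     that remains. *)
  have nE : n = 6 by lia.
  have a0 : c 2 3 != 0.
    have [i [j [i2 j2 ij cij]]] := cn0; rewrite nE /= in ij sys.
    have [[iE jE]|[[iE jE]|[iE jE]]] : (i = 2 /\ j = 2) \/ (i = 2 /\ j = 3) \/ (i = 3 /\ j = 2) by lia.
    - by move: cij; rewrite iE jE (cs_diag sys)// eqxx.
    - by rewrite iE jE in cij.
    - by move: cij; rewrite iE jE (cs_anti sys)// oppr_eq0.
  exists B6; move: (@classB2_iso (@m2_coef R) (c 2 3)^-1); rewrite /b_bracket /b_dim nE; apply.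
  - by rewrite invr_eq0.
  - by move=> j.
  - move=> i j i2 ij ijn; have [-> ->] : i = 2 /\ j = 3 by lia.
    by rewrite mulVf.
have rel := central_rel n8.
have mE : (n.-1 - 3 = n - 4)%N by lia.
have [b0 n12] : c 3 4 != 0 /\ (n.-1 <= 11)%N.
  by apply: central_rel_bound => //; [lia|move: ne; lia|rewrite mE].
pose k := (c 3 4)^-1; have k0 : k != 0 by rewrite invr_eq0.
have kb : k * c 3 4 = 1 by rewrite mulVf.
have sysk := coef_sysZ k sys.
have iso al : k * c 2 3 - 2 = al -> lie_isom br (@sc_bracket R n (central_sc n (g_coef al))).
  move=> alE; apply: (classB2_iso k0) => //.
  by apply: (coef_sys_g sysk) => //; lia.
have relk : k * c 3 (n - 4)%N + k * c 2 (n - 4)%N + k * c 2 3 = 0.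
  by rewrite -!mulrDr rel mulr0.
have [nE|[nE|nE]] : n = 8 \/ n = 10 \/ n = 12 by move: ne; lia.
- rewrite nE in sysk relk iso; exists B8; apply: iso.
  exact: central_rel8 sysk kb relk.
- rewrite nE in sysk relk iso.
  case: (central_rel10 sysk kb relk) => h; [exists B10_1|exists B10_2]; exact: iso.
- rewrite nE in sysk relk iso.
  case: (central_rel12 sysk kb relk) => h; [exists B12_plus|exists B12_minus]; exact: iso.
Qed.
End ClassB2.

(** * The six algebras: Jacobi identities and Einstein metrics *)

Definition triples (D : seq nat) : seq (nat * nat * nat) :=
  [seq t <- [seq (p, c) | p <- [seq (a, b) | a <- D, b <- D], c <- D] |
    [&& t.1.1 < t.1.2, t.1.2 < t.2 & (t.1.1 + t.1.2 + t.2)%N \in D]%N].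

Definition jacobi_sum (R : realType) (D : seq nat) (C : nat -> nat -> R) (a b c : nat) : R :=
  (if (b + c)%N \in D then C b c * C a (b + c)%N else 0) +
  (if (c + a)%N \in D then C c a * C b (c + a)%N else 0) +
  (if (a + b)%N \in D then C a b * C c (a + b)%N else 0).

Lemma sc_antisym (R : realType) n s (x y : 'rV[R]_n) : sc_bracket s x y = - sc_bracket s y x.
Proof.
have := sc_alt s (x + y); rewrite (linear_funD _ _ (sc_linearr s _)) !(linear_funD _ _ (sc_linearl s _)).
by rewrite !sc_alt add0r addr0 => /eqP; rewrite addr_eq0 => /eqP ->; rewrite opprK.
Qed.

Section CentralExtension.
Variables (R : realType) (n : nat) (g : nat -> nat -> R).
Hypotheses (n6 : (6 <= n)%N) (ne : ~~ odd n).
Local Notation sc := (@sc_bracket R n (central_sc n g)).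
Local Notation C := (Bcoef n (alt_coef g)).

Lemma central_graded : exists e, graded sc (Bdegs n) C e.
Proof.
have [u ub] := iso_sc_basis (lie_isom_refl sc); exists (fun a => if a == n.+1 then u n else u a).
by apply: central_sc_graded => //; [exact: sc_alt|exact: sc_antisym].
Qed.

Lemma central_nilpotent :
  (forall t, t \in triples (Bdegs n) -> jacobi_sum (Bdegs n) C t.1.1 t.1.2 t.2 = 0) ->
  nilpotent_lie sc.
Proof.
move=> jac; have [e gr] := central_graded.
apply: (graded_nilpotent (Bdegs_uniq n) gr); last by move=> a; rewrite mem_Bdegs; lia.
apply: (graded_is_lie (Bdegs_uniq n) gr).
- exact: sc_linearl.
- exact: sc_linearr.
- exact: sc_alt.
- move=> a b; rewrite !mem_Bdegs /Bcoef addnC => aD bD; case: eqP => abE.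
    have -> : b = (n.+1 - a)%N by lia.
    by rewrite sign_reflect//; lia.
  by rewrite /alt_coef; case: ltngtP; rewrite ?opprK ?oppr0.
- move=> a b c aD bD cD ab bc abcD; apply: (jac (a, b, c)).
  rewrite mem_filter /= ab bc abcD /=; apply/allpairsP; exists (a, b, c); split=> //=.
  by apply/allpairsP; exists (a, b).
Qed.
End CentralExtension.

(** Membership in a computed list becomes a conjunction, which can be split into one goal per
    element. *)
Lemma in_seq_ind (T : eqType) (P : T -> Prop) s :
  foldr (fun t Q => P t /\ Q) True s -> forall t, t \in s -> P t.
Proof. by elim: s => //= x s IH [Px /IH H] t; rewrite inE => /orP[/eqP ->|/H]. Qed.

Ltac jacobi_cases n :=
  apply: in_seq_ind;
  let s := eval vm_compute in (triples (Bdegs n)) in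
  have -> : triples (Bdegs n) = s by [];
  do ?[split; first rewrite /= /jacobi_sum !mem_Bdegs /Bcoef /alt_coef !addnS !addn0 /=];
  try exact: I.

Section Nilpotent.
Variable R : realType.

Section B12.
Variable a : R.
Hypothesis aE : 2 * a ^+ 2 + 8 * a + 3 = 0.

(** Both parameters of dimension 12 are roots of this quadratic. Computing modulo it reduces powers
    of a and the inverse of 2 a + 5 to linear expressions in a, which treats the two conjugate
    algebras at once. *)
Lemma b12_sqr : a ^+ 2 = - 4 * a - 3 / 2.
Proof. by have := aE; lra. Qed.

Lemma b12_cube : a ^+ 3 = (29 * a + 12) / 2.
Proof. by rewrite exprS b12_sqr; have := aE; nra. Qed.

Lemma b12_q : 2 * (a ^+ 2 + 4 * a + 3) = 3.
Proof. by have := aE; lra. Qed.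

Lemma b12_d : (2 * a + 5)^-1 = (2 * a + 3) / 9.
Proof.
have d0 : 2 * a + 5 != 0.
  apply/eqP => d0; have aE' : a = - (5 / 2) by lra.
  by have := aE; rewrite aE'; lra.
by apply: (mulfI d0); rewrite divff//; have := aE; lra.
Qed.

Definition b12E := (invfM, b12_d, b12_cube, b12_sqr).

Lemma b12_nilpotent : nilpotent_lie (@sc_bracket R 12 (central_sc 12 (g_coef a))).
Proof.
have a2 := b12_sqr; have a3 := b12_cube.
by apply: central_nilpotent => //; jacobi_cases 12%N; rewrite /g_coef ?b12_q ?b12E; lra.
Qed.

(** Enclosures of the two roots, narrow enough to show that none of the reduced coefficients
    vanishes. *)
Lemma b12_range : (- (43 / 100) < a < - (41 / 100)) || (- (359 / 100) < a < - (358 / 100)).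
Proof.
have a2 := b12_sqr.
have E : (a + 2 - 158 / 100) * (a + 2 + 158 / 100) > 0 by nra.
have F : (a + 2 - 159 / 100) * (a + 2 + 159 / 100) < 0 by nra.
have [s0|s0] := leP (a + 2) 0; apply/orP; [right|left]; apply/andP; split; nra.
Qed.
End B12.

Lemma b12_root (s : R) : s ^+ 2 = 10 ->
  2 * ((-4 + s) / 2) ^+ 2 + 8 * ((-4 + s) / 2) + 3 = 0.
Proof. by move=> s2; rewrite exprMn sqrrD s2 exprVn; lra. Qed.

Lemma b_nilpotent b : nilpotent_lie (@b_bracket R b).
Proof.
case: b.
- apply: central_nilpotent => //; jacobi_cases 6%N; rewrite /m2_coef; lra.
- apply: central_nilpotent => //; jacobi_cases 8%N; rewrite /g_coef; by field.
- apply: central_nilpotent => //; jacobi_cases 10%N; rewrite /g_coef; by field.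
- apply: central_nilpotent => //; jacobi_cases 10%N; rewrite /g_coef; by field.
- by apply/b12_nilpotent/b12_root; rewrite sqr_sqrtr.
- by apply/b12_nilpotent; apply: (@b12_root (- Num.sqrt 10)); rewrite sqrrN sqr_sqrtr.
Qed.
End Nilpotent.

Lemma central_einstein (R : realType) n (g : nat -> nat -> R) Z t s mu :
  (6 <= n)%N -> ~~ odd n -> nilpotent_lie (@sc_bracket R n (central_sc n g)) ->
  table_check (Bdegs n) Z (table_entry t) s mu ->
  all (fun p : nat * nat => p.1 + p.2 != n.+1)%N Z ->
  (forall a b, (0 < a)%N -> (a < b)%N -> (a + b <= n.-1)%N -> (g a b == 0) = ((a, b) \in Z)) ->
  einstein_nilradical (@sc_bracket R n (central_sc n g)).
Proof.
move=> n6 ne nil tab Zn gZ; have [e gr] := central_graded g n6 ne.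
apply: (feasible_einstein (Bdegs_uniq n) nil gr); apply: (table_feasible tab) => a b.
rewrite !mem_Bdegs /pairs mem_Bdegs /Bcoef => aD bD /andP[ab abD].
have [abE|abE] := eqVneq (a + b)%N n.+1.
  rewrite signr_eq0; apply/esym/negP => /(allP Zn) /=.
  by rewrite abE eqxx.
by rewrite alt_coef_lt// gZ//; lia.
Qed.

Lemma pairs1_upto11 (P : nat -> nat -> Prop) n : (n <= 11)%N ->
  (forall k, (2 <= k)%N -> (k < n)%N -> P 1%N k) ->
  (forall p, p \in [:: (2, 3); (2, 4); (2, 5); (2, 6); (2, 7); (2, 8); (2, 9);
       (3, 4); (3, 5); (3, 6); (3, 7); (3, 8); (4, 5); (4, 6); (4, 7); (5, 6)]%N ->
     (p.1 + p.2 <= n)%N -> P p.1 p.2) ->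
  forall a b, (0 < a)%N -> (a < b)%N -> (a + b <= n)%N -> P a b.
Proof.
move=> n11 P1 HP a b a0 ab abn; have [a1|a1] := eqVneq a 1%N.
  by rewrite a1; apply: P1; lia.
by apply: (pairs_upto11 n11 HP) => //; lia.
Qed.

Definition b_zeros (b : b_algebra) : seq (nat * nat) :=
  if b is B10_1 then [:: (2, 5); (3, 6)]%N else [::].

(** All constants of both algebras of dimension 12 are nonzero, so one solution serves both. *)
Definition b12_table : seq (seq nat) :=
  [:: [::]; [:: 0;0;101;30;30;117;198;30;30;30;30]; [:: 0;0;0;30;30;103;30;120;43;30;0;30];
      [:: 0;0;0;0;51;30;30;190;30;0;148]; [:: 0;0;0;0;0;30;30;104;0;114];
      [:: 0;0;0;0;0;0;30;0;30]; [:: 0;0;0;0;0;0;0;30]]%N.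

Lemma g_coef_b12_neq0 (R : realType) (a : R) i j : 2 * a ^+ 2 + 8 * a + 3 = 0 ->
  (0 < i)%N -> (i < j)%N -> (i + j <= 11)%N -> g_coef a i j != 0.
Proof.
move=> aE; have := b12_range aE; have a2 := b12_sqr aE => aR.
move: i j; apply: pairs1_upto11 => // [k _ _|p]; first exact: oner_neq0.
rewrite !inE; do ?[case/orP]; move=> /eqP -> /= _; rewrite /g_coef ?(b12_q aE) ?(b12E aE).
all: apply/eqP => h; case/orP: aR => /andP[l1 l2]; try lra.
Qed.

Lemma b_coef_eq0 (R : realType) b i j : (0 < i)%N -> (i < j)%N -> (i + j <= (b_dim b).-1)%N ->
  (b_coef R b i j == 0) = ((i, j) \in b_zeros b).
Proof.
have s10 : Num.sqrt 10 ^+ 2 = 10 :> R by rewrite sqr_sqrtr.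
case: b => i0 ij ijn; rewrite /b_coef; last first.
- rewrite in_nil; apply: negbTE; apply: g_coef_b12_neq0 => //.
  by apply: (@b12_root _ (- Num.sqrt 10)); rewrite sqrrN.
- by rewrite in_nil; apply: negbTE; apply: g_coef_b12_neq0 => //; apply: b12_root.
- move: i j i0 ij ijn; apply: pairs1_upto11 => // [k _ _|p]; first exact: negbTE (oner_neq0 _).
  have d : 2 * -3 + 5 = -1 :> R by ring.
  by rewrite !inE; do ?[case/orP]; move=> /eqP -> //= _; rewrite in_nil /g_coef ?d; apply/eqP; lra.
- move: i j i0 ij ijn; apply: pairs1_upto11 => // [k _ _|p]; first exact: negbTE (oner_neq0 _).
  have d : 2 * -1 + 5 = 3 :> R by ring.
  by rewrite !inE; do ?[case/orP]; move=> /eqP -> //= _; rewrite /g_coef ?d;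
  first [apply: negbTE; apply/eqP; lra|apply: (introT eqP); lra].
- move: i j i0 ij ijn; apply: pairs1_upto11 => // [k _ _|p]; first exact: negbTE (oner_neq0 _).
  by rewrite !inE; do ?[case/orP]; move=> /eqP -> //= _; rewrite in_nil /g_coef; apply/eqP; lra.
- move: i j i0 ij ijn; apply: pairs1_upto11 => // [k _ _|p]; first exact: negbTE (oner_neq0 _).
  by rewrite !inE; do ?[case/orP]; move=> /eqP -> //= _; rewrite in_nil oner_eq0.
Qed.

Lemma b_einstein (R : realType) b : einstein_nilradical (@b_bracket R b).
Proof.
have nil := b_nilpotent R b; have zE := @b_coef_eq0 R b; rewrite /b_bracket in nil *.
case: b nil zE => nil zE.
- apply: (central_einstein _ _ nil (Z := [::]) (s := 52) (mu := 11)
   (t := [:: [::]; [:: 0;0;5;16;20]; [:: 0;0;0;4;0;21]; [:: 0;0;0;0;4]])%N) => //.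
- apply: (central_einstein _ _ nil (Z := [::]) (s := 221) (mu := 37)
   (t := [:: [::]; [:: 0;0;2;87;90;3;2]; [:: 0;0;0;21;2;78;0;44]; [:: 0;0;0;0;2;0;2]; [:: 0;0;0;0;0;66]])%N) => //.
- apply: (central_einstein _ _ nil (Z := b_zeros B10_1) (s := 29) (mu := 4)
   (t := [:: [::]; [:: 0;0;3;3;3;3;4;3;6]; [:: 0;0;0;3;3;0;4;3;0;5]; [:: 0;0;0;0;4;6;0;0;4];
             [:: 0;0;0;0;0;3;0;3]; [:: 0;0;0;0;0;0;3]])%N) => //.
- apply: (central_einstein _ _ nil (Z := [::]) (s := 145) (mu := 20)
   (t := [:: [::]; [:: 0;0;14;14;18;21;18;26;14]; [:: 0;0;0;14;14;14;14;14;0;21];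
             [:: 0;0;0;0;18;14;14;0;25]; [:: 0;0;0;0;0;14;0;15]; [:: 0;0;0;0;0;0;14]])%N) => //.
- apply: (central_einstein _ _ nil (Z := [::]) (s := 675) (mu := 79) (t := b12_table)%N) => //.
- apply: (central_einstein _ _ nil (Z := [::]) (s := 675) (mu := 79) (t := b12_table)%N) => //.
Qed.

(** * Invariance of c_23 / c_34: the six algebras are pairwise non-isomorphic *)

Section Leading.
Variables (R : realType) (V : vectType R) (br : V -> V -> V) (D : seq nat).
Variables (C : nat -> nat -> R) (e : nat -> V).
Hypothesis (Du : uniq D) (lie : is_lie br) (gr : graded br D C e).
Local Notation co := (gcoord D e).
Local Notation low := (low D e).

Lemma low_lead k v : k \in D -> low k v -> low k.+1 (v - co k v *: e k).
Proof.
move=> kD lv b bD; rewrite ltnS leq_eqVlt => /orP[/eqP ->|bk].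
  by rewrite linearB linearZ /= (gcoord_e Du gr.1)// eqxx mulr1 subrr.
by apply: (lowB lv _ bD bk); apply/lowZ/(low_e Du gr).
Qed.

Lemma lowS k v : low k v -> (k \in D -> co k v = 0) -> low k.+1 v.
Proof.
by move=> lv v0 b bD; rewrite ltnS leq_eqVlt => /orP[/eqP bk|/lv]; [rewrite bk v0// -bk|exact].
Qed.

(** Passing to leading terms is multiplicative: terms above the leading ones only reach higher
    degrees. *)
Lemma gcoord_lead k l u v : k \in D -> l \in D -> (k + l)%N \in D -> low k u -> low l v ->
  co (k + l)%N (br u v) = co k u * co l v * C k l.
Proof.
move=> kD lD klD lu lv; have [br1 br2] := (lie_linearl lie, lie_linearr lie).
rewrite -[u in br u _](subrK (co k u *: e k)) (linear_funD _ _ (br1 v)) linearD /=.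
rewrite (low_br Du lie gr (low_lead kD lu) lv klD (leqnn _)) add0r.
rewrite (linear_funZ _ _ (br1 v)) linearZ /= (gcoord_brr Du lie gr)// mulrA.
by [].
Qed.
End Leading.

Section Distinct.
Variables (R : realType) (V : vectType R) (br : V -> V -> V) (n : nat).
Variables (C C' : nat -> nat -> R) (e f : nat -> V).
Local Notation D := (Bdegs n).
Hypotheses (n8 : (8 <= n)%N) (lie : is_lie br).
Hypotheses (gr : graded br D C e) (gr' : graded br D C' f).
Hypotheses (C1 : forall k, (2 <= k <= n.-2)%N -> C 1 k = 1).
Hypotheses (C1' : forall k, (2 <= k <= n.-2)%N -> C' 1 k = 1).
Hypothesis C2' : C' 2 n.-1 != 0.
Local Notation co := (gcoord D e).
Local Notation low := (low D e).

Let Du : uniq D. Proof. exact: Bdegs_uniq. Qed.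
Let inD k : (0 < k <= n.-1)%N -> k \in D. Proof. by rewrite mem_Bdegs => ->. Qed.
Let low1 v : low 1 v. Proof. by move=> a; rewrite mem_Bdegs; lia. Qed.

Let f_next k : (2 <= k <= n.-2)%N -> br (f 1%N) (f k) = f k.+1.
Proof.
move=> kn; rewrite gr'.2; [|by apply: inD; lia|by apply: inD; lia].
by rewrite inD ?C1'// ?scale1r// add1n; lia.
Qed.

(** The vector f_3 = [f_1, f_2] has no component in degree 2 because [e_1, e_1] = 0; each further
    bracket with f_1 raises the level. *)
Lemma new_low k : (3 <= k <= n.-1)%N -> low k (f k).
Proof.
elim: k => // -[|[|[|k]]] // IH kn; last first.
  rewrite -f_next; last lia.
  by apply: (low_br Du lie gr (k := 1) (l := k.+3)) => //; apply: IH; lia.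
have d1 : 1%N \in D by apply: inD; lia.
have d2 : (1 + 1)%N \in D by apply: inD; lia.
rewrite -f_next; last lia.
apply: lowS; first exact: (low_br Du lie gr (k := 1) (l := 1)).
move=> _; rewrite (gcoord_lead Du lie gr (k := 1) (l := 1))//.
have := graded_anti Du lie gr d1 d1 d2 => c11.
by rewrite (_ : C 1 1 = 0) ?mulr0//; lra.
Qed.

(** A vanishing leading coefficient at f_k would propagate under brackets with f_1 up to f_(n-1). As
    degree n is missing, f_(n-1) would then lie in degree n + 1 and commute with f_2, against
    C'_(2,n-1) being nonzero. *)
Lemma new_lead_neq0 k : (3 <= k <= n.-1)%N -> co k (f k) != 0.
Proof.
move=> kn; apply/eqP => ck0.
have lowk : low k.+1 (f k) by apply: lowS => //; exact: new_low.
have high m : (k + m <= n.-1)%N -> low (k + m).+1 (f (k + m)%N).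
  elim: m => [|m IH] km; first by rewrite addn0.
  rewrite addnS -f_next; last lia.
  by apply: (low_br Du lie gr (k := 1) (l := (k + m).+1)) => //; apply: IH; lia.
have := high (n.-1 - k)%N; rewrite (_ : (k + (n.-1 - k) = n.-1)%N); last lia.
rewrite (_ : n.-1.+1 = n); last lia.
move=> /(_ ltac:(lia)) lown.
have lown1 : low n.+1 (f n.-1).
  by apply: lowS => //; rewrite mem_Bdegs; lia.
have f0 : br (f 2%N) (f n.-1) = 0.
  apply: (low_eq0 Du gr (k := n.+2)); first by move=> a; rewrite mem_Bdegs; lia.
  exact: (low_br Du lie gr (k := 1) (l := n.+1)).
have nE : (2 + n.-1 = n.+1)%N by lia.
have nD : n.+1 \in D by rewrite mem_Bdegs; lia.
move/eqP: f0; rewrite gr'.2; [|by apply: inD; lia|by apply: inD; lia].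
by rewrite nE nD scaler_eq0 (negPf C2') (negPf (e_neq0 Du gr' nD)).
Qed.

(* The leading coefficients of the new basis are p at e_1, r at e_2 and p^(k-2) r at e_k. *)
Lemma graded_ratio : C 2 3 * C' 3 4 = C' 2 3 * C 3 4.
Proof.
have lead k l u v : (0 < k)%N -> (0 < l)%N -> (k + l <= n.-1)%N -> low k u -> low l v ->
    co (k + l)%N (br u v) = co k u * co l v * C k l.
  by move=> k0 l0 kl; apply: (gcoord_lead Du lie gr); apply: inD; lia.
set p := co 1 (f 1%N); set r := co 2 (f 2%N).
(* The bracket [f_2, f_(n-2)] has weight n, which is not a degree, so it is zero; an e_1-component
   of f_2 would give it a nonzero coordinate at e_(n-1). *)
have s0 : co 1 (f 2%N) = 0.
  have nlow : low (n - 2)%N (f (n - 2)%N) by apply: new_low; lia.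
  have n1 : (1 + (n - 2) = n.-1)%N by lia.
  have := lead 1 (n - 2)%N (f 2%N) (f (n - 2)%N) isT ltac:(lia) ltac:(lia) (low1 _) nlow.
  rewrite C1; last lia.
  rewrite gr'.2; [|by apply: inD; lia|by apply: inD; lia].
  have -> : (2 + (n - 2))%N \in D = false by rewrite mem_Bdegs; lia.
  rewrite linear0 mulr1 => /esym/eqP; rewrite mulf_eq0 => /orP[/eqP//|].
  by rewrite (negPf (new_lead_neq0 _))//; lia.
have low2 : low 2 (f 2%N) by apply: lowS => //.
have lowk k : (2 <= k <= n.-1)%N -> low k (f k).
  by move=> kn; have [k2|k2] := eqVneq k 2%N; [rewrite k2|apply: new_low; lia].
have ck k : (k.+2 <= n.-1)%N -> co k.+2 (f k.+2) = p ^+ k * r.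
  elim: k => [|k IH] kn; first by rewrite mul1r.
  rewrite -f_next; last lia.
  rewrite (lead 1 k.+2 _ _ isT isT kn (low1 _) (lowk k.+2 ltac:(lia))).
  rewrite C1; last lia.
  by rewrite IH; [rewrite mulr1 mulrA -exprS|lia].
have c3 : p * r != 0 by have := new_lead_neq0 (k := 3); rewrite (ck 1); [apply; lia|lia].
have [p0 r0] : p != 0 /\ r != 0 by move: c3; rewrite mulf_eq0 negb_or => /andP.
have rel k l : (2 <= k)%N -> (2 <= l)%N -> (k + l <= n.-1)%N -> r * C k l = C' k l * p ^+ 2.
  move=> k2 l2 kl; have := lead k l (f k) (f l) ltac:(lia) ltac:(lia) kl (lowk k ltac:(lia)) (lowk l ltac:(lia)).
  rewrite gr'.2; [|by apply: inD; lia|by apply: inD; lia].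
  rewrite inD; last lia.
  rewrite linearZ /=.
  have [k' kE] : exists k', k = k'.+2 by exists (k - 2)%N; lia.
  have [l' lE] : exists l', l = l'.+2 by exists (l - 2)%N; lia.
  have klE : (k + l = (k' + l' + 2).+2)%N by lia.
  rewrite klE (ck (k' + l' + 2)%N); last lia.
  rewrite kE lE (ck k'); last lia.
  rewrite (ck l'); last lia.
  move=> h; have q0 : p ^+ k' * p ^+ l' * r != 0 by rewrite !mulf_neq0// expf_neq0.
  by apply: (mulfI q0); move: h; rewrite !exprD => h; lra.
have h1 := rel 2 3 isT isT ltac:(lia); have h2 := rel 3 4 isT isT ltac:(lia).
have q0 : r * p ^+ 2 != 0 by rewrite mulf_neq0// expf_neq0.
apply: (mulfI q0).
have -> : r * p ^+ 2 * (C 2 3 * C' 3 4) = (r * C 2 3) * (C' 3 4 * p ^+ 2) by ring.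
by rewrite h1 -h2; ring.
Qed.
End Distinct.

Lemma b_dim_bound b : (6 <= b_dim b)%N /\ ~~ odd (b_dim b).
Proof. by case: b. Qed.

(** The dimension leaves only the pairs in dimensions 10 and 12. There c_34 = 1, so that the
    invariant ratio is 2 + alpha. *)
Lemma b_inj (R : realType) b b' : lie_isom (@b_bracket R b) (@b_bracket R b') -> b = b'.
Proof.
move=> iso; have [n6 ne] := b_dim_bound b; have [n6' ne'] := b_dim_bound b'.
have [lie _] := b_nilpotent R b.
have [e gr] := central_graded (b_coef R b) n6 ne.
have [u ub] := iso_sc_basis iso.
have gr' := central_sc_graded n6' ne' (lie_alt lie) (fun x y => lie_anti lie y x) ub.
have dimE : b_dim b = b_dim b'.
  have := size_degrees gr.1; have := size_degrees gr'.1; rewrite !size_rcons !size_iota; lia.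
have [E|E] := leqP 8 (b_dim b); last by case: (b) (b') dimE E => -[].
rewrite -dimE in gr'.
have one c k : c = b \/ c = b' -> (2 <= k <= (b_dim b).-2)%N ->
    Bcoef (b_dim b) (alt_coef (b_coef R c)) 1 k = 1.
  move=> cE kn; have -> : Bcoef (b_dim b) (alt_coef (b_coef R c)) 1 k = alt_coef (b_coef R c) 1 k.
    by rewrite /Bcoef; have -> : (1 + k == (b_dim b).+1)%N = false by lia.
  rewrite alt_coef_lt; last lia.
  by case: (c).
have top : Bcoef (b_dim b) (alt_coef (b_coef R b')) 2 (b_dim b).-1 != 0.
  rewrite /Bcoef; have -> : (2 + (b_dim b).-1 == (b_dim b).+1)%N by lia.
  by rewrite sqrrN expr1n oner_neq0.
have := graded_ratio E lie gr gr' (fun k => one b k (or_introl erefl))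
  (fun k => one b' k (or_intror erefl)) top.
have s0 : Num.sqrt 10 != 0 :> R by rewrite sqrtr_eq0 -ltNge ltr0n.
case: (b) (b') dimE => -[] //= _; rewrite /Bcoef /alt_coef /= /g_coef !mulr1 => h.
- exfalso; lra.
- exfalso; lra.
- by exfalso; move/eqP: s0; apply; lra.
- by exfalso; move/eqP: s0; apply; lra.
Qed.

Lemma classB2_iff (R : realType) (V : vectType R) (br : V -> V -> V) :
  (exists n, classB2 br n) <-> (exists b : b_algebra, lie_isom br (@b_bracket R b)).
Proof.
split=> [[n clB]|[b iso]].
  have [lie [n6 [ne _]]] := clB.
  have [e [c [gr cn0]]] := classB2_graded lie n6 ne clB.
  exact: classB2_iso_b gr cn0.
have lie := lie_isom_is_lie iso (b_nilpotent R b).1.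
have [n6 ne] := b_dim_bound b; have [u ub] := iso_sc_basis iso.
exists (b_dim b); apply: (sc_basis_B2 lie n6 ne ub).
  by move=> j _; case: (b).
by case: (b) => /=; [exists 2, 3|exists 3, 4..]; split; rewrite //= oner_eq0.
Qed.

Theorem theorem2 (R : realType) :
  (forall (V : vectType R) (br : V -> V -> V) (n : nat),
     filiform br -> classA2 br n -> (8 <= n)%N ->
     (einstein_nilradical br <->
        lie_isom br (@V_bracket R n) \/
        (exists a : R, a <> -2 /\ lie_isom br (@g_bracket R a 8)) \/
        (exists a : R,
           [/\ a <> - (5 / 2), a <> -2 & lie_isom br (@g_bracket R a 9)]) \/
        (exists a : R,
           a <> - (5 / 2) /\
           [/\ a <> -2, a <> -1, a <> 1 / 2 &
               lie_isom br (@g_bracket R a 10)]) \/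
        (exists a : R,
           [/\ a <> -3, a <> - (5 / 2), a <> -1 &
               lie_isom br (@g_bracket R a 11)]))) /\
  (forall (V : vectType R) (br : V -> V -> V),
     (exists n, classB2 br n) <->
     (exists b : b_algebra, lie_isom br (@b_bracket R b))) /\
  (forall b b' : b_algebra,
     lie_isom (@b_bracket R b) (@b_bracket R b') -> b = b') /\
  (forall b : b_algebra, einstein_nilradical (@b_bracket R b)).
Proof.
split; first by move=> V br n; exact: classA2_einstein.
split; first by move=> V br; exact: classB2_iff.
by split; [exact: b_inj|exact: b_einstein].
Qed.
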